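(* Let $Y_1,\dots,Y_n$ be independent, let $\theta_0$ be the point $\theta_0=\arg\max_{\theta\in\Theta}\sum_i\{b_i\Psi_i^\top\theta-d(\Psi_i^\top\theta)\}$ with $b_i=\mathbf EY_i$, and let there exist $\lambda_1^*>0$ and values $\mathfrak n_i>0$ such that $$\log\mathbf E\exp\Bigl\{2\lambda\frac{Y_i-b_i}{\mathfrak n_i}\Bigr\}\le2\lambda^2,\qquad|\lambda|\le\lambda_1^*,\ i\le n .$$ Let, additionally, for some $\mu>0$ and all $\theta\in\Theta$ $$\mu\,\mathfrak n_i|\Psi_i^\top(\theta-\theta_0)|\le\lambda_1^*,\qquad i\le n,$$ and, with $V_1=\sum_i\mathfrak n_i^2\Psi_i\Psi_i^\top$, $V=\mu^2V_1$ and some $\lambda^*>0$, $$\sup_{\gamma\in S^p}\lambda^*\frac{\mathfrak n_i|\gamma^\top\Psi_i|}{(\gamma^\top V_1\gamma)^{1/2}}\le\lambda_1^*,\qquad i\le n.$$ Fix any $\varrho\in(0,1)$ and $\epsilon>0$ with $\varrho\epsilon/(1-\varrho)\le\lambda^*$. (1) Let $\varkappa$ be a monotonically decreasing positive function on $[0,\infty)$ with $$\mathfrak P^*:=\omega_p^{-1}\int_{\mathbb R^p}\varkappa(\|z\|)\,dz=p\int_0^\infty\varkappa(t)t^{p-1}dt<\infty,$$ and define $\mathrm{pen}(\theta)=-\varrho^{-1}\log\varkappa\bigl(\epsilon^{-1}\|\sqrt V(\theta-\theta_0)\|+1\bigr)$. Then $$\log\mathbf E\exp\Bigl\{\sup_{\theta\in\Theta}\varrho\bigl[\mathcal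 L(\theta,\theta_0)+\mathfrak M(\theta,\theta_0)-\mathrm{pen}(\theta)\bigr]\Bigr\}\le\frac{2\epsilon^2\varrho^2}{1-\varrho}+(1-\varrho)\mathbb Q_p+\log\mathfrak P^* .$$ (2) Let also there exist $\mathfrak a>0$ such that $\mathfrak M(\theta,\theta_0)\ge\mathfrak a^2(\theta-\theta_0)^\top V(\theta-\theta_0)$ for all $\theta\in\Theta$. For $0<\mathfrak a_1\le\mathfrak a$ and $s=1-\mathfrak a_1^2/\mathfrak a^2$ put $$\mathfrak Q(\varrho,s)=\mathbf E\exp\Bigl\{\varrho\sup_{\theta\in\Theta}\bigl[\mathcal L(\theta,\theta_0)+\mathfrak M(\theta,\theta_0)-\mathfrak a_1^2(\theta-\theta_0)^\top V(\theta-\theta_0)\bigr]\Bigr\}.$$ Then $$\mathbf P\bigl(\mathfrak M(\tilde\theta,\theta_0)>\mathfrak z\bigr)\le\mathfrak Q(\varrho,s)e^{-\varrho s\mathfrak z},\qquad\log\mathfrak Q(\varrho,s)\le p\,C(\varrho)+p\log\bigl(|\mathfrak a^2(1-s)(1-\varrho)|^{-1/2}\bigr)$$ for every $\mathfrak z>0$, with a fixed constant $C(\varrho)$, and for the confidence set $\mathcal E(\mathfrak z)=\{\theta\in\Theta:\mathcal L(\tilde\theta,\theta)\le\mathfrak z\}$ it holds, with $\mathfrak Q(\varrho)=\mathfrak Q(\varrho,0)$, $$\mathbf P\bigl(\theta_0\notin\mathcal E(\mathfrak z)\bigr)\le\mathfrak Q(\varrho)e^{-\varrho\mathfrak z}.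$$
   Context: Generalized linear quasi-likelihood. $Y_1,\dots,Y_n$ are real observations with joint law $\mathbf P$ (expectation $\mathbf E$); they need not follow any exponential-family model. $\Psi_1,\dots,\Psi_n\in\mathbb R^p$ are deterministic, $\Theta\subseteq\mathbb R^p$, and $d(\cdot)$ is the given (smooth) convex function of a canonical exponential family with log-likelihood $y\upsilon-d(\upsilon)+\ell(y)$. For $\mu>0$, $$\mathcal L(\theta)=\mu\sum_i\{Y_i\Psi_i^\top\theta-d(\Psi_i^\top\theta)\},\quad\mathcal L(\theta,\theta')=\mathcal L(\theta)-\mathcal L(\theta'),\quad\tilde\theta=\arg\max_{\theta\in\Theta}\mathcal L(\theta),$$ and $\mathfrak M(\theta,\theta_0)=-\log\mathbf E\exp\{\mathcal L(\theta,\theta_0)\}$. $S^p$ is the set of unit vectors of $\mathbb R^p$. $\omega_p$ is the volume of the Euclidean unit ball of $\mathbb R^p$, and $\mathbb Q_p=\sum_{k\ge1}2^{-k}\log N_p(2^{-k})$ is its entropy number, where $N_p(\delta)$ is the minimal number of Euclidean balls of radius $\delta$ needed to cover the unit ball.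
   Formalization: The bound on log Q(ϱ,s) is proved for 𝔞₁ up to an arbitrary fixed bound, and C(ϱ) may depend on that bound; with C depending on ϱ alone it fails, since Q ≥ 1 while the right side tends to −∞ as 𝔞₁ grows (e.g. Θ={θ₀}). *)

(* Defs.v *)
From HB Require Import structures.
From mathcomp Require Import all_boot all_order all_algebra.
From mathcomp Require Import all_classical all_reals all_analysis.

Set Implicit Arguments.
Unset Strict Implicit.
Unset Printing Implicit Defensive.

Import Order.TTheory GRing.Theory Num.Theory.
Import numFieldNormedType.Exports.

Local Open Scope classical_set_scope.
Local Open Scope ring_scope.

(** * Euclidean structure of R^p *)

Section euclidean.
Context {R : realType} {p : nat}.
Implicit Types (u v : 'cV[R]_p) (A S : 'M[R]_p).

Definition dotp u v : R := (u^T *m v) 0 0.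

(* The norm that the library puts on matrices is the maximum norm. *)
Definition enorm u : R := Num.sqrt (dotp u u).

Definition unit_sphere : set 'cV[R]_p := [set u | enorm u = 1].

Definition qform A u : R := (u^T *m A *m u) 0 0.

Definition is_sqrtmx A S : Prop :=
  [/\ S^T = S, forall u, 0 <= qform S u & S *m S = A].

End euclidean.

(** * Lebesgue measure on R^p, carried by the measurable space of p-tuples *)

Section lebesgue_tuple_step.
Context {R : realType} {p : nat}.
Local Notation mR := (measurableTypeR R).
Variable m : {sigma_finite_measure set (p.-tuple mR) -> \bar R}.

Let tcons (x : mR * p.-tuple mR) : p.+1.-tuple mR := [tuple of x.1 :: x.2].

Definition lebesgue_tupleS : set (p.+1.-tuple mR) -> \bar R :=
  pushforward (lebesgue_measure \x m)%E tcons.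

Let measurable_tcons : measurable_fun [set: mR * p.-tuple mR] tcons.
Proof. exact: measurable_cons. Qed.

Let lebesgue_tupleS0 : lebesgue_tupleS set0 = 0%E.
Proof. by rewrite /lebesgue_tupleS /pushforward preimage_set0 measure0. Qed.

Let lebesgue_tupleS_ge0 A : (0 <= lebesgue_tupleS A)%E.
Proof. exact: measure_ge0. Qed.

Let lebesgue_tupleS_sigma_additive : semi_sigma_additive lebesgue_tupleS.
Proof.
move=> F mF tF mUF; rewrite /lebesgue_tupleS /pushforward preimage_bigcup.
apply: measure_semi_sigma_additive.
- by move=> n; rewrite -[X in measurable X]setTI; exact: measurable_tcons.
- apply/trivIsetP => /= i j _ _ ij; rewrite -preimage_setI.
  by move/trivIsetP : tF => /(_ _ _ _ _ ij) ->//; rewrite preimage_set0.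
- by rewrite -preimage_bigcup -[X in measurable X]setTI; exact: measurable_tcons.
Qed.

HB.instance Definition _ := isMeasure.Build _ _ _ lebesgue_tupleS
  lebesgue_tupleS0 lebesgue_tupleS_ge0 lebesgue_tupleS_sigma_additive.

Let lebesgue_tupleS_sigma_finite : sigma_finite setT lebesgue_tupleS.
Proof.
have [F TF Foo] : sigma_finite setT (lebesgue_measure \x m)%E.
  have /sigma_finiteP[F [TF ndF Foo]] := sigma_finiteT (@lebesgue_measure R).
  have /sigma_finiteP[G [TG ndG Goo]] := sigma_finiteT m.
  exists (fun k => F k `*` G k).
    rewrite -setXTT TF TG predeqE => -[x y]; split.
      move=> [/= [i _ Fx] [j _ Gy]]; exists (maxn i j) => //; split.
      - by move: x Fx; exact/subsetPset/ndF/leq_maxl.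
      - by move: y Gy; exact/subsetPset/ndG/leq_maxr.
    by move=> [k _ []/= ? ?]; split; exists k.
  move=> k; have [? ?] := Foo k; have [? ?] := Goo k.
  split; first exact: measurableX.
  by rewrite product_measure1E// lte_mul_pinfty// ge0_fin_numE.
pose untcons (t : p.+1.-tuple mR) : mR * p.-tuple mR := (thead t, [tuple of behead t]).
have untconsK x : untcons (tcons x) = x.
  by case: x => x t; congr pair; apply/val_inj.
have tconsK t : tcons (untcons t) = t.
  by apply/val_inj => /=; case/tupleP: t.
have muntcons : measurable_fun setT untcons.
  apply/measurable_fun_pairP; split; first exact: measurable_tnth.
  exact: measurable_behead.
exists (fun k => untcons @^-1` F k).
  by rewrite -preimage_bigcup -TF preimage_setT.
move=> k; have [mFk Fk] := Foo k; split.
  by rewrite -[X in measurable X]setTI; exact: muntcons.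
rewrite /lebesgue_tupleS /pushforward.
rewrite (_ : _ @^-1` _ = F k)//.
by apply/seteqP; split => x /=; rewrite untconsK.
Qed.

HB.instance Definition _ := Measure_isSigmaFinite.Build _ _ _ lebesgue_tupleS
  lebesgue_tupleS_sigma_finite.

Lemma lebesgue_tupleSE (A : set R) (B : set (p.-tuple mR)) :
  measurable A -> measurable B ->
  lebesgue_tupleS [set t | A (thead t) /\ B [tuple of behead t]] =
  (lebesgue_measure A * m B)%E.
Proof.
move=> mA mB; rewrite -product_measure1E//; congr product_measure1.
apply/seteqP; split => -[x t] /=; rewrite theadE;
  by rewrite (_ : [tuple of _] = t) //; apply/val_inj.
Qed.

End lebesgue_tuple_step.

Fixpoint lebesgue_tuple {R : realType} (p : nat) :
    {sigma_finite_measure set (p.-tuple (measurableTypeR R)) -> \bar R} :=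
  if p is p'.+1 then lebesgue_tupleS (lebesgue_tuple p')
  else \d_([tuple] : 0.-tuple (measurableTypeR R)).

(** * Volume and entropy number of the Euclidean unit ball *)

Section unit_ball.
Context {R : realType} (p : nat).
Local Open Scope ereal_scope.

Definition cV_of_tuple (z : p.-tuple (measurableTypeR R)) : 'cV[R]_p :=
  \col_i tnth z i.

Definition ball_volume : \bar R :=
  lebesgue_tuple p [set z | (enorm (cV_of_tuple z) <= 1)%R].

(* Balls are closed, and their centers may lie outside the unit ball. *)
Definition ball_coverable (delta : R) (m : nat) : Prop :=
  exists c : 'I_m -> 'cV[R]_p,
    forall u, (enorm u <= 1)%R -> exists i, (enorm (u - c i)%R <= delta)%R.

Definition covering_number (delta : R) : R :=
  inf [set m%:R | m in ball_coverable delta].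

Definition entropy_number : \bar R :=
  \sum_(1 <= k <oo) (2^-1 ^+ k * ln (covering_number (2^-1 ^+ k)))%R%:E.

Definition radial_mass (kappa : R -> R) : \bar R :=
  ball_volume^-1 * \int[lebesgue_tuple p]_z (kappa (enorm (cV_of_tuple z)))%:E.

End unit_ball.

(** * Probabilistic and statistical notions *)

Section model.
Context {disp : measure_display} {T : measurableType disp} {R : realType}.
Variable P : probability T R.

Definition mutually_independent (n : nat) (Y : 'I_n -> T -> R) : Prop :=
  forall (J : {set 'I_n}) (B : 'I_n -> set R), (forall i, measurable (B i)) ->
    (P (\bigcap_(i in [set i | i \in J]) (Y i @^-1` B i)) =
     \prod_(i in J) P (Y i @^-1` B i))%E.

Section quasi_likelihood.
Context {n p : nat}.
Variables (mu : R) (d : R -> R) (Psi : 'I_n -> 'cV[R]_p) (Y : 'I_n -> T -> R).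

Definition quasi_lik (theta : 'cV[R]_p) (w : T) : R :=
  mu * \sum_i (Y i w * dotp (Psi i) theta - d (dotp (Psi i) theta)).

Definition quasi_llr (theta theta' : 'cV[R]_p) (w : T) : R :=
  quasi_lik theta w - quasi_lik theta' w.

Definition rate (theta theta0 : 'cV[R]_p) : \bar R :=
  (- lne 'E_P[fun w => expR (quasi_llr theta theta0 w)])%E.

Definition conf_set (Theta : set 'cV[R]_p) (theta_hat : T -> 'cV[R]_p) (z : R) (w : T) :
    set 'cV[R]_p :=
  [set theta | Theta theta /\ quasi_llr (theta_hat w) theta w <= z].

End quasi_likelihood.
End model.

(* The densities y v - d v + ell y are taken with respect to some
   sigma-finite measure; [U] is the set of natural parameters. *)
Definition canonical_expfam (R : realType) (U : set R) (d : R -> R) : Prop :=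
  exists (nu : {sigma_finite_measure set (measurableTypeR R) -> \bar R})
         (ell : measurableTypeR R -> R),
    measurable_fun setT ell /\
    forall v, U v ->
      (\int[nu]_y (expR (y * v - d v + ell y))%:E = 1)%E.

Definition smooth_on (R : realType) (U : set R) (f : R -> R) : Prop :=
  forall (k : nat) (v : R), U v -> derivable (derive1n k f) v 1.

Definition is_argmax (X : Type) (R : realType) (A : set X) (f : X -> R) (x : X) :
    Prop :=
  A x /\ forall y, A y -> f y <= f x.

(* Main.v *)
(** Write [u = sqrtV (theta - theta0)], [X_i = (Y_i - b_i) / n_i] and
    [t_i(u) = mu n_i Psi_i^T (theta - theta0)].  Then [sum_i t_i(u)^2 = |u|^2], and
    [L + M = sum_i (X_i t_i(u) - g_i(t_i(u))) =: xi(u)], where [g_i] is the logarithm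
    of the moment generating function of [X_i], a convex function with
    [0 <= g_i(y) <= y^2/2].

    Let [B] be a symmetric convex body on which the [t_i] and [|.|] are small.  For
    [u] in [a + B] replace every [t_i(u)] by an anchor [t'_i] that depends only on [a]
    (a proximal point of [g_i]), and [g_i] by its tangent at [t'_i], of slope [G_i]:
      [rho xi(u) <= rho A + (1 - rho) C(u)],
    where [A] is the log-likelihood ratio at the anchors, so [E e^A = 1], and [C(u)] is
    affine in [u].  By Jensen and the symmetry of [B], [e^C(u)] is at most [(7/2)^p]
    times an average over [B] of exponentials; this bound [S] does not depend on [u]
    and [E S <= beta := (7/2)^p e^(2 eps^2 rho^2 / (1 - rho)^2)].  Convexity of the
    exponential gives [E sup_(u in a + B) e^(rho xi(u)) <= beta^(1 - rho)], and
    integrating over [a] against Lebesgue measure yields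
      [E sup_u e^(rho xi(u) + phi(u)) <= beta^(1 - rho) / vol B * int psi(a) da]
    whenever [phi(u) <= log psi(a)] for [u] in [a + B].

    Part (1) takes for [B] the ball of radius [eps]; comparing volumes,
    [N_p(2^-k) >= 2^(k p)], so the entropy number is at least [p log (7/2)].
    Part (2) takes the ball of radius [sqrt p] cut by the slabs [|t_i| <= const]
    and a Gaussian [psi]; the probability bounds are then Markov's inequality. *)

Require Import Defs.
From HB Require Import structures.
From mathcomp Require Import all_boot all_order all_algebra.
From mathcomp Require Import all_classical all_reals all_analysis.
From mathcomp Require Import measurable_realfun.
From mathcomp Require Import ring lra.

Set Implicit Arguments.
Unset Strict Implicit.
Unset Printing Implicit Defensive.

Import Order.TTheory GRing.Theory Num.Theory.
Import numFieldNormedType.Exports.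

Local Open Scope classical_set_scope.
Local Open Scope ring_scope.

(** * Anchors of a convex function *)

(** The moment bound controls [g i] only for |y| <= 2L, with L = [lambda1], while k = (1 - rho)/rho
    may be arbitrarily small: every quotient by k has to be kept inside this interval. Anchoring at
    t_i(a) itself would moreover leave a linear term G_i t_i(v)/k in the logarithm of E e^C, and its
    sum over i grows with a. At a proximal point the displacement tau = (t_i(a) - t'_i)/k equals the
    slope, and y^2/2 - tau y <= (y - tau)^2/2: the drift cancels and the bound depends on the body
    alone. Moving the anchor to keep the exponents in the domain costs only a constant in front of
    the square.

    The factor 7/2, inverse of the step 2/7, must be paid by the entropy number. As the sum of k
    2^(-k) is 2, volumes bound that number below by p log 4, so every factor smaller than 4 is
    reached by finitely many terms. *)

Lemma subgradient_bound (R : realType) (g : R -> R) (L t G : R) : 0 < L ->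
  (forall y, `|y| <= 2 * L -> 0 <= g y <= y ^+ 2 / 2) -> `|t| <= L ->
  (forall s, `|s| <= 2 * L -> g t + G * (s - t) <= g s) -> `|G| <= 2 * L.
Proof.
move=> L0 gb; rewrite !ler_norml => /andP[tl tu] hG.
have tL : `|t| <= 2 * L by rewrite ler_norml; apply/andP; split; lra.
have /andP[g0 _] := gb _ tL.
have L2 : `|2 * L| <= 2 * L by rewrite ler_norml; apply/andP; split; lra.
have L2' : `|- (2 * L)| <= 2 * L by rewrite normrN.
have /andP[_ ga] := gb _ L2; have /andP[_ gc] := gb _ L2'.
(* Both endpoints 2L and -2L are at distance at least L from [t], and the rise of [g] towards them
   is at most 2L^2. *)
have h1 := hG _ L2; have h2 := hG _ L2'.
rewrite leNgt [_ <= 2 * L]leNgt; apply/andP; split; apply/negP => h; nra.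
Qed.

(** Bounded slopes make [g] Lipschitz with constant 2L; continuity provides the minimizer of the
    proximal problem. *)
Lemma subgradient_continuous (R : realType) (g : R -> R) (L : R) : 0 < L ->
  (forall y, `|y| <= 2 * L -> 0 <= g y <= y ^+ 2 / 2) ->
  (forall t, `|t| <= L ->
    exists G, forall s, `|s| <= 2 * L -> g t + G * (s - t) <= g s) ->
  {within `[- L, L], continuous g}.
Proof.
move=> L0 gb sub.
have lip x y : `|x| <= L -> `|y| <= L -> g x - g y <= 2 * L * `|x - y|.
  move=> xL yL; have [G hG] := sub _ xL.
  have GL := subgradient_bound L0 gb xL hG.
  have /hG : `|y| <= 2 * L by lra.
  have : G * (x - y) <= 2 * L * `|x - y|.
    by rewrite (le_trans (ler_norm _))// normrM ler_wpM2r.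
  lra.
have lip2 x y : `|x| <= L -> `|y| <= L -> `|g x - g y| <= 2 * L * `|x - y|.
  move=> xL yL; rewrite ler_norml; apply/andP; split; last exact: lip.
  by rewrite lerNl opprB distrC lip.
apply/subspace_continuousP => x /= /[!in_itv]/= xL.
have {}xL : `|x| <= L by rewrite ler_norml.
apply/cvgrPdist_lt => e e0; rewrite near_withinE.
near=> y => /=; rewrite in_itv /= => yL; have {}yL : `|y| <= L by rewrite ler_norml.
rewrite (le_lt_trans (lip2 _ _ xL yL))//.
rewrite -ltr_pdivlMl; last lra.
near: y; apply: cvgr_dist_lt => //; rewrite mulr_gt0// invr_gt0; lra.
Unshelve. all: by end_near. Qed.

(* [t0] minimizes [g t + (t - alpha) ^ 2 / (2 k)] over [[-L, L]]; at such a point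
   [(alpha - t0) / k] is a subgradient relative to that interval. *)
Lemma prox_point (R : realType) (g : R -> R) (L k alpha : R) :
  0 < L -> 0 < k ->
  (forall y, `|y| <= 2 * L -> 0 <= g y <= y ^+ 2 / 2) ->
  (forall t, `|t| <= L ->
    exists G, forall s, `|s| <= 2 * L -> g t + G * (s - t) <= g s) ->
  exists2 t0, `|t0| <= L &
  forall t, `|t| <= L -> g t0 + (alpha - t0) / k * (t - t0) <= g t.
Proof.
move=> L0 k0 gb sub; pose phi t := g t + (t - alpha) ^+ 2 / (2 * k).
have [t0] : exists2 c : R, c \in `[- L, L] &
    forall t : R, t \in `[- L, L] -> phi c <= phi t.
  have LL : - L <= L by lra.
  apply: (EVT_min LL).
  have cg := subgradient_continuous L0 gb sub.
  move=> x; apply: (@continuousD _ R^o _ (g : subspace `[- L, L] -> R)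
    (fun t : subspace `[- L, L] => (t - alpha) ^+ 2 / (2 * k))); first exact: cg.
  have : {within `[- L, L], continuous (fun t => (t - alpha) ^+ 2 / (2 * k))}.
    apply: continuous_subspaceT => y.
    apply: cvgM; last exact: cvg_cst.
    under eq_fun do rewrite expr2.
    by rewrite expr2; apply: cvgM; (apply: cvgB; [exact: cvg_id|exact: cvg_cst]).
  exact.
rewrite in_itv /= => t0L mint0; exists t0; first by rewrite ler_norml.
move=> t tL; set D := g t - g t0 - (alpha - t0) / k * (t - t0).
suff : 0 <= D by rewrite /D; lra.
rewrite leNgt; apply/negP => D0.
pose q := (t - t0) ^+ 2 / (2 * k).
have q0 : 0 <= q by rewrite /q divr_ge0 ?sqr_ge0//; lra.
(* Step length from [t0] towards [t]: minimality of [t0] gives D + s q >= 0, whereas this choice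
   makes D + s q = s D < 0. *)
pose s := - D / (q - D).
have s01 : 0 < s <= 1.
  by rewrite /s divr_gt0 ?oppr_gt0//=; [rewrite ler_pdivrMr; lra|lra].
have sq : s * (q - D) = - D by rewrite /s divfK//; apply/eqP; lra.
pose p := t0 + s * (t - t0).
have tL' := tL; move: tL'; rewrite ler_norml => /andP[ta tb].
move: t0L => /andP[t0a t0b]; move: s01 => /andP[s0 s1].
have pL : - L <= p <= L by rewrite /p; apply/andP; split; nra.
have pL' : `|p| <= L by rewrite ler_norml.
have [G hG] := sub _ pL'.
have tL2 : `|t| <= 2 * L by lra.
have t0L2 : `|t0| <= 2 * L by rewrite ler_norml; apply/andP; split; lra.
have h1 := hG _ tL2; have h2 := hG _ t0L2.
have gp : g p <= (1 - s) * g t0 + s * g t.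
  have e : (1 - s) * (t0 - p) + s * (t - p) = 0 by rewrite /p; ring.
  have h3 : (1 - s) * (g p + G * (t0 - p)) <= (1 - s) * g t0.
    by rewrite ler_wpM2l//; lra.
  have h4 : s * (g p + G * (t - p)) <= s * g t by rewrite ler_wpM2l//; lra.
  have e2 : (1 - s) * (g p + G * (t0 - p)) + s * (g p + G * (t - p))
    = g p + G * ((1 - s) * (t0 - p) + s * (t - p)) by ring.
  rewrite e mulr0 addr0 in e2; lra.
have := mint0 p; rewrite in_itv /= => /(_ pL).
rewrite /phi => mp.
have e3 : (p - alpha) ^+ 2 / (2 * k) = (t0 - alpha) ^+ 2 / (2 * k)
   - s * ((alpha - t0) / k * (t - t0)) + s * (s * q).
  by rewrite /p /q; field; lra.
have h5 : 0 <= s * (D + s * q) by rewrite /D; lra.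
have : 0 <= D + s * q by rewrite -(pmulr_rge0 _ s0).
nra.
Qed.

(* [t'] is the anchor and [G] the slope at it.  With step [h = 2/7], the constant
   [2/5] is [h / (1 - h)], so that averaging over [B] with weights [5/7] and [2/7]
   keeps the exponents in the domain of [g]; [50/49] is [2 (1 - h)^2], which bounds
   the averaged exponents by [2 t^2 / k^2]. *)
Definition anchored (R : realType) (g : R -> R) (L k alpha t' G : R) := [/\ `|t'| <= L,
  forall t, `|t| <= L -> g t' + G * (t - t') <= g t,
  forall y, y ^+ 2 / 2 - G * y <= 50 / 49 * (y - (alpha - t') / k) ^+ 2 &
  forall t x, `|t| <= L -> `|t - alpha| <= k * L -> `|x| <= L ->
    `|(t - t') / k + 2 / 5 * x| <= 2 * L].

(** For fixed [y] the left side is affine in [G], so the extreme slopes decide: [tau] if y >= 0,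
    10/3 [tau] if y < 0; there the claim is a nonnegative quadratic form. The ratio 10/3 is 2L, the
    largest slope, over 3L/5, the smallest possible [tmax] below. *)
Lemma slope_quadratic (R : realType) (tau G y : R) :
  (0 <= tau /\ tau <= G <= 10 / 3 * tau) ->
  y ^+ 2 / 2 - G * y <= 50 / 49 * (y - tau) ^+ 2.
Proof.
move=> [t0 /andP[tG Gt]].
have h1 : y ^+ 2 / 2 - tau * y <= 50 / 49 * (y - tau) ^+ 2.
  have := sqr_ge0 (y - tau); have := sqr_ge0 tau; lra.
have h2 : y ^+ 2 / 2 - 10 / 3 * tau * y <= 50 / 49 * (y - tau) ^+ 2.
  have := sqr_ge0 (51 / 49 * y + (10 / 3 - 100 / 49) * tau);
  have := sqr_ge0 tau; nra.
have [y0|y0] := leP 0 y.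
  by have : tau * y <= G * y; [rewrite ler_wpM2r|lra].
by have : 10 / 3 * tau * y <= G * y; [rewrite ler_wnM2r// ltW|lra].
Qed.

(* The proximal point fails the last clause of [anchored] when its slope is too
   large; then [t'] is taken where the slope equals the largest admissible value.
   The second alternative is handled by reflecting [g]. *)
Lemma anchor_upper (R : realType) (g : R -> R) (L k alpha : R) :
  0 < L -> 0 < k ->
  (forall y, `|y| <= 2 * L -> 0 <= g y <= y ^+ 2 / 2) ->
  (forall t, `|t| <= L ->
    exists G, forall s, `|s| <= 2 * L -> g t + G * (s - t) <= g s) ->
  exists t' G, anchored g L k alpha t' G \/
    (`|t'| <= L /\ (alpha - t') / k < 0) /\
    (forall t, `|t| <= L -> g t' + (alpha - t') / k * (t - t') <= g t).
Proof.
move=> L0 k0 gb sub; have [t0 t0L h0] := prox_point alpha L0 k0 gb sub.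
have [|tau0] := ltP ((alpha - t0) / k) 0.
  by move=> tau0; exists t0, 0; right.
set tau := (alpha - t0) / k in h0 tau0.
(* Upper bound of (t - alpha)/k over the admissible [t]. *)
pose m := Num.min L ((L - alpha) / k).
have mL : m <= L by rewrite /m ge_min lexx.
have ma : m <= (L - alpha) / k by rewrite /m ge_min lexx orbT.
have mE t : `|t| <= L -> `|t - alpha| <= k * L -> (t - alpha) / k <= m.
  rewrite !ler_norml => /andP[_ h1] /andP[_ h2]; rewrite /m le_min.
  rewrite ler_pdivrMr// mulrC; apply/andP; split; first lra.
  by rewrite ler_pM2r ?invr_gt0//; lra.
have xlow t : `|t - alpha| <= k * L -> - L <= (t - alpha) / k.
  by rewrite ler_norml => /andP[h _]; rewrite ler_pdivlMr//; lra.
(* Largest displacement allowed: m + tmax + 2/5 L is exactly 2L. *)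
pose tmax := 8 / 5 * L - m.
have eE t s : (t - s) / k = (t - alpha) / k + (alpha - s) / k.
  by rewrite -mulrDl addrA subrK.
have [tm|tm] := leP tau tmax.
  exists t0, tau; left; split => //.
    move=> y; rewrite -/tau; apply: slope_quadratic; split => //.
    by apply/andP; split; lra.
  move=> t x tL ta; rewrite !ler_norml => /andP[x1 x2].
  have := mE _ tL ta; have := xlow _ ta.
  rewrite (eE t t0) -/tau => h1 h2; apply/andP; split; first lra.
  rewrite /tmax in tm; lra.
pose t' := alpha - k * tmax.
have tE : (alpha - t') / k = tmax by rewrite /t'; field; lra.
have t0E : t0 = alpha - k * tau by rewrite /tau; field; lra.
have tmax0 : 3 / 5 * L <= tmax by rewrite /tmax; lra.
have t't0 : t0 < t' by rewrite t0E /t' ltrD2l ltrN2 ltr_pM2l.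
have km : k * m <= L - alpha by rewrite -(divfK (lt0r_neq0 k0) (L - alpha)) mulrC
  ler_pM2r.
have t'L : `|t'| <= L.
  move: t0L; rewrite !ler_norml => /andP[a b]; apply/andP; split; first lra.
  rewrite /t' /tmax; nra.
have [G hG] := sub _ t'L.
have GL := subgradient_bound L0 gb t'L hG.
exists t', G; left; split => //.
- by move=> t tL; apply: hG; lra.
- move=> y; apply: slope_quadratic; rewrite tE; split; first lra.
  apply/andP; split; last by rewrite (le_trans (ler_norm _))// (le_trans GL)//; lra.
  have h1 := h0 _ t'L; have t0L2 : `|t0| <= 2 * L by lra.
  have h2 := hG _ t0L2.
  (* Subgradients are monotone: moving the anchor to the right of [t0] can only raise the slope
     above [tau], hence above [tmax]. *)
  have : 0 <= (G - tau) * (t' - t0) by lra.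
  rewrite pmulr_lge0; lra.
- move=> t x tL ta; rewrite !ler_norml => /andP[x1 x2].
  have := mE _ tL ta; have := xlow _ ta.
  rewrite (eE t t') tE => h1 h2; apply/andP; split; first lra.
  rewrite /tmax in tm *; lra.
Qed.

Lemma prox_anchor (R : realType) (g : R -> R) (L k alpha : R) :
  0 < L -> 0 < k ->
  (forall y, `|y| <= 2 * L -> 0 <= g y <= y ^+ 2 / 2) ->
  (forall t, `|t| <= L ->
    exists G, forall s, `|s| <= 2 * L -> g t + G * (s - t) <= g s) ->
  exists t' G, anchored g L k alpha t' G.
Proof.
move=> L0 k0 gb sub.
have [t' [G [?|[[t'L neg] h0]]]] := anchor_upper alpha L0 k0 gb sub.
  by exists t', G.
have gb' y : `|y| <= 2 * L -> 0 <= g (- y) <= y ^+ 2 / 2.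
  by move=> yL; rewrite -sqrrN gb// normrN.
have sub' t : `|t| <= L ->
    exists G, forall s, `|s| <= 2 * L -> g (- t) + G * (s - t) <= g (- s).
  rewrite -normrN => /sub[G' hG]; exists (- G') => s sL.
  by rewrite (le_trans _ (hG (- s) _)) ?normrN// lerD2l; lra.
have [u [H [[uL h1 h2 h3]|[[uL neg'] h1]]]] :=
  anchor_upper (- alpha) L0 k0 gb' sub'.
  exists (- u), (- H); split; first by rewrite normrN.
  - move=> t tL; rewrite (le_trans _ (eq_ind_r (fun z => _ <= g z)
      (h1 (- t) _) (esym (opprK t))))// ?normrN//; lra.
  - move=> y; have := h2 (- y); rewrite sqrrN mulNr mulrN opprK => /le_trans; apply.
    rewrite (_ : - y - _ = - (y - (alpha - - u) / k)) ?sqrrN//.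
    by field; apply/eqP; lra.
  - move=> t x tL ta xL; rewrite -normrN.
    rewrite (_ : - _ = (- t - u) / k + 2 / 5 * (- x)); last by field; lra.
    apply: h3; rewrite ?normrN//.
    by rewrite (_ : _ - _ = - (t - alpha)) ?normrN//; ring.
(* Both proximal slopes are negative, that is -u < alpha < t'. But -u and t' are proximal points of
   the same [g] for the same [alpha], and monotonicity of subgradients forces them to coincide. *)
exfalso.
move: neg' neg; rewrite !pmulr_llt0 ?invr_gt0// => neg' neg.
have uL' : `|- u| <= L by rewrite normrN.
have a1 := h0 _ uL'.
have t'L' : `|- t'| <= L by rewrite normrN.
have := h1 _ t'L'; rewrite opprK => a2.
have : ((alpha - t') / k - (alpha + u) / k) * (- u - t') <= 0.
  have -> : ((alpha - t') / k - (alpha + u) / k) * (- u - t') =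
   ((alpha - t') / k * (- u - t')) + (- alpha - u) / k * (- t' - u) by field; lra.
  lra.
rewrite -mulrBl mulrAC pmulr_lle0 ?invr_gt0//.
rewrite (_ : alpha - t' - _ = - u - t'); last by ring.
rewrite -expr2 => sq; have : (- u - t') ^+ 2 = 0.
  by apply/eqP; rewrite eq_le sq sqr_ge0.
move/eqP; rewrite sqrf_eq0 => /eqP; lra.
Qed.

(** * Integration *)

Section nonmeasurable_integrands.
Context d (T : measurableType d) (R : realType).
Variable m : {measure set T -> \bar R}.
Local Open Scope ereal_scope.
Import HBNNSimple.

(* The integral of a nonnegative function is a supremum over simple functions
   below it, so monotonicity needs no measurability. *)
Lemma ge0_le_integral_lower (f1 f2 : T -> \bar R) :
  (forall x, 0 <= f1 x) -> (forall x, f1 x <= f2 x) ->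
  \int[m]_x f1 x <= \int[m]_x f2 x.
Proof.
move=> f10 f12; have f20 x : 0 <= f2 x by rewrite (le_trans (f10 x)).
rewrite !ge0_integralTE//; apply: le_ereal_sup => _ [h hf <-].
by exists h => // x; rewrite (le_trans (hf x)).
Qed.

(** The lower bound behind Markov's inequality, stated for an [f] that may fail to be measurable,
    such as a supremum over an arbitrary [Theta]. *)
Lemma le_measure_integral (f : T -> \bar R) (A : set T) (c : R) :
  measurable A -> (0 <= c)%R -> (forall x, 0 <= f x) ->
  (forall x, A x -> c%:E <= f x) -> c%:E * m A <= \int[m]_x f x.
Proof.
move=> mA c0 f0 cf.
have <- : \int[m]_x (c%:E * (\1_A x)%:E) = c%:E * m A.
  rewrite ge0_integralZl ?integral_indic ?setIT//.
  exact/measurable_EFinP/measurable_indic.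
apply: ge0_le_integral_lower => x; first by rewrite mule_ge0// lee_fin.
rewrite indicE; case: (boolP (x \in A)) => [|_]; last by rewrite mule0.
by rewrite inE => Ax; rewrite mule1 cf.
Qed.

End nonmeasurable_integrands.

Lemma measurable_bool_natr d (T : measurableType d) (R : realType) (f : T -> bool) :
  measurable_fun setT f -> measurable_fun setT (fun x => (f x)%:R : R).
Proof.
move=> mf; have mb : measurable_fun setT (fun b : bool => b%:R : R) by [].
exact: measurableT_comp mb mf.
Qed.

Section layer_cake.
Context d (T : measurableType d) (R : realType).
Variable m : {sigma_finite_measure set T -> \bar R}.
Local Open Scope ereal_scope.

Lemma measurable_fun_superlevel (F : T -> R) (G : T -> \bar R) :
  measurable_fun setT F -> measurable_fun setT G ->
  measurable_fun setT (fun z : T * measurableTypeR R =>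
    (0 <= z.2 < F z.1)%R%:R%:E * G z.1).
Proof.
move=> mF mG; apply: emeasurable_funM; last first.
  by apply: measurableT_comp mG _; exact: measurable_fst.
have mb : measurable_fun setT
    (fun z : T * measurableTypeR R => (0 <= z.2 < F z.1)%R).
  apply: measurable_and.
    by apply: measurable_fun_ler => //; exact: measurable_snd.
  apply: measurable_fun_ltr; first exact: measurable_snd.
  by apply: measurableT_comp mF _; exact: measurable_fst.
by apply: (measurableT_comp (f := fun b : bool => b%:R%:E)).
Qed.

Lemma measurable_integral_superlevel (F : T -> R) (G : T -> \bar R) :
  measurable_fun setT F -> measurable_fun setT G -> (forall x, 0 <= G x) ->
  measurable_fun setT (fun r : measurableTypeR R =>
    \int[m]_x ((0 <= r < F x)%R%:R%:E * G x)).
Proof.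
move=> mF mG G0; apply: (measurable_fun_fubini_tonelli_G (m1 := m) _
  (measurable_fun_superlevel mF mG)) => z.
by rewrite mule_ge0// lee_fin.
Qed.

(** [F x] is the length of the interval [0, F x[; the rest is Tonelli. It reduces both the product
    formula and the radial integrals to superlevel sets. *)
Lemma layer_cake (F : T -> R) (G : T -> \bar R) :
  measurable_fun setT F -> measurable_fun setT G ->
  (forall x, (0 <= F x)%R) -> (forall x, 0 <= G x) ->
  \int[m]_x ((F x)%:E * G x) =
  \int[lebesgue_measure]_r \int[m]_x ((0 <= r < F x)%R%:R%:E * G x).
Proof.
move=> mF mG F0 G0.
pose h (z : T * measurableTypeR R) := (0 <= z.2 < F z.1)%R%:R%:E * G z.1.
have mh : measurable_fun setT h by exact: measurable_fun_superlevel.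
have h0 z : 0 <= h z by rewrite mule_ge0// lee_fin.
rewrite -(fubini_tonelli h mh h0); apply: eq_integral => x _.
rewrite /h/= ge0_integralZr//; last first.
  apply: (measurableT_comp (f := fun b : bool => b%:R%:E)) => //.
  by apply: measurable_and; [exact: measurable_fun_ler|exact: measurable_fun_ltr].
congr (_ * _).
transitivity (\int[@lebesgue_measure R]_(r in setT) (\1_`[0%R, F x[ r)%:E); last first.
  by apply: eq_integral => r _; rewrite indicE mem_setE in_itv.
rewrite integral_indic//= setIT lebesgue_measure_itv/= lte_fin.
have [|F00] := ltP 0%R (F x); first by rewrite sube0.
by congr (_ %:E); apply/eqP; rewrite eq_le F00 F0.
Qed.

End layer_cake.

Lemma integral_cst_probability d (T : measurableType d) (R : realType)
  (P : probability T R) (c : \bar R) : (\int[P]_(w in setT) c = c)%E.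
Proof.
rewrite integral_cst//; apply: (eq_trans _ (mule1 c)); congr (_ * _)%E.
exact: probability_setT.
Qed.

(** * Product formula for independent observations *)

Section independent_product.
Context d (T : measurableType d) (R : realType).
Variable P : probability T R.
Local Open Scope ereal_scope.

(** The superlevel sets of [f] are measurable, so the hypothesis applies at each level and the layer
    cake formula reassembles [f]. *)
Lemma integral_mul_of_indic (Y : T -> R) (G : T -> \bar R) (c : \bar R)
    (f : R -> R) :
  measurable_fun setT Y -> measurable_fun setT G -> measurable_fun setT f ->
  (forall x, 0 <= G x) -> 0 <= c -> (forall y, (0 <= f y)%R) ->
  (forall A : set R, measurable A ->
    \int[P]_w ((\1_A (Y w))%:E * G w) = (\int[P]_w (\1_A (Y w))%:E) * c) ->
  \int[P]_w ((f (Y w))%:E * G w) = (\int[P]_w (f (Y w))%:E) * c.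
Proof.
move=> mY mG mf G0 c0 f0 H.
have mfY : measurable_fun setT (fun w => f (Y w)) by exact: measurableT_comp.
have mA (r : R) : measurable [set y : R | (0 <= r < f y)%R].
  have mb : measurable_fun setT (fun y : R => (0 <= r < f y)%R).
    by apply: measurable_and => //; exact: measurable_fun_ltr.
  by have := mb measurableT [set true] Logic.I; rewrite setTI.
rewrite layer_cake//.
transitivity (\int[lebesgue_measure]_r
    ((\int[P]_x ((0 <= r < f (Y x))%R%:R%:E * 1)) * c)).
  apply: eq_integral => r _; have := H _ (mA r).
  under eq_integral do rewrite indicE mem_setE.
  by move=> ->; congr (_ * _); apply: eq_integral => x _;
    rewrite mule1 indicE mem_setE.
rewrite ge0_integralZr//; last 2 first.
  exact: (measurable_integral_superlevel P mfY (measurable_cst 1)).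
  by move=> r _; apply: integral_ge0 => x _; rewrite mule1 lee_fin.
by rewrite -(layer_cake P (G := cst 1))//; under eq_integral do rewrite mule1.
Qed.

Lemma integral_prod_independent n (Y : 'I_n -> T -> R) (f : 'I_n -> R -> R) :
  (forall i, measurable_fun setT (Y i)) -> mutually_independent P Y ->
  (forall i, measurable_fun setT (f i)) -> (forall i y, (0 <= f i y)%R) ->
  \int[P]_w (\prod_i f i (Y i w))%:E = \prod_i \int[P]_w (f i (Y i w))%:E.
Proof.
move=> mY indY mf f0.
(* Hybrid product: [f i] for the first [k] indices, arbitrary indicators for the others. At k = 0
   the claim is independence, at k = n the lemma; each induction step replaces one indicator. *)
pose F (B : 'I_n -> set R) k (i : 'I_n) := if (i < k)%N then f i else \1_(B i).
suff H k B : (forall i, measurable (B i)) ->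
    \int[P]_w (\prod_i F B k i (Y i w))%:E =
    \prod_i \int[P]_w (F B k i (Y i w))%:E.
  have := H n (fun=> setT) (fun=> measurableT).
  under eq_integral do under eq_bigr do rewrite /F ltn_ord.
  by under [in RHS]eq_bigr do rewrite /F ltn_ord.
elim: k B => [|k IH] B mB.
  have mYB i : measurable (Y i @^-1` B i).
    by rewrite -[X in measurable X]setTI; exact: mY.
  rewrite (eq_integral (fun w =>
      (\1_(\bigcap_(i in [set i | i \in finset.setT]) (Y i @^-1` B i)) w)%:E)).
    rewrite integral_indic//; last exact: fin_bigcap_measurable.
    rewrite setIT; apply: (eq_trans (indY finset.setT B mB)).
    apply: eq_big => [i|i _]; first by rewrite inE.
    by rewrite -[in LHS](setIT (_ @^-1` _)) -integral_indic.
  move=> w _; congr (_ %:E); rewrite indicE.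
  case: (boolP (_ \in _)) => [|].
    rewrite inE => wB; apply: big1 => i _.
    by rewrite /F ltn0 indicE mem_set//; apply: (wB i) => /=; rewrite finset.in_setT.
  rewrite notin_setE => wB; have [i wBi] : exists i, ~ B i (Y i w).
    by apply/not_existsP => h; apply: wB => i _; apply/not_notP/h.
  by rewrite (bigD1 i)//= /F ltn0 indicE memNset// mul0r.
have [nk|kn] := leqP n k.
  have FE i : F B k.+1 i = F B k i.
    by rewrite /F ltnW ?(leq_trans (ltn_ord i))// ltnS (leq_trans _ nk)// ltnW.
  by under eq_integral do under eq_bigr do rewrite FE;
    under [in RHS]eq_bigr do rewrite FE; exact: IH.
pose k' := Ordinal kn.
have FE C i : i != k' -> F C k.+1 i = F C k i.
  by move=> ik; rewrite /F ltnS leq_eqVlt (negbTE (ik : (i != k :> nat))).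
have Fk C : F C k.+1 k' = f k' by rewrite /F ltnSn.
have Fk0 C : F C k k' = \1_(C k') by rewrite /F ltnn.
have mF C l i : (forall i, measurable (C i)) ->
    measurable_fun setT (fun w => F C l i (Y i w)).
  move=> mC; rewrite /F; case: ifP => _.
    exact: measurableT_comp (mf i) (mY i).
  have mI : measurable_fun setT (\1_(C i) : R -> R) by exact: measurable_indic.
  exact: measurableT_comp mI (mY i).
have F0 C l i y : (0 <= F C l i y)%R.
  by rewrite /F; case: ifP.
under eq_integral do rewrite (bigD1 k')//= EFinM Fk.
rewrite [RHS](bigD1 k')//= Fk.
apply: integral_mul_of_indic => //.
- apply/measurable_EFinP; rewrite (_ : (fun _ => _) =
    (fun w => \prod_(i <- index_enum 'I_n) if i != k' then F B k.+1 i (Y i w) else 1)%R).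
    by apply: measurable_prod => i _; case: (i != k') => //; exact: mF.
  by apply/funext => w; rewrite big_mkcond.
- by move=> w; rewrite lee_fin; apply: prodr_ge0.
- by apply: prode_ge0 => i _; apply: integral_ge0 => w _; rewrite lee_fin.
(* The induction hypothesis holds for all families of sets, so [A] may be put at the index that is
   being replaced. *)
move=> A mA; pose C i := if i == k' then A else B i.
have mC i : measurable (C i) by rewrite /C; case: ifP.
have CE : C k' = A by rewrite /C eqxx.
have FC i y : i != k' -> F C k i y = F B k.+1 i y.
  by move=> ik; rewrite FE// /F /C (negbTE ik).
have := IH C mC.
under eq_integral do rewrite (bigD1 k')//= EFinM Fk0 CE.
rewrite [in X in _ = X -> _](bigD1 k')//= Fk0 CE.
under eq_integral do under eq_bigr => i ik do rewrite FC//.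
move=> ->; congr (_ * _); apply: eq_bigr => i ik.
by apply: eq_integral => w _; rewrite FC.
Qed.

End independent_product.

Section log_mgf.
Context d (T : measurableType d) (R : realType).
Variable P : probability T R.

Lemma normr_le_expR_sum (L x : R) : 0 < L ->
  `|x| <= L^-1 * (expR (L * x) + expR (- L * x)).
Proof.
move=> L0; rewrite -ler_pdivrMl ?invr_gt0// invrK.
rewrite -{1}(gtr0_norm L0) -normrM.
have h (y : R) : y <= expR y by have := expR_ge1Dx y; lra.
rewrite ler_norml; apply/andP; split.
  have := h (- L * x); have := expR_gt0 (L * x); lra.
by have := h (L * x); have := expR_gt0 (- L * x); lra.
Qed.

(** The slope is the mean of X under the tilted law e^(tX - g t) dP. In e^(sX) = e^(tX) e^(G(s - t))
    e^((s - t)(X - G)) the last factor is bounded below by its tangent, whose linear term integrates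
    to zero under the tilted law. Dominating X e^(tX) uses the exponents t + L and t - L, which is
    why |t| <= L is asked. *)
Lemma log_mgf_subgradient (X : T -> R) (g : R -> R) (L : R) : 0 < L ->
  measurable_fun setT X ->
  (forall y, `|y| <= 2 * L -> (\int[P]_w (expR (y * X w))%:E = (expR (g y))%:E)%E) ->
  forall t, `|t| <= L -> exists m,
    (\int[P]_w (X w * expR (t * X w))%:E = m%:E)%E /\
    forall s, `|s| <= 2 * L -> g t + m / expR (g t) * (s - t) <= g s.
Proof.
move=> L0 mX mgf t tL.
have me y : measurable_fun setT (fun w => expR (y * X w)).
  by apply: measurableT_comp => //; exact: measurable_funM.
have ie y : `|y| <= 2 * L -> P.-integrable setT (fun w => (expR (y * X w))%:E).
  move=> yL; apply/integrableP; split; first exact/measurable_EFinP.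
  under eq_integral do rewrite gee0_abs ?lee_fin ?expR_ge0//.
  by rewrite mgf// ltry.
move: (tL); rewrite ler_norml => /andP[t1 t2].
have tL2 : `|t| <= 2 * L by lra.
have iX : P.-integrable setT (fun w => (X w * expR (t * X w))%:E).
  have i1 : P.-integrable setT (fun w =>
      (L^-1%:E * ((expR ((t + L) * X w))%:E + (expR ((t - L) * X w))%:E))%E).
    apply: integrableZl => //; apply: integrableD => //; apply: ie.
      by rewrite ler_norml; apply/andP; split; lra.
    by rewrite ler_norml; apply/andP; split; lra.
  apply: le_integrable i1 => //.
    by apply/measurable_EFinP; exact: measurable_funM.
  move=> w _; rewrite -EFinD -EFinM !abse_EFin lee_fin.
  rewrite (le_trans _ (ler_norm _))// normrM (ger0_norm (expR_ge0 (t * X w))).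
  apply: (le_trans (ler_wpM2r (expR_ge0 _) (normr_le_expR_sum (X w) L0))).
  rewrite -mulrA ler_pM2l ?invr_gt0// mulrDl -!expRD.
  by rewrite -!mulrDl (addrC L) (addrC (- L)).
have /fineK mE := integrable_fin_num measurableT iX.
set m := fine _ in mE; exists m; split => // s sL.
set G := m / _.
pose A := expR (G * (s - t)) * (1 - (s - t) * G).
pose B := expR (G * (s - t)) * (s - t).
have : (\int[P]_w (A%:E * (expR (t * X w))%:E + B%:E * (X w * expR (t * X w))%:E)
     <= \int[P]_w (expR (s * X w))%:E)%E.
  apply: le_integral => //.
  - by apply: integrableD => //; apply: integrableZl => //; exact: ie.
  - exact: ie.
  move=> w _; rewrite -!EFinM -EFinD lee_fin.
  have -> : A * expR (t * X w) + B * (X w * expR (t * X w)) =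
    expR (t * X w) * (expR (G * (s - t)) * (1 + (s - t) * (X w - G))).
    by rewrite /A /B; ring.
  have -> : s * X w = t * X w + (G * (s - t) + (s - t) * (X w - G)) by ring.
  rewrite expRD ler_pM2l ?expR_gt0// expRD ler_pM2l ?expR_gt0//.
  exact: expR_ge1Dx.
rewrite integralD//; [|by apply: integrableZl => //; exact: ie
  |exact: integrableZl].
rewrite !integralZl//; last exact: ie.
rewrite !mgf// -mE -!EFinM -EFinD lee_fin => h.
rewrite -ler_expR expRD; apply: le_trans h; rewrite le_eqVlt; apply/orP; left.
apply/eqP; rewrite /A /B -[in X in _ = _ + _ * X](divfK (lt0r_neq0 (expR_gt0 (g t))) m) -/G.
by rewrite (mulrC (G : R)); ring.
Qed.

(** As X is centered, the tangent of [g] at 0 is horizontal, and g 0 = 0; this gives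
    nonnegativity. *)
Lemma log_mgf_subgradients (X : T -> R) (g : R -> R) (L : R) : 0 < L ->
  measurable_fun setT X -> (\int[P]_w (X w)%:E = 0)%E ->
  (forall y, `|y| <= 2 * L -> (\int[P]_w (expR (y * X w))%:E = (expR (g y))%:E)%E) ->
  (forall t, `|t| <= L ->
    exists G, forall s, `|s| <= 2 * L -> g t + G * (s - t) <= g s) /\
  (forall y, `|y| <= 2 * L -> 0 <= g y).
Proof.
move=> L0 mX EX mgf; have sub := log_mgf_subgradient L0 mX mgf.
split=> [t tL|y yL].
  by have [m [_ h]] := sub _ tL; exists (m / expR (g t)).
have z : `|0 : R| <= L by rewrite normr0 ltW.
have [m []] := sub _ z.
under eq_integral do rewrite mul0r expR0 mulr1.
rewrite EX => -[<-] /(_ _ yL); rewrite !mul0r addr0.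
have z2 : `|0 : R| <= 2 * L by lra.
suff -> : g 0 = 0 by [].
have := mgf _ z2; under eq_integral do rewrite mul0r expR0.
rewrite integral_cst_probability => -[].
by rewrite -[in LHS](@expR0 R) => /expR_inj.
Qed.

End log_mgf.

(** * Lebesgue measure of tuples and Euclidean balls *)

Section affine_lebesgue.
Context {R : realType}.
Local Notation mR := (measurableTypeR R).
Local Open Scope ereal_scope.

(** The hypothesis says that [m] is [k] times its own image under [h], so this is integration
    against an image measure. *)
Lemma ge0_integral_scaled_preimage d (T : measurableType d)
    (m : {measure set T -> \bar R}) (h : T -> T) (k : R) (f : T -> \bar R) :
  measurable_fun setT h -> (0 <= k)%R ->
  (forall A, measurable A -> k%:E * m (h @^-1` A) = m A) ->
  measurable_fun setT f -> (forall x, 0 <= f x) ->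
  k%:E * \int[m]_x f (h x) = \int[m]_x f x.
Proof.
move=> mh k0 hm mf f0.
pose mhm := measure_function_pushforward__canonical__measure_function_Measure m mh.
transitivity (\int[mscale (NngNum k0) mhm]_x f x); last first.
  by apply: eq_measure_integral => A mA _; exact: hm.
rewrite ge0_integral_mscale//=; congr (_ * _).
rewrite -[in LHS](preimage_setT h).
by apply/esym/(@ge0_integral_pushforward _ _ _ _ _ _ mh m setT f).
Qed.

Lemma measurable_affine (c s : R) : measurable_fun setT (fun x : mR => (c + s * x)%R : mR).
Proof. by apply: measurable_funD => //; exact: measurable_funM. Qed.

Lemma lebesgue_measure_affine (c s : R) (A : set mR) : s != 0%R -> measurable A ->
  `|s|%:E * lebesgue_measure ((fun x => (c + s * x)%R : mR) @^-1` A) =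
  lebesgue_measure A.
Proof.
move=> s0 mA; pose h : mR -> mR := fun x => (c + s * x)%R.
have mh : measurable_fun setT h by exact: measurable_affine.
pose mhm := measure_function_pushforward__canonical__measure_function_Measure
  (@lebesgue_measure R) mh.
have sp : (0 < `|s|)%R by rewrite normr_gt0.
pose mu := mscale (NngNum (normr_ge0 s)) mhm.
suff -> : lebesgue_measure A = mu A by [].
apply: lebesgue_measure_unique => // _ [[a b] _ <-] /=.
rewrite lebesgue_measure_itv/= lte_fin /mu /mscale /= /mhm /pushforward.
have [ab|ba] := ltP a b; last first.
  by rewrite set_itv_ge ?bnd_simp -?leNgt// preimage_set0 measure0 mule0.
have [s1|s1] := ltP 0%R s.
- rewrite (_ : _ @^-1` _ = `](a - c) / s, (b - c) / s]%classic)%R; last first.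
    apply/seteqP; split => x /=; rewrite !in_itv/= ltr_pdivrMr// ler_pdivlMr//;
      by rewrite ltrBlDl lerBrDl (mulrC x).
  rewrite lebesgue_measure_itv/= lte_fin ltr_pM2r ?invr_gt0// ltrD2r ab.
  by rewrite -!EFinB -EFinM gtr0_norm//; congr (_ %:E); field.
- have {}s1 : (s < 0)%R by rewrite lt_neqAle s0.
  rewrite (_ : _ @^-1` _ = `[(b - c) / s, (a - c) / s[%classic)%R; last first.
    apply/seteqP; split => x /=; rewrite !in_itv/= ler_ndivrMr// ltr_ndivlMr//;
      by rewrite ltrBlDl lerBrDl (mulrC x) andbC.
  rewrite lebesgue_measure_itv/= lte_fin ltr_nM2r ?invr_lt0// ltrD2r ab.
  by rewrite -!EFinB -EFinM ltr0_norm//; congr (_ %:E); field.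
Qed.

Definition tuple_affine p (c : p.-tuple mR) (s : R) (z : p.-tuple mR) : p.-tuple mR :=
  [tuple (tnth c i + s * tnth z i)%R | i < p].

Lemma measurable_tuple_affine p (c : p.-tuple mR) s :
  measurable_fun setT (tuple_affine c s).
Proof.
apply/measurable_fun_tnthP => i.
rewrite (_ : _ \o _ = (fun z => tnth c i + s * tnth z i)%R).
  by apply: measurable_funD => //; apply: measurable_funM => //; exact: measurable_tnth.
by apply/funext => z /=; rewrite tnth_mktuple.
Qed.

(** The measure of a set of (p+1)-tuples is by construction the integral of its sections, so head
    and tail are rescaled separately, by the one-dimensional case and by induction. *)
Lemma lebesgue_tuple_affine p (c : p.-tuple mR) s (A : set (p.-tuple mR)) :
  s != 0%R -> measurable A ->
  (`|s| ^+ p)%:E * lebesgue_tuple p (tuple_affine c s @^-1` A) =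
  lebesgue_tuple p A.
Proof.
move=> s0; elim: p c A => [|p IH] c A mA.
  rewrite expr0 mul1e; congr (_ _); apply/seteqP.
  have e z : tuple_affine c s z = z by rewrite tuple0 [RHS]tuple0.
  by split=> z; rewrite /preimage /= e.
case/tupleP: c => c0 c.
pose tc (x : mR * p.-tuple mR) : p.+1.-tuple mR := [tuple of x.1 :: x.2].
have mtc : measurable_fun setT tc by exact: measurable_cons.
have mE : measurable (tc @^-1` A) by rewrite -[X in measurable X]setTI; exact: mtc.
pose phi (x : mR) := lebesgue_tuple p (xsection (tc @^-1` A) x).
have mphi : measurable_fun setT phi by exact: measurable_fun_xsection.
have -> : lebesgue_tuple p.+1 A = \int[lebesgue_measure]_x phi x by [].
rewrite -(@ge0_integral_scaled_preimage _ _ lebesgue_measure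
  (fun x : mR => (c0 + s * x)%R) `|s| phi)//; last 2 first.
- exact: measurable_affine.
- by move=> B mB; exact: lebesgue_measure_affine.
rewrite exprS EFinM -muleA; congr (_ * _).
rewrite -ge0_integralZl//; last first.
  apply: (@measurable_fun_xsection _ _ _ _ _ (lebesgue_tuple p)).
  rewrite -[X in measurable X]setTI; apply: mtc => //.
  by rewrite -[X in measurable X]setTI; exact: measurable_tuple_affine.
apply: eq_integral => x _; rewrite /phi -[RHS](IH c); last exact: measurable_xsection.
congr (_ * lebesgue_tuple p _).
have tcE t : tuple_affine [tuple of c0 :: c] s (tc (x, t)) =
    tc ((c0 + s * x)%R, tuple_affine c s t).
  apply: eq_from_tnth => i; rewrite tnth_mktuple.
  case: (unliftP ord0 i) => [j|] -> /=; last by rewrite !tnth0.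
  by rewrite !tnthS tnth_mktuple.
by apply/seteqP; split=> t; rewrite /xsection /preimage /= !inE /= tcE.
Qed.

Lemma ge0_integral_tuple_affine p (c : p.-tuple mR) s (f : p.-tuple mR -> \bar R) :
  s != 0%R -> measurable_fun setT f -> (forall z, 0 <= f z) ->
  (`|s| ^+ p)%:E * \int[lebesgue_tuple p]_z f (tuple_affine c s z) =
  \int[lebesgue_tuple p]_z f z.
Proof.
move=> s0 mf f0; apply: ge0_integral_scaled_preimage => //.
- exact: measurable_tuple_affine.
- by move=> A mA; exact: lebesgue_tuple_affine.
Qed.

End affine_lebesgue.

Section euclidean_facts.
Context {R : realType} {p : nat}.
Implicit Types (u v w : 'cV[R]_p).

Lemma dotpE u v : dotp u v = \sum_i u i 0 * v i 0.
Proof. by rewrite /dotp !mxE; apply: eq_bigr => i _; rewrite mxE. Qed.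

Lemma dotpC u v : dotp u v = dotp v u.
Proof. by rewrite !dotpE; apply: eq_bigr => i _; rewrite mulrC. Qed.

Lemma dotpDr u v w : dotp u (v + w) = dotp u v + dotp u w.
Proof. by rewrite /dotp mulmxDr mxE. Qed.

Lemma dotpZr a u v : dotp u (a *: v) = a * dotp u v.
Proof. by rewrite /dotp -scalemxAr mxE. Qed.

Lemma dotpNr u v : dotp u (- v) = - dotp u v.
Proof. by rewrite -scaleN1r dotpZr mulN1r. Qed.

Lemma dotpBr u v w : dotp u (v - w) = dotp u v - dotp u w.
Proof. by rewrite dotpDr dotpNr. Qed.

Lemma dotpDl u v w : dotp (v + w) u = dotp v u + dotp w u.
Proof. by rewrite dotpC dotpDr !(dotpC u). Qed.

Lemma dotpZl a u v : dotp (a *: v) u = a * dotp v u.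
Proof. by rewrite dotpC dotpZr dotpC. Qed.

Lemma dotpBl u v w : dotp (v - w) u = dotp v u - dotp w u.
Proof. by rewrite dotpC dotpBr !(dotpC u). Qed.

Lemma dotp0r u : dotp u 0 = 0.
Proof. by rewrite -(scale0r (0 : 'cV[R]_p)) dotpZr mul0r. Qed.

Lemma dotp_ge0 u : 0 <= dotp u u.
Proof. by rewrite dotpE sumr_ge0// => i _; rewrite -expr2 sqr_ge0. Qed.

Lemma sqr_enorm u : enorm u ^+ 2 = dotp u u.
Proof. by rewrite /enorm sqr_sqrtr// dotp_ge0. Qed.

Lemma enorm_ge0 u : 0 <= enorm u.
Proof. exact: sqrtr_ge0. Qed.

Lemma enormZ a u : enorm (a *: u) = `|a| * enorm u.
Proof.
by rewrite /enorm dotpZr dotpC dotpZr mulrA -expr2 sqrtrM ?sqr_ge0// sqrtr_sqr.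
Qed.

Lemma enormN u : enorm (- u) = enorm u.
Proof. by rewrite -scaleN1r enormZ normrN normr1 mul1r. Qed.

Lemma enorm0 : enorm (0 : 'cV[R]_p) = 0.
Proof. by rewrite -(scale0r (0 : 'cV[R]_p)) enormZ normr0 mul0r. Qed.

Lemma enorm_eq0 u : enorm u = 0 -> u = 0.
Proof.
move=> u0; have : dotp u u = 0 by rewrite -sqr_enorm u0 expr0n.
rewrite dotpE => /eqP; rewrite psumr_eq0; last by move=> i _; rewrite -expr2 sqr_ge0.
move=> /allP h; apply/matrixP => i j; rewrite ord1 mxE.
by have := h i (mem_index_enum _); rewrite mulf_eq0 orbb => /eqP.
Qed.

Lemma le_enorm_sqr u r : 0 <= r -> (enorm u <= r) = (dotp u u <= r ^+ 2).
Proof. by move=> r0; rewrite -sqr_enorm ler_pXn2r ?nnegrE ?enorm_ge0. Qed.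

Lemma dotp_le u v : dotp u v <= enorm u * enorm v.
Proof.
have [u0|u0] := eqVneq (enorm u) 0.
  by rewrite (enorm_eq0 u0) dotpC dotp0r enorm0 mul0r.
have [v0|v0] := eqVneq (enorm v) 0.
  by rewrite (enorm_eq0 v0) dotp0r enorm0 mulr0.
have up : 0 < enorm u by rewrite lt_neqAle eq_sym u0 enorm_ge0.
have vp : 0 < enorm v by rewrite lt_neqAle eq_sym v0 enorm_ge0.
have := dotp_ge0 (enorm v *: u - enorm u *: v).
rewrite dotpBr !dotpBl !dotpZl !dotpZr -!sqr_enorm (dotpC v u) => h.
have : 0 <= 2 * (enorm u * enorm v) * (enorm u * enorm v - dotp u v) by lra.
by rewrite pmulr_rge0 ?subr_ge0// !mulr_gt0.
Qed.

Lemma enormD u v : enorm (u + v) <= enorm u + enorm v.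
Proof.
rewrite le_enorm_sqr ?addr_ge0 ?enorm_ge0//.
rewrite dotpDr !dotpDl -!sqr_enorm (dotpC v u).
have := dotp_le u v; lra.
Qed.

End euclidean_facts.

Section balls.
Context {R : realType} (p : nat).
Local Notation mR := (measurableTypeR R).
Local Open Scope ereal_scope.

Lemma cV_of_tuple_affine (c : p.-tuple mR) s z :
  cV_of_tuple (tuple_affine c s z) = (cV_of_tuple c + s *: cV_of_tuple z)%R.
Proof. by apply/matrixP => i j; rewrite !mxE tnth_mktuple. Qed.

Definition tuple_of_cV (u : 'cV[R]_p) : p.-tuple mR := [tuple u i 0%R | i < p].

Lemma tuple_of_cVK : cancel tuple_of_cV (@cV_of_tuple R p).
Proof. by move=> u; apply/matrixP => i j; rewrite !mxE tnth_mktuple ord1. Qed.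

Lemma measurable_dotp_tuple (u : 'cV[R]_p) :
  measurable_fun setT (fun z : p.-tuple mR => dotp u (cV_of_tuple z)).
Proof.
under eq_fun do rewrite dotpE; apply: measurable_sum => i.
under eq_fun do rewrite mxE.
by apply: measurable_funM => //; exact: measurable_tnth.
Qed.

Lemma measurable_enorm_tuple :
  measurable_fun setT (fun z : p.-tuple mR => enorm (cV_of_tuple z)).
Proof.
have ms : measurable_fun setT (@Num.sqrt R).
  by apply: continuous_measurable_fun; exact: sqrt_continuous.
apply: (measurableT_comp ms (g := fun z : p.-tuple mR =>
  dotp (cV_of_tuple z) (cV_of_tuple z))).
under eq_fun do rewrite dotpE; apply: measurable_sum => i.
by under eq_fun do rewrite mxE; apply: measurable_funM; exact: measurable_tnth.
Qed.

Definition tuple_ball (r : R) : set (p.-tuple mR) :=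
  [set z | (enorm (cV_of_tuple z) <= r)%R].

Lemma measurable_preimage_true d (T : measurableType d) (f : T -> bool) :
  measurable_fun setT f -> measurable [set x | f x].
Proof. by move=> mf; have := mf measurableT [set true] Logic.I; rewrite setTI. Qed.

Lemma measurable_tuple_ball r : measurable (tuple_ball r).
Proof.
apply: measurable_preimage_true; apply: measurable_fun_ler => //.
exact: measurable_enorm_tuple.
Qed.

Lemma lebesgue_shifted_ball (u : 'cV[R]_p) r : (0 < r)%R ->
  lebesgue_tuple p [set z | (enorm (cV_of_tuple z - u)%R <= r)%R] =
  (r ^+ p)%:E * ball_volume p.
Proof.
move=> r0; rewrite -(@lebesgue_tuple_affine _ _ (tuple_of_cV u) r _ (lt0r_neq0 r0)).
  rewrite gtr0_norm//; congr (_ * lebesgue_tuple p _).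
  apply/seteqP; split => z; rewrite /preimage /= cV_of_tuple_affine tuple_of_cVK
    addrAC subrr add0r enormZ gtr0_norm// -ler_pdivlMl// mulVf ?lt0r_neq0//.
apply: measurable_preimage_true; apply: measurable_fun_ler => //.
rewrite (_ : (fun _ => _) = (fun z => enorm (cV_of_tuple z)) \o
    tuple_affine (tuple_of_cV (- u)%R) 1).
  apply: measurableT_comp; first exact: measurable_enorm_tuple.
  exact: measurable_tuple_affine.
by apply/funext => z /=; rewrite cV_of_tuple_affine tuple_of_cVK scale1r addrC.
Qed.

Lemma lebesgue_tuple_ball r : (0 < r)%R ->
  lebesgue_tuple p (tuple_ball r) = (r ^+ p)%:E * ball_volume p.
Proof.
move=> r0; rewrite -(lebesgue_shifted_ball 0 r0); congr (lebesgue_tuple p _).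
by apply/seteqP; split => z; rewrite /tuple_ball /= subr0.
Qed.

Lemma lebesgue_cube q (r : R) : (0 <= r)%R ->
  measurable [set z : q.-tuple mR | forall i, (`|tnth z i| <= r)%R] /\
  lebesgue_tuple q [set z : q.-tuple mR | forall i, (`|tnth z i| <= r)%R] =
  ((r *+ 2) ^+ q)%:E.
Proof.
move=> r0; elim: q => [|q [mC IH]].
  rewrite (_ : mkset _ = setT); last first.
    by apply/seteqP; split => // z _ [].
  by split => //; rewrite expr0 /= /dirac indicT.
set C := mkset _ in mC IH.
pose A : set R := `[(- r)%R, r]%classic.
have CE : [set z : q.+1.-tuple mR | forall i, (`|tnth z i| <= r)%R] =
    [set t | A (thead t) /\ C [tuple of behead t]].
  apply/seteqP; split => z /=.
    move=> h; split; first by rewrite /A /= in_itv/= -ler_norml; exact: h.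
    by move=> i; rewrite tnth_behead; exact: h.
  move=> [h0 h] i; case: (unliftP ord0 i) => [j|] ->; last first.
    by rewrite ler_norml; move: h0; rewrite /A /= in_itv.
  have -> : lift ord0 j = inord j.+1 by apply/val_inj; rewrite /= inordK ?ltnS ?ltn_ord.
  by have := h j; rewrite tnth_behead.
split.
  rewrite CE; apply: measurableI.
    rewrite -[X in measurable X]setTI.
    exact: (@measurable_tnth _ mR q.+1 ord0 measurableT A (measurable_itv _)).
  rewrite -[X in measurable X]setTI.
  exact: (@measurable_behead _ mR q measurableT C mC).
rewrite CE; have := @lebesgue_tupleSE R q (lebesgue_tuple q) A C (measurable_itv _) mC.
rewrite IH => {}IH; apply: (eq_trans IH).
rewrite lebesgue_measure_itv/= lte_fin exprS EFinM.
case: ltP => [_|]; first by rewrite -EFinB opprK mulr2n.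
rewrite -subr_le0 opprK -mulr2n => r2.
have -> : r = 0%R by apply/eqP; rewrite eq_le r0 -(@pmulrn_lle0 _ r 2)// r2.
by rewrite mul0rn.
Qed.

(** The cube of half-side 1/p lies in the ball: each squared coordinate is at most its absolute
    value, hence at most 1/p. *)
Lemma ball_volume_gt0 : (0 < p)%N -> 0 < ball_volume (R := R) p.
Proof.
move=> p0; have pR : (0 < p%:R :> R)%R by rewrite ltr0n.
have r0 : (0 <= (p%:R : R)^-1)%R by rewrite invr_ge0 ltW.
have [mC CE] := lebesgue_cube p r0.
apply: (@lt_le_trans _ _ (((p%:R^-1 : R) *+ 2) ^+ p)%:E).
  by rewrite lte_fin exprn_gt0// pmulrn_lgt0 ?invr_gt0.
rewrite -CE; apply: le_measure; rewrite ?inE//; first exact: measurable_tuple_ball.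
move=> z /= h; rewrite le_enorm_sqr// expr1n dotpE.
apply: (@le_trans _ _ (\sum_(i < p) p%:R^-1)%R); last first.
  by rewrite sumr_const card_ord -(mulr_natl (p%:R^-1)%R) mulfV// gt_eqF.
apply: ler_sum => i _; rewrite mxE -expr2 -real_normK ?num_real//.
rewrite (le_trans (_ : _ <= `|tnth z i|)%R)//.
have h1 : (`|tnth z i| <= 1)%R.
  by rewrite (le_trans (h i))// invf_le1// ler1n.
by rewrite expr2 ler_piMl.
Qed.

Lemma ball_volume_fin : ball_volume (R := R) p < +oo.
Proof.
have [mC CE] := lebesgue_cube p (@ler01 R).
apply: (@le_lt_trans _ _ (((1 : R) *+ 2) ^+ p)%:E); last by rewrite ltry.
rewrite -CE; apply: le_measure; rewrite ?inE//; first exact: measurable_tuple_ball.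
move=> z /=; rewrite le_enorm_sqr// expr1n dotpE => h i.
rewrite -(@ler_pXn2r _ 2)// ?nnegrE// expr1n real_normK ?num_real//.
apply: le_trans h; rewrite (bigD1 i)//= mxE -expr2 lerDl sumr_ge0// => j _.
by rewrite -expr2 sqr_ge0.
Qed.

Lemma ball_volume_fin_num : (0 < p)%N -> ball_volume (R := R) p \is a fin_num.
Proof. by move=> p0; rewrite gt0_fin_numE ?ball_volume_fin ?ball_volume_gt0. Qed.

End balls.

(** * Radial integrals in polar form *)

Section radial.
Context {R : realType} (p : nat).
Hypothesis p0 : (0 < p)%N.
Local Notation mR := (measurableTypeR R).
Local Open Scope ereal_scope.

Lemma integral_exprn (T : R) : (0 < T)%R ->
  \int[lebesgue_measure]_(t in `[0%R, T]) (p%:R * t ^+ p.-1)%:E = (T ^+ p)%:E.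
Proof.
move=> T0; rewrite (@continuous_FTC2 _ _ (fun t : R => t ^+ p)%R)//.
- by rewrite expr0n gtn_eqF// sube0.
- apply: continuous_subspaceT => x; apply: cvgM; first exact: cvg_cst.
  exact: exprn_continuous.
- split.
  + by move=> x _; exact: exprn_derivable.
  + by apply: cvg_at_right_filter; exact: exprn_continuous.
  + by apply: cvg_at_left_filter; exact: exprn_continuous.
- by move=> x _; rewrite exp_derive1.
Qed.

(* The centered balls exhaust a radial superlevel set up to its boundary, which
   determines the volume: [S] is the set of radii. *)
Lemma downset_value (S : set R) (c : R) (v : \bar R) : (0 < c)%R ->
  (forall t, S t -> (0 <= t)%R) -> 0 <= v ->
  (forall t, S t -> (0 < t)%R -> (c * t ^+ p)%:E <= v) ->
  (forall T, (0 < T)%R -> (forall t, S t -> (t <= T)%R) -> v <= (c * T ^+ p)%:E) ->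
  v = c%:E * ereal_sup [set (t ^+ p)%:E | t in 0%R |` S].
Proof.
move=> c0 S0 v0 lo up; set x := ereal_sup _.
(* The point 0 was adjoined to [S] because the supremum over an empty set would be -oo. *)
have x0 : 0 <= x.
  by apply: ereal_sup_ubound; exists 0%R; [left|rewrite expr0n gtn_eqF].
apply/eqP; rewrite eq_le; apply/andP; split; last first.
  rewrite muleC -lee_pdivlMr//; apply: ge_ereal_sup => _ [t [->|St] <-].
    by rewrite expr0n gtn_eqF// mule_ge0// lee_fin invr_ge0 ltW.
  have [t0|t0] := ltP 0%R t.
    by rewrite lee_pdivlMr// -EFinM mulrC lo.
  have -> : t = 0%R by apply/eqP; rewrite eq_le t0 S0.
  by rewrite expr0n gtn_eqF// mule_ge0// lee_fin invr_ge0 ltW.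
case: (eqVneq x +oo) => [->|xoo]; first by rewrite gt0_muley ?lte_fin// leey.
have xfin : x \is a fin_num by rewrite ge0_fin_numE// lt_neqAle xoo leey.
have Sx t : S t -> (t ^+ p <= fine x)%R.
  by move=> St; rewrite -lee_fin fineK//; apply: ereal_sup_ubound; exists t => //; right.
have fx0 : (0 <= fine x)%R by rewrite fine_ge0.
rewrite -(fineK xfin) -EFinM.
pose T := (fine x `^ p%:R^-1)%R.
have T0 : (0 <= T)%R by exact: powR_ge0.
have pn : (p%:R : R) != 0%R by rewrite pnatr_eq0 gtn_eqF.
have Tp : (T ^+ p = fine x)%R.
  by rewrite -powR_mulrn// /T -powRrM mulVf// powRr1.
have ST t : S t -> (t <= T)%R.
  by move=> St; rewrite -(@ler_pXn2r _ p)// ?nnegrE ?S0// Tp Sx.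
(* [T] is 0 when [S] has no positive element, while the hypothesis [up] wants a positive radius;
   hence T + h with a small h > 0. *)
rewrite -Tp; apply/lee_addgt0Pr => e e0.
have : \forall h \near (0%R : R)^'+, (c * (T + h) ^+ p <= c * T ^+ p + e)%R.
  have cv : (c * (T + h) ^+ p)%R @[h --> (0%R : R)] --> (c * T ^+ p)%R.
    rewrite -[X in _ --> (c * X ^+ p)%R](addr0 T).
    apply: cvgM; first exact: cvg_cst.
    apply: (cvg_comp (fun h : R => T + h)%R (fun y : R => y ^+ p)%R _
      (@exprn_continuous R p _)).
    by apply: cvgD; [exact: cvg_cst|exact: cvg_id].
  move/cvg_at_right_filter : cv => /cvgrPdist_le/(_ e e0).
  apply: filterS => h; rewrite ler_distl => /andP[? ?]; lra.
move=> H; have [h [h0 hh]] : exists h : R, (0 < h)%R /\ (c * (T + h) ^+ p <= c * T ^+ p + e)%R.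
  near (0%R : R)^'+ => h; exists h; split; first by near: h; exact: nbhs_right_gt.
  by near: h.
rewrite -EFinD; apply: (@le_trans _ _ (c * (T + h) ^+ p)%:E); last by rewrite lee_fin.
by apply: up => [|t /ST tT]; lra.
Unshelve. all: by end_near. Qed.

Variable kappa : R -> R.
Hypothesis kappa0 : forall t, (0 <= t)%R -> (0 < kappa t)%R.
Hypothesis kappa_dec : forall t t', (0 <= t -> t <= t' -> kappa t' <= kappa t)%R.

(** Constant extension to negative arguments, monotone on the whole line and therefore
    measurable. *)
Let K (t : R) := kappa (Num.max 0 t)%R.

Let K_dec t t' : (t <= t')%R -> (K t' <= K t)%R.
Proof.
move=> tt; apply: kappa_dec; first by rewrite le_max lexx.
by rewrite ge_max !le_max lexx tt orbT.
Qed.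

Let K0 t : (0 < K t)%R.
Proof. by apply: kappa0; rewrite le_max lexx. Qed.

Let measurable_K : measurable_fun setT K.
Proof.
apply: nonincreasing_measurable => // x y xy; exact: K_dec.
Qed.

Lemma measurable_radial :
  measurable_fun setT (fun z : p.-tuple mR => kappa (enorm (cV_of_tuple z))).
Proof.
rewrite (_ : (fun _ => _) = K \o (fun z : p.-tuple mR => enorm (cV_of_tuple z))).
  by apply: measurableT_comp => //; exact: measurable_enorm_tuple.
by apply/funext => z /=; rewrite /K max_r// enorm_ge0.
Qed.

(** Both sides are cut into levels. At level r >= 0 the radii with r < kappa t form a down-set
    [S r]; its mass under the density p t^(p-1) is the supremum of t^p over it, and so is the volume
    of the corresponding ball in units of [ball_volume]. *)
Lemma radial_massE : radial_mass p kappa =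
  p%:R%:E * \int[lebesgue_measure]_(t in `[0%R, +oo[) (kappa t * t ^+ p.-1)%:E.
Proof.
have vol0 := ball_volume_gt0 (R := R) p0.
have volf := ball_volume_fin_num (R := R) p0.
have v0 : (0 < fine (ball_volume (R := R) p))%R.
  by rewrite fine_gt0// vol0 ball_volume_fin.
pose G (t : R) := ((0 <= t)%R%:R * (p%:R * t ^+ p.-1))%R.
have mG : measurable_fun setT G.
  apply: measurable_funM.
    by apply: measurable_bool_natr; exact: measurable_fun_ler.
  by apply: measurable_funM => //; exact: measurable_funX.
have G0 t : (0 <= G t)%R.
  rewrite /G; case: (leP 0%R t) => t0; last by rewrite mul0r.
  by rewrite mul1r mulr_ge0// exprn_ge0.
pose S r := [set t | (0 <= t)%R /\ (r < K t)%R].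
pose X r := ereal_sup [set (t ^+ p)%:E | t in 0%R |` S r].
have RHSE : p%:R%:E * \int[lebesgue_measure]_(t in `[0%R, +oo[) (kappa t * t ^+ p.-1)%:E
    = \int[@lebesgue_measure R]_t ((K t)%:E * (G t)%:E).
  rewrite -ge0_integralZl//; last 2 first.
  - apply: (eq_measurable_fun (fun t => (K t * t ^+ p.-1)%:E)).
      by move=> t; rewrite inE/= in_itv/= andbT => t0; rewrite /K max_r.
    apply/measurable_EFinP; apply: measurable_funM.
      exact: measurable_funTS.
    by apply: measurable_funX; exact: measurable_id.
  - move=> t; rewrite /= in_itv/= andbT => t0.
    by rewrite lee_fin mulr_ge0 ?exprn_ge0// ltW// kappa0.
  rewrite integral_mkcond; apply: eq_integral => t _; rewrite patchE.
  case: ifPn => [|].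
    rewrite inE/= in_itv/= andbT => t0.
    rewrite /G t0 mul1r /K max_r// -!EFinM; congr (_ %:E); ring.
  rewrite notin_setE/= in_itv/= andbT => /negP t0.
  by rewrite /G (negbTE t0) mul0r mule0.
rewrite RHSE (layer_cake (@lebesgue_measure R))//; last 2 first.
- exact/measurable_EFinP.
- by move=> t; exact/ltW.
pose F r := \int[@lebesgue_measure R]_t ((0 <= r < K t)%R%:R%:E * (G t)%:E).
have mF : measurable_fun setT F.
  apply: (measurable_integral_superlevel (@lebesgue_measure R)) => //.
  exact/measurable_EFinP.
have F0 r : 0 <= F r by apply: integral_ge0 => t _; rewrite mule_ge0// lee_fin.
rewrite /radial_mass.
have -> : \int[lebesgue_tuple p]_z (kappa (enorm (cV_of_tuple z)))%:E =
    \int[lebesgue_tuple p]_z ((K (enorm (cV_of_tuple z)))%:E * cst 1 z).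
  by apply: eq_integral => z _; rewrite mule1 /K max_r// enorm_ge0.
rewrite layer_cake//; last 2 first.
- by apply: measurableT_comp => //; exact: measurable_enorm_tuple.
- by move=> z; exact/ltW.
rewrite (_ : \int[lebesgue_measure]_r _ = ball_volume p * \int[@lebesgue_measure R]_r F r).
  by rewrite muleA [X in X * _]muleC divee ?mul1e// gt_eqF.
rewrite -ge0_integralZl//.
apply: eq_integral => r _.
have [r0|r0] := ltP r 0%R.
  rewrite integral0_eq; last by move=> z _; rewrite mul0e.
  rewrite (_ : F r = 0) ?mule0//; apply: integral0_eq => t _.
  by rewrite leNgt r0 mul0e.
have S0 t : S r t -> (0 <= t)%R by case.
have Sdown t : (0 <= r < K t)%R -> (0 <= t)%R -> S r t.
  by move=> /andP[_ rt] t0; split.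
have -> : F r = X r.
  rewrite -[RHS]mul1e; apply: (@downset_value (S r) 1) => //.
  - move=> t [t0 rt] tp; rewrite mul1r -integral_exprn// integral_mkcond.
    apply: ge0_le_integral_lower => u; rewrite patchE; case: ifPn => //.
      rewrite inE/= in_itv/= => /andP[u0 _].
      by rewrite lee_fin mulr_ge0// exprn_ge0.
    rewrite inE/= in_itv/= => /andP[u0 ut].
    by rewrite r0 (lt_le_trans rt (K_dec ut)) mul1e /G u0 mul1r.
    by rewrite mule_ge0// lee_fin.
  - move=> T T0 ST; rewrite mul1r -integral_exprn// integral_mkcond.
    apply: ge0_le_integral_lower => u; first by rewrite mule_ge0// lee_fin.
    rewrite patchE /G; case: (leP 0%R u) => u0; last first.
      by rewrite mul0r mule0; case: ifPn => // h; rewrite lee_fin;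
        move: h; rewrite inE/= in_itv/= leNgt u0.
    case: (boolP (0 <= r < K u)%R) => [h|_].
      by rewrite mem_set ?mul1e ?mul1r// /= in_itv/= u0 ST//; exact: Sdown.
    rewrite mul0e; case: ifPn => // _.
    by rewrite lee_fin mulr_ge0// exprn_ge0.
rewrite -[ball_volume p]fineK//.
have mball t : measurable (tuple_ball (R := R) (p := p) t).
  exact: measurable_tuple_ball.
have ballE (t : R) : (0 < t)%R -> (fine (ball_volume p) * t ^+ p)%:E =
    \int[lebesgue_tuple p]_z (\1_(@tuple_ball R p t) z)%:E.
  move=> t0; transitivity (lebesgue_tuple p (@tuple_ball R p t)).
    by rewrite lebesgue_tuple_ball// mulrC EFinM fineK.
  by rewrite integral_indic// setIT.
apply: downset_value => //.
- by apply: integral_ge0 => z _; rewrite mule1 lee_fin.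
- move=> t [t0 rt] tp; rewrite ballE//.
  apply: ge0_le_integral_lower => z; first by rewrite lee_fin.
  rewrite indicE mule1; have [|_] := boolP (z \in _); last by rewrite lee_fin.
  rewrite inE /tuple_ball/= => zt.
  by rewrite (lt_le_trans rt (K_dec zt)).
- move=> T T0 ST; rewrite ballE//.
  apply: ge0_le_integral_lower => z; first by rewrite mule1 lee_fin.
  rewrite mule1; case: (boolP (_ && _)) => [h|_]; last by rewrite lee_fin.
  by rewrite indicE mem_set// /tuple_ball /= ST//; apply: Sdown; rewrite ?r0// enorm_ge0.
Qed.

End radial.

(** * Covering numbers *)

Lemma ln_seven_halves (R : realType) : 8 * ln (7 / 2 : R) <= 15 * ln 2.
Proof.
have e8 : (7 / 2 : R) ^+ 8 = ((7 / 2) ^+ 4) ^+ 2 by rewrite -exprM.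
have e15 : (2 : R) ^+ 15 = 2 * (2 ^+ 7) ^+ 2 by rewrite -exprM -exprS.
have h : (7 / 2 : R) ^+ 8 <= 2 ^+ 15.
  rewrite e8 e15; have x7 : (7 / 2 : R) ^+ 4 <= 7 / 5 * 2 ^+ 7 by lra.
  have x0 : 0 <= (7 / 2 : R) ^+ 4 by rewrite exprn_ge0.
  have y0 : 0 <= (2 : R) ^+ 7 by rewrite exprn_ge0.
  move: ((7 / 2 : R) ^+ 4) ((2 : R) ^+ 7) x7 x0 y0 => x y x7 x0 y0; nra.
have p7 : 0 < (7 / 2 : R) by lra.
have p2 : 0 < (2 : R) by lra.
rewrite (mulr_natl _ 8) (mulr_natl _ 15) -(lnXn 8 p7) -(lnXn 15 p2).
by rewrite ler_ln// posrE; exact: exprn_gt0.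
Qed.

Section covering.
Context {R : realType} (p : nat).
Hypothesis p0 : (0 < p)%N.
Local Notation mR := (measurableTypeR R).

(** Volumes are compared: the [m] small balls have total volume m delta^p times that of the ball
    they cover. *)
Lemma ball_coverable_volume (delta : R) m : 0 < delta ->
  ball_coverable p delta m -> 1 <= m%:R * delta ^+ p.
Proof.
move=> d0 [c hc].
pose B i := [set z : p.-tuple mR | enorm (cV_of_tuple z - c i) <= delta].
have mB i : measurable (B i).
  apply: measurable_preimage_true; apply: measurable_fun_ler => //.
  rewrite (_ : (fun _ => _) = (fun z => enorm (cV_of_tuple z)) \o
      tuple_affine (tuple_of_cV (- c i)) 1).
    apply: measurableT_comp; first exact: measurable_enorm_tuple.
    exact: measurable_tuple_affine.
  by apply/funext => z /=; rewrite cV_of_tuple_affine tuple_of_cVK scale1r addrC.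
have h : (ball_volume (R := R) p <= \sum_(i < m) (delta ^+ p)%:E * ball_volume p)%E.
  apply: (@le_trans _ _ (\int[lebesgue_tuple p]_z (\1_(@tuple_ball R p 1) z)%:E)%E).
    by rewrite integral_indic ?setIT//; exact: measurable_tuple_ball.
  apply: (@le_trans _ _ (\sum_(i < m) \int[lebesgue_tuple p]_z (\1_(B i) z)%:E)%E);
    last first.
    apply: lee_sum => i _; rewrite integral_indic// setIT.
    by rewrite -(lebesgue_shifted_ball (c i) d0).
  rewrite -ge0_integral_sum//; last first.
    by move=> i; exact/measurable_EFinP/measurable_indic.
  apply: ge0_le_integral_lower => z; first by rewrite lee_fin.
  rewrite sumEFin lee_fin indicE; have [|_] := boolP (z \in _); last first.
    by rewrite sumr_ge0.
  rewrite inE /tuple_ball/= => /hc[i zi].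
  by rewrite (bigD1 i)//= indicE mem_set// lerDl sumr_ge0.
have vf := ball_volume_fin_num (R := R) p0.
have v0 : 0 < fine (ball_volume (R := R) p).
  by rewrite fine_gt0// ball_volume_gt0// ball_volume_fin.
move: h; rewrite -(fineK vf) -EFinM sumEFin lee_fin sumr_const card_ord.
rewrite -[X in _ <= X -> _]mulr_natl mulrA => h; rewrite -(ler_pM2r v0) mul1r.
exact: h.
Qed.

(** The infimum of an empty set is 0, so a lower bound on [covering_number] requires that some cover
    exists. The centers are the points of mesh 1/N in the cube [-1, 1]^p; the squared error is at
    most p/N^2 <= (p/N)^2 <= delta^2. *)
Lemma ball_coverable_exists (delta : R) : 0 < delta ->
  exists m, ball_coverable p delta m.
Proof.
move=> d0; pose N := (Num.truncn (p%:R / delta)).+1.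
have N0 : 0 < N%:R :> R by rewrite ltr0n.
have Nd : p%:R / delta <= N%:R by rewrite ltW// truncnS_gt.
pose I : finType := {ffun 'I_p -> 'I_(N.*2).+1}.
pose g (f : I) : 'cV[R]_p := \col_i ((f i)%:R / N%:R - 1).
exists #|I|, (fun j => g (enum_val j)) => u u1.
have ui i : -1 <= u i 0 <= 1.
  rewrite -ler_norml -(@ler_pXn2r _ 2)// ?nnegrE// expr1n real_normK ?num_real//.
  move: u1; rewrite le_enorm_sqr// expr1n dotpE; apply: le_trans.
  by rewrite (bigD1 i)//= -expr2 lerDl sumr_ge0// => j _; rewrite -expr2 sqr_ge0.
have x0 i : 0 <= (u i 0 + 1) * N%:R.
  by rewrite mulr_ge0//; have := ui i; lra.
have jb i : (Num.truncn ((u i 0 + 1) * N%:R)%R < (N.*2).+1)%N.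
  rewrite ltnS -(ler_nat R) (le_trans (proj1 (andP (truncn_itv (x0 i)))))//.
  rewrite -muln2 natrM mulrC ler_pM2l//; have := ui i; lra.
pose f : I := [ffun i => Ordinal (jb i)].
exists (enum_rank f); rewrite enum_rankK.
rewrite (le_enorm_sqr _ (ltW d0)) dotpE.
apply: (@le_trans _ _ (\sum_(i < p) N%:R^-1 ^+ 2)).
  apply: ler_sum => i _; rewrite !mxE ffunE /= -expr2 -real_normK ?num_real//.
  rewrite ler_pXn2r ?nnegrE ?invr_ge0//.
  have /andP[t1 t2] := truncn_itv (x0 i).
  have h1 : (Num.truncn ((u i 0 + 1) * N%:R))%:R / N%:R <= u i 0 + 1.
    by rewrite ler_pdivrMr.
  have h2 : u i 0 + 1 <= (Num.truncn ((u i 0 + 1) * N%:R))%:R / N%:R + N%:R^-1.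
    by rewrite -[X in _ / _ + X]mul1r -mulrDl ler_pdivlMr// natr1 ltW.
  have : 0 < N%:R^-1 :> R by rewrite invr_gt0.
  by rewrite ler_norml => ?; apply/andP; split; lra.
rewrite sumr_const card_ord -[_ *+ p]mulr_natl.
have : p%:R / N%:R <= delta.
  by rewrite ler_pdivrMr// mulrC -ler_pdivrMr.
have p1 : 1 <= p%:R :> R by rewrite ler1n.
have i0 : 0 < N%:R^-1 :> R by rewrite invr_gt0.
move=> h; apply: (@le_trans _ _ ((p%:R / N%:R) ^+ 2)); last first.
  by rewrite ler_pXn2r ?nnegrE// ?divr_ge0 ?ler0n// ltW.
by rewrite exprMn ler_wpM2r ?sqr_ge0// expr2 ler_peMl.
Qed.

Lemma covering_number_ge (delta : R) : 0 < delta ->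
  delta ^- p <= covering_number p delta.
Proof.
move=> d0; apply: lb_le_inf.
  by have [m mc] := ball_coverable_exists d0; exists m%:R, m.
move=> _ [m mc <-]; rewrite -[leLHS]mul1r ler_pdivrMr ?exprn_gt0//.
exact: ball_coverable_volume.
Qed.

(** By volumes the k-th term is at least k 2^(-k) p ln 2. The first six terms give 15/8, the
    constant of [ln_seven_halves]; five would give 57/32, which is below log_2(7/2). *)
Lemma entropy_number_ge : ((p%:R * ln (7 / 2 : R))%:E <= entropy_number p)%E.
Proof.
have t0 k : (0 <= (2^-1 ^+ k * ln (covering_number p (2^-1 ^+ k : R)))%R%:E)%E &&
    ((2^-1 ^+ k * (k%:R * (p%:R * ln 2)))%R%:E <=
     (2^-1 ^+ k * ln (covering_number p (2^-1 ^+ k : R)))%R%:E)%E.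
  have d0 : 0 < 2^-1 ^+ k :> R by rewrite exprn_gt0.
  have l2 : k%:R * (p%:R * ln 2) <= ln (covering_number p (2^-1 ^+ k : R)).
    have -> : k%:R * (p%:R * ln 2) = ln ((2^-1 ^+ k : R) ^- p).
      rewrite lnV ?posrE ?exprn_gt0// lnXn// lnXn// lnV ?posrE//.
      by rewrite -mulr_natl -[_ *+ k]mulr_natl; ring.
    rewrite ler_ln ?posrE ?invr_gt0 ?exprn_gt0//; first exact: covering_number_ge.
    apply: lt_le_trans (covering_number_ge d0).
    by rewrite invr_gt0 exprn_gt0.
  have ln20 : 0 <= ln 2 :> R by rewrite ln_ge0// ler1n.
  rewrite !lee_fin ler_pM2l// l2 andbT mulr_ge0 ?(ltW d0)//.
  by rewrite (le_trans _ l2)// mulr_ge0// mulr_ge0.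
rewrite /entropy_number.
apply: (@le_trans _ _ (\sum_(1 <= k < 7)
  (2^-1 ^+ k * ln (covering_number p (2^-1 ^+ k : R)))%:E)%E); last first.
  by apply: nneseries_lim_ge => k _ _; have /andP[] := t0 k.
apply: (@le_trans _ _ (\sum_(1 <= k < 7)
  (2^-1 ^+ k * (k%:R * (p%:R * ln (2 : R))))%:E)%E); last first.
  by apply: lee_sum => k _; have /andP[] := t0 k.
rewrite sumEFin lee_fin; do 6 rewrite big_ltn//; rewrite big_geq// addr0.
have h := @ln_seven_halves R.
have : 0 <= p%:R * (15 * ln (2 : R) - 8 * ln (7 / 2 : R)).
  by rewrite mulr_ge0// subr_ge0.
lra.
Qed.

End covering.

(** * Majorants of the likelihood ratio process *)

Lemma expR_convex2 (R : realType) (r x y : R) : 0 <= r <= 1 ->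
  expR (r * x + (1 - r) * y) <= r * expR x + (1 - r) * expR y.
Proof.
move=> /andP[r0 r1]; set m := r * x + (1 - r) * y.
have h z : expR m * (1 + (z - m)) <= expR z.
  have -> : expR z = expR m * expR (z - m) by rewrite -expRD addrC subrK.
  by rewrite ler_pM2l ?expR_gt0// expR_ge1Dx.
have h1 : r * (expR m * (1 + (x - m))) <= r * expR x by rewrite ler_wpM2l.
have h2 : (1 - r) * (expR m * (1 + (y - m))) <= (1 - r) * expR y.
  by rewrite ler_wpM2l//; lra.
apply: le_trans (lerD h1 h2); rewrite le_eqVlt; apply/orP; left; apply/eqP.
rewrite -[LHS]mulr1; transitivity (expR m * (1 + (r * x + (1 - r) * y - m))).
  by rewrite -/m subrr addr0.
by ring.
Qed.

Section chaining.
Context d (T : measurableType d) (R : realType) (P : probability T R) (n p : nat).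
Local Notation mR := (measurableTypeR R).
Variables (X : 'I_n -> T -> R) (g : 'I_n -> R -> R) (L : R) (tau : 'I_n -> 'cV[R]_p).
Hypothesis L0 : 0 < L.
Hypothesis mX : forall i, measurable_fun setT (X i).
Hypothesis mgf : forall y : 'I_n -> R, (forall i, `|y i| <= 2 * L) ->
  (\int[P]_w (expR (\sum_i y i * X i w))%:E = (expR (\sum_i g i (y i)))%:E)%E.
Hypothesis gb : forall i y, `|y| <= 2 * L -> 0 <= g i y <= y ^+ 2 / 2.
Hypothesis gsub : forall i t, `|t| <= L ->
  exists G, forall s, `|s| <= 2 * L -> g i t + G * (s - t) <= g i s.
Variables (rho eps : R) (B : set (p.-tuple mR)).
Hypothesis rho0 : 0 < rho.
Hypothesis rho1 : rho < 1.
Let k := (1 - rho) / rho.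
Let t i (z : p.-tuple mR) := dotp (tau i) (cV_of_tuple z).
Hypothesis mB : measurable B.
Hypothesis Bsym : forall z, B z -> B (tuple_affine (tuple_of_cV 0) (-1) z).
Hypothesis Bconv : forall v z, B v -> B z ->
  B (tuple_affine (tuple_of_cV ((5 / 7) *: cV_of_tuple v)) (2 / 7) z).
Hypothesis Bt : forall z i, B z -> `|t i z| <= k * L.
Hypothesis Bq : forall z, B z -> \sum_i t i z ^+ 2 <= eps ^+ 2.
Variable volB : R.
Hypothesis volBE : lebesgue_tuple p B = volB%:E.
Hypothesis volB0 : 0 < volB.

Definition centered_llr (u : 'cV[R]_p) w :=
  \sum_i (X i w * dotp (tau i) u - g i (dotp (tau i) u)).

Let k0 : 0 < k.
Proof. by rewrite /k divr_gt0// subr_gt0. Qed.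

Let lb := p%:R * ln (7 / 2) + 2 * eps ^+ 2 / k ^+ 2.

Let measurable_t i : measurable_fun setT (t i).
Proof. exact: measurable_dotp_tuple. Qed.

Let tA i c s z : t i (tuple_affine (tuple_of_cV c) s z) = dotp (tau i) c + s * t i z.
Proof. by rewrite /t cV_of_tuple_affine tuple_of_cVK dotpDr dotpZr. Qed.

Let integral_B : (\int[lebesgue_tuple p]_z (\1_B z)%:E = volB%:E)%E.
Proof. by rewrite integral_indic// setIT; exact: volBE. Qed.

Section local_majorant.
Variables (a : p.-tuple mR) (t' G : 'I_n -> R).
Hypothesis anch : forall i, anchored (g i) L k (t i a) (t' i) (G i).

Let tau0 i := (t i a - t' i) / k.
(** At z = (5/7) v + (2/7) b this is (t_i(a) + t_i(v) - t'_i)/k + (2/5) t_i(b)/k, the expression in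
    the last clause of [anchored]. *)
Let y z i := tau0 i + 7 / 5 * t i z / k.
(** Off [W] an exponent may leave the domain of [g], where no moment formula is available. The
    points used in [ge_S] stay in [W] by the last clause of [anchored]. *)
Let W := [set z | B z /\ forall i, `|y z i| <= 2 * L].

Let measurable_y i : measurable_fun setT (y^~ i).
Proof.
apply: measurable_funD => //; apply: measurable_funM => //.
exact: measurable_funM.
Qed.

Let measurable_W : measurable W.
Proof.
rewrite (_ : W = B `&` \bigcap_(i in [set: 'I_n]) [set z | `|y z i| <= 2 * L]).
  apply: measurableI => //; apply: fin_bigcap_measurable.
    by apply: finite_finset.
  move=> i _; apply: measurable_preimage_true; apply: measurable_fun_ler => //.
  exact: measurableT_comp.
by apply/seteqP; split=> z [Bz h]; split => // i; [move=> _|]; exact: h.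
Qed.

Let f w z := expR (\sum_i (X i w - G i) * y z i).

Let measurable_f : measurable_fun setT (fun x : T * p.-tuple mR => f x.1 x.2).
Proof.
apply: measurableT_comp => //; apply: measurable_sum => i.
apply: measurable_funM.
  apply: measurable_funB => //.
  by apply: measurableT_comp (mX i) _; exact: measurable_fst.
by apply: measurableT_comp (measurable_y i) _; exact: measurable_snd.
Qed.

Let h (x : T * p.-tuple mR) := (\1_W x.2 * f x.1 x.2)%:E.

Let measurable_h : measurable_fun setT h.
Proof.
apply/measurable_EFinP; apply: measurable_funM => //.
have mI : measurable_fun setT (\1_W : p.-tuple mR -> R) by exact: measurable_indic.
by apply: measurableT_comp mI _; exact: measurable_snd.
Qed.

Let h0 x : (0 <= h x)%E.
Proof. by rewrite lee_fin mulr_ge0// expR_ge0. Qed.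

Let c0 := (7 / 2) ^+ p / volB.

Let c00 : 0 < c0.
Proof. by rewrite divr_gt0// exprn_gt0//; lra. Qed.

(* The change of variable [z = (5/7) v + (2/7) b] turns this integral over [W] into
   one over all [b] in [B], for every [v] in [B] at once; this costs the factor
   [(7/2)^p]. *)
Let S w := (c0%:E * \int[lebesgue_tuple p]_z h (w, z))%E.

Let measurable_S : measurable_fun setT S.
Proof.
apply: measurable_funeM.
exact: (measurable_fun_fubini_tonelli_F (m2 := lebesgue_tuple p) h measurable_h h0).
Qed.

(** The quadratic clause of [anchored] with y - tau0 = (7/5) t_i(z)/k, where (50/49)(7/5)^2 = 2. The
    offset [tau0], and with it the dependence on [a], is gone. *)
Let integral_f z : W z -> (\int[P]_w (f w z)%:E <= (expR (2 * eps ^+ 2 / k ^+ 2))%:E)%E.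
Proof.
move=> [Bz yz].
have -> : (\int[P]_w (f w z)%:E)%E = (expR (\sum_i (g i (y z i) - G i * y z i)))%:E.
  transitivity (\int[P]_w ((expR (- \sum_i G i * y z i))%:E * (expR (\sum_i y z i * X i w))%:E))%E.
    apply: eq_integral => w _; rewrite -EFinM -expRD /f; congr (expR _)%:E.
    rewrite -sumrN -big_split/=; apply: eq_bigr => i _; ring.
  rewrite ge0_integralZl//; last first.
    apply/measurable_EFinP; apply: measurableT_comp => //; apply: measurable_sum => i.
    exact: measurable_funM.
  rewrite mgf// -EFinM -expRD; congr (expR _)%:E.
  by rewrite -sumrN -big_split/=; apply: eq_bigr => i _; rewrite addrC.
rewrite lee_fin ler_expR.
apply: (@le_trans _ _ (\sum_i 2 * t i z ^+ 2 / k ^+ 2)).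
  apply: ler_sum => i _; have [_ _ h3 _] := anch i.
  have /andP[_ gy] := gb i (yz i).
  apply: (le_trans (lerB gy (lexx _))); apply: (le_trans (h3 _)).
  rewrite -/(tau0 i) /y; rewrite le_eqVlt; apply/orP; left; apply/eqP.
  by field; rewrite gt_eqF.
rewrite -mulr_suml ler_pM2r ?invr_gt0 ?exprn_gt0//.
by rewrite -mulr_sumr ler_pM2l//; exact: Bq.
Qed.

Let integral_S : (\int[P]_w S w <= (expR lb)%:E)%E.
Proof.
rewrite /S ge0_integralZl//; last 3 first.
- exact: (measurable_fun_fubini_tonelli_F (m2 := lebesgue_tuple p) h measurable_h h0).
- by move=> w _; apply: integral_ge0.
- by rewrite lee_fin ltW.
rewrite (fubini_tonelli h measurable_h h0).
apply: (@le_trans _ _ (c0%:E * \int[lebesgue_tuple p]_z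
    ((expR (2 * eps ^+ 2 / k ^+ 2))%:E * (\1_B z)%:E))%E).
  rewrite lee_pmul2l//; apply: ge0_le_integral_lower => z.
    by apply: integral_ge0.
  have [zW|zW] := boolP (z \in W).
    have Wz : W z by move: zW; rewrite inE.
    under eq_integral do rewrite /h/= indicE zW mul1r.
    rewrite indicE mem_set ?mule1; last by case: Wz.
    exact: integral_f.
  under eq_integral do rewrite /h/= indicE (negbTE zW) mul0r.
  by rewrite integral0 mule_ge0// lee_fin ?expR_ge0.
rewrite ge0_integralZl//; last exact/measurable_EFinP/measurable_indic.
rewrite integral_B -!EFinM lee_fin /c0 /lb expRD.
have -> : expR (p%:R * ln (7 / 2)) = (7 / 2 : R) ^+ p.
  by rewrite expRM_natl lnK// posrE; lra.
rewrite le_eqVlt; apply/orP; left; apply/eqP.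
by field; rewrite gt_eqF.
Qed.

Let ge_S v w : B v -> (forall i, `|t i a + t i v| <= L) ->
  ((expR (\sum_i (X i w - G i) * (tau0 i + t i v / k)))%:E <= S w)%E.
Proof.
move=> Bv tL; set C := \sum_i _.
pose l (b : p.-tuple mR) := \sum_i (X i w - G i) * (2 / 5 * t i b / k).
have ml : measurable_fun setT l.
  by apply: measurable_sum => i; apply: measurable_funM => //;
    apply: measurable_funM => //; exact: measurable_funM.
have mI : measurable_fun setT (\1_B : p.-tuple mR -> R) by exact: measurable_indic.
pose q (s : R) (b : p.-tuple mR) := (\1_B b * expR (s * l b))%:E.
have mq s : measurable_fun setT (q s).
  apply/measurable_EFinP; apply: measurable_funM => //; apply: measurableT_comp => //.
  exact: measurable_funM.
have q0 s b : (0 <= q s b)%E by rewrite lee_fin mulr_ge0// expR_ge0.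
have sym : (\int[lebesgue_tuple p]_b q 1%R b = \int[lebesgue_tuple p]_b q (-1)%R b)%E.
  rewrite -(@ge0_integral_tuple_affine _ _ (tuple_of_cV 0) (-1) (q 1))//.
    rewrite normrN normr1 expr1n mul1e; apply: eq_integral => b _.
    rewrite /q; congr (_ * expR _)%:E.
      rewrite !indicE; congr ((nat_of_bool _)%:R); apply/idP/idP; rewrite !inE.
        move=> /Bsym; congr B; apply: eq_from_tnth => i.
        by rewrite !tnth_mktuple mxE; ring.
      exact: Bsym.
    rewrite mul1r mulN1r /l -sumrN; apply: eq_bigr => i _.
    by rewrite tA dotp0r add0r; ring.
(* e^l + e^(-l) >= 2, and by symmetry of [B] both terms have the same integral over it. *)
have volq : (volB%:E <= \int[lebesgue_tuple p]_b q 1%R b)%E.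
  have : (2%:E * volB%:E <= 2%:E * \int[lebesgue_tuple p]_b q 1%R b)%E.
    have -> : (2%:E * \int[lebesgue_tuple p]_b q 1%R b =
        \int[lebesgue_tuple p]_b (q 1%R b + q (-1)%R b))%E.
      rewrite ge0_integralD// -sym -[in LHS](_ : (1 + 1 = 2 :> R))//.
      by rewrite EFinD ge0_muleDl// mul1e.
    rewrite -integral_B.
    rewrite -ge0_integralZl//; last exact/measurable_EFinP.
    apply: ge0_le_integral_lower => b; first by rewrite mule_ge0// lee_fin.
    rewrite /q -EFinD -EFinM lee_fin -mulrDr mulrC ler_wpM2l// mul1r mulN1r.
    have := expR_gt0 (l b); have h1 := expR_ge1Dx (l b); have := expR_ge1Dx (- l b).
    lra.
  by rewrite lee_pmul2l// lte_fin.
rewrite /S.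
have sn : (2 / 7 : R) != 0 by apply/eqP; lra.
have hm : measurable_fun setT (fun z => h (w, z)).
  by apply: measurableT_comp measurable_h _; exact: measurable_pair1.
rewrite -(@ge0_integral_tuple_affine _ _ (tuple_of_cV ((5 / 7) *: cV_of_tuple v)) (2 / 7) _ sn hm)//.
rewrite muleA -EFinM ger0_norm; last lra.
have -> : c0 * (2 / 7) ^+ p = volB^-1.
  rewrite /c0 mulrAC -exprMn (_ : 7 / 2 * (2 / 7) = 1) ?expr1n ?mul1r//.
  by field.
apply: (@le_trans _ _ (volB^-1%:E * ((expR C)%:E * \int[lebesgue_tuple p]_b q 1%R b))%E).
  rewrite muleCA -[leLHS]mule1 lee_pmul2l ?lte_fin ?expR_gt0//.
  rewrite -[leLHS](_ : (volB^-1%:E * volB%:E = 1)%E).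
    by rewrite lee_pmul2l// lte_fin invr_gt0.
  by rewrite -EFinM mulVf// gt_eqF.
apply: lee_wpmul2l; first by rewrite lee_fin invr_ge0 ltW.
rewrite -ge0_integralZl; [|exact: measurableT|exact: mq|by move=> b _; exact: q0
  |by rewrite lee_fin expR_ge0].
apply: ge0_le_integral_lower => b; first by rewrite mule_ge0// lee_fin expR_ge0.
rewrite /q /h/= -EFinM lee_fin mulrCA mul1r -expRD.
have [|bB] := boolP (b \in B); last first.
  have -> : \1_B b = 0 :> R by rewrite indicE (negbTE bB).
  by rewrite mul0r mulr_ge0// expR_ge0.
rewrite inE => Bb; set z := tuple_affine _ _ _.
have tz i : t i z = 5 / 7 * t i v + 2 / 7 * t i b by rewrite tA dotpZr.
have yE i : y z i = tau0 i + t i v / k + 2 / 5 * t i b / k.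
  by rewrite /y tz; field; rewrite gt_eqF.
have Wz : W z.
  split; first exact: Bconv.
  move=> i; have [_ _ _ h4] := anch i.
  have kk : k != 0 by rewrite gt_eqF.
  have := h4 (t i a + t i v) (t i b / k).
  rewrite (_ : _ / k + 2 / 5 * (t i b / k) = y z i); last first.
    by rewrite yE /tau0; field.
  apply; first exact: tL.
    by rewrite addrAC subrr add0r Bt.
  by rewrite normrM normfV (gtr0_norm k0) ler_pdivrMr// mulrC Bt.
rewrite !indicE !mem_set// !mul1r le_eqVlt; apply/orP; left; apply/eqP.
rewrite /f; congr (expR _); rewrite /C /l -big_split/=; apply: eq_bigr => i _.
by rewrite yE; ring.
Qed.

Let A w := \sum_i (X i w * t' i - g i (t' i)).

Let measurable_A : measurable_fun setT (fun w => (expR (A w))%:E).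
Proof.
apply/measurable_EFinP; apply: measurableT_comp => //; apply: measurable_sum => i.
by apply: measurable_funB => //; exact: measurable_funM.
Qed.

Let integral_A : (\int[P]_w (expR (A w))%:E = 1)%E.
Proof.
transitivity (\int[P]_w ((expR (- \sum_i g i (t' i)))%:E *
    (expR (\sum_i t' i * X i w))%:E))%E.
  apply: eq_integral => w _; rewrite -EFinM -expRD; congr (expR _)%:E.
  by rewrite -sumrN -big_split/=; apply: eq_bigr => i _; ring.
rewrite ge0_integralZl//; last first.
  apply/measurable_EFinP; apply: measurableT_comp => //; apply: measurable_sum => i.
  exact: measurable_funM.
rewrite mgf; first by rewrite -EFinM -expRD addrC subrr expR0.
move=> i; have [h1 _ _ _] := anch i; rewrite (le_trans h1)//.
by rewrite ler_peMl ?ltW// ltr1n.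
Qed.

Lemma majorant_of_anchor : exists H : T -> \bar R,
  [/\ measurable_fun setT H, forall w, (0 <= H w)%E,
    (\int[P]_w H w <= (expR ((1 - rho) * lb))%:E)%E &
    forall u v w, (forall i, `|dotp (tau i) u| <= L) -> B v ->
      u = cV_of_tuple a + cV_of_tuple v ->
      ((expR (rho * centered_llr u w))%:E <= H w)%E].
Proof.
have e1 : 0 < 1 - rho by rewrite subr_gt0.
(* Weighted convexity of the exponential is applied to A and C - [lb]: after this shift e^A and
   e^(-lb) S both have expectation at most 1, and only the factor e^((1 - rho) lb) is left. *)
exists (fun w => (expR ((1 - rho) * lb))%:E *
  (rho%:E * (expR (A w))%:E + ((1 - rho) * expR (- lb))%:E * S w))%E.
have S0 w : (0 <= S w)%E.
  by rewrite mule_ge0 ?integral_ge0// lee_fin ltW.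
have c1 : 0 <= (1 - rho) * expR (- lb) by rewrite mulr_ge0 ?expR_ge0// ltW.
have s1 w : (0 <= rho%:E * (expR (A w))%:E)%E.
  by rewrite mule_ge0// lee_fin ?expR_ge0// ltW.
have s2 w : (0 <= ((1 - rho) * expR (- lb))%:E * S w)%E.
  by rewrite mule_ge0// lee_fin.
have m1 : measurable_fun setT (fun w => rho%:E * (expR (A w))%:E)%E.
  exact: measurable_funeM.
have m2 : measurable_fun setT (fun w => ((1 - rho) * expR (- lb))%:E * S w)%E.
  exact: measurable_funeM.
split.
- by apply: measurable_funeM; exact: emeasurable_funD.
- by move=> w; rewrite mule_ge0 ?adde_ge0// lee_fin expR_ge0.
- rewrite ge0_integralZl; [|exact: measurableT|exact: emeasurable_funD
    |by move=> w _; exact: adde_ge0|by rewrite lee_fin expR_ge0].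
  rewrite -[leRHS]mule1; apply: lee_wpmul2l; first by rewrite lee_fin expR_ge0.
  rewrite ge0_integralD; [|exact: measurableT|by move=> w _; exact: s1|exact: m1
    |by move=> w _; exact: s2|exact: m2].
  rewrite ge0_integralZl; [|exact: measurableT|exact: measurable_A
    |by move=> w _; rewrite lee_fin expR_ge0|by rewrite lee_fin ltW].
  rewrite ge0_integralZl; [|exact: measurableT|exact: measurable_S
    |by move=> w _; exact: S0|by rewrite lee_fin].
  rewrite integral_A mule1.
  apply: (@le_trans _ _ (rho%:E + ((1 - rho) * expR (- lb))%:E * (expR lb)%:E)%E).
    by apply: leeD2l; apply: lee_wpmul2l; [rewrite lee_fin|exact: integral_S].
  by rewrite -EFinM -EFinD lee_fin -mulrA -expRD addNr expR0 mulr1 addrC subrK.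
move=> u v w uL Bv uE.
have tu i : dotp (tau i) u = t i a + t i v by rewrite uE dotpDr.
set C := \sum_i (X i w - G i) * (tau0 i + t i v / k).
have CS : ((expR C)%:E <= S w)%E.
  by apply: ge_S => // i; rewrite -tu.
have le1 : rho * centered_llr u w <= rho * A w + (1 - rho) * C.
  rewrite /centered_llr /A /C !mulr_sumr -big_split/=; apply: ler_sum => i _.
  have [_ h2 _ _] := anch i; have := h2 _ (uL i); rewrite tu => hi.
  (* The value of [k] is chosen for this identity: (1 - rho)/k = rho, so the remainder of the
     tangent inequality becomes (1 - rho) C. *)
  have -> : (1 - rho) * ((X i w - G i) * (tau0 i + t i v / k)) =
      rho * ((X i w - G i) * (t i a + t i v - t' i)).
    by rewrite /tau0 /k; field; rewrite !gt_eqF// subr_gt0.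
  rewrite -mulrDr ler_pM2l//; lra.
apply: (@le_trans _ _ (expR (rho * A w + (1 - rho) * C))%:E).
  by rewrite lee_fin ler_expR.
have -> : rho * A w + (1 - rho) * C =
  (1 - rho) * lb + (rho * A w + (1 - rho) * (C - lb)) by ring.
rewrite expRD EFinM; apply: lee_wpmul2l; first by rewrite lee_fin expR_ge0.
apply: (@le_trans _ _ (rho * expR (A w) + (1 - rho) * expR (C - lb))%:E).
  by rewrite lee_fin expR_convex2// !ltW.
rewrite EFinD EFinM; apply: leeD2l.
rewrite expRD mulrCA mulrC EFinM; apply: lee_wpmul2l; first by rewrite lee_fin.
exact: CS.
Qed.

End local_majorant.

Lemma local_majorant (a : p.-tuple mR) : exists H : T -> \bar R,
  [/\ measurable_fun setT H, forall w, (0 <= H w)%E,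
    (\int[P]_w H w <= (expR ((1 - rho) * lb))%:E)%E &
    forall u v w, (forall i, `|dotp (tau i) u| <= L) -> B v ->
      u = cV_of_tuple a + cV_of_tuple v ->
      ((expR (rho * centered_llr u w))%:E <= H w)%E].
Proof.
have /choice[tG tGP] : forall i, exists x : R * R, anchored (g i) L k (t i a) x.1 x.2.
  move=> i; have [t' [G h]] := prox_anchor (t i a) L0 k0 (gb i) (@gsub i).
  by exists (t', G).
exact: (@majorant_of_anchor a (fun i => (tG i).1) (fun i => (tG i).2)).
Qed.

End chaining.

(** * Averaging the local majorants over the anchor points *)

Section sup_majorant.
Context d (T : measurableType d) (R : realType) (P : probability T R) (p : nat).
Local Notation mR := (measurableTypeR R).
Variables (U : set 'cV[R]_p) (lam : 'cV[R]_p -> T -> R) (phi : 'cV[R]_p -> R).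
Variables (B : set (p.-tuple mR)) (volB K : R) (psi : p.-tuple mR -> R).
Hypothesis mlam : forall u, measurable_fun setT (lam u).
Hypothesis mB : measurable B.
Hypothesis volBE : lebesgue_tuple p B = volB%:E.
Hypothesis volB0 : 0 < volB.
Hypothesis K0 : 0 <= K.
Hypothesis mpsi : measurable_fun setT psi.
Hypothesis psi0 : forall a, 0 <= psi a.
Hypothesis local : forall a : p.-tuple mR, exists H : T -> \bar R,
  [/\ measurable_fun setT H, forall w, (0 <= H w)%E, (\int[P]_w H w <= K%:E)%E &
    forall u v w, U u -> B v -> u = cV_of_tuple a + cV_of_tuple v ->
      ((expR (lam u w))%:E <= H w)%E].
Hypothesis phi_psi : forall u a v, U u -> B v ->
  u = cV_of_tuple a + cV_of_tuple v -> expR (phi u) <= psi a.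
Variable u_ : nat -> 'cV[R]_p.
Hypothesis Uu : forall m, U (u_ m).
Hypothesis dense : forall u w e, U u -> 0 < e ->
  exists m, lam u w + phi u <= lam (u_ m) w + phi (u_ m) + e.

Let refl m (a : p.-tuple mR) := tuple_affine (tuple_of_cV (u_ m)) (-1) a.
(** The points [a] whose translate a + B contains [u_ m]. *)
Let A m := refl m @^-1` B.

Let mA m : measurable (A m).
Proof. by rewrite -[X in measurable X]setTI; exact: measurable_tuple_affine. Qed.

Let AE m a : A m a -> u_ m = cV_of_tuple a + cV_of_tuple (refl m a).
Proof. by move=> _; rewrite cV_of_tuple_affine tuple_of_cVK scaleN1r addrC subrK. Qed.

Let volA m : lebesgue_tuple p (A m) = volB%:E.
Proof.
have := @lebesgue_tuple_affine _ _ (tuple_of_cV (u_ m)) (-1) B _ mB.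
by rewrite normrN normr1 expr1n mul1e volBE; apply; rewrite oppr_eq0 oner_eq0.
Qed.

Let h m (x : T * p.-tuple mR) := (\1_(A m) x.2 * expR (lam (u_ m) x.1))%:E.

Let measurable_h m : measurable_fun setT (h m).
Proof.
apply/measurable_EFinP; apply: measurable_funM.
  have mI : measurable_fun setT (\1_(A m) : p.-tuple mR -> R).
    exact: measurable_indic.
  by apply: measurableT_comp mI _; exact: measurable_snd.
by apply: measurableT_comp => //; apply: measurableT_comp (mlam _) _;
  exact: measurable_fst.
Qed.

Let h0 m x : (0 <= h m x)%E.
Proof. by rewrite lee_fin mulr_ge0// expR_ge0. Qed.

(** The majorants supplied by [local] are picked separately for each [a], with no measurability in
    [a]. This countable supremum is jointly measurable, and for fixed [a] it lies below the local
    majorant, so it inherits the bound [K]. *)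
Let H (x : T * p.-tuple mR) := esups (h ^~ x) 0%N.

Let hH m x : (h m x <= H x)%E.
Proof. by apply: ereal_sup_ubound; exists m. Qed.

Let H0 x : (0 <= H x)%E.
Proof. exact: le_trans (h0 0%N x) (hH 0%N x). Qed.

Let Q (x : T * p.-tuple mR) := ((psi x.2)%:E * H x)%E.

Let measurable_Q : measurable_fun setT Q.
Proof.
apply: emeasurable_funM; last exact: measurable_fun_esups.
by apply/measurable_EFinP; apply: measurableT_comp mpsi _; exact: measurable_snd.
Qed.

Let Q0 x : (0 <= Q x)%E.
Proof. by rewrite mule_ge0// lee_fin. Qed.

Let bnd w := (volB^-1%:E * \int[lebesgue_tuple p]_a Q (w, a))%E.

Let integral_Q_ge0 w : (0 <= \int[lebesgue_tuple p]_a Q (w, a))%E.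
Proof. by apply: integral_ge0 => a _; exact: Q0. Qed.

(** [A m] has volume [volB], and on it the integrand [Q] is at least the left side. *)
Let bnd_m m w : ((expR (lam (u_ m) w + phi (u_ m)))%:E <= bnd w)%E.
Proof.
apply: (@le_trans _ _ (volB^-1%:E * \int[lebesgue_tuple p]_a
    ((expR (lam (u_ m) w + phi (u_ m)))%:E * (\1_(A m) a)%:E))%E).
  rewrite ge0_integralZl; [|exact: measurableT|exact/measurable_EFinP/measurable_indic
    |by move=> a _; rewrite lee_fin|by rewrite lee_fin expR_ge0].
  have -> : (\int[lebesgue_tuple p]_a (\1_(A m) a)%:E = volB%:E)%E.
    by rewrite integral_indic// setIT; exact: volA.
  by rewrite -!EFinM lee_fin mulrCA mulVf ?mulr1// gt_eqF.
apply: lee_wpmul2l; first by rewrite lee_fin invr_ge0 ltW.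
apply: ge0_le_integral_lower => a; first by rewrite -EFinM lee_fin mulr_ge0 ?expR_ge0.
have [aA|aA] := boolP (a \in A m); last first.
  by rewrite indicE (negbTE aA) mule0 Q0.
have Aa : A m a by move: aA; rewrite inE.
apply: (@le_trans _ _ ((psi a)%:E * h m (w, a))%E); last first.
  by apply: lee_wpmul2l; [rewrite lee_fin|exact: hH].
rewrite /h/= indicE aA mule1 mul1r -EFinM lee_fin expRD mulrC.
by rewrite ler_wpM2r ?expR_ge0//; exact: phi_psi (Uu m) Aa (AE Aa).
Qed.

Lemma sup_majorant : exists bnd : T -> \bar R,
  [/\ measurable_fun setT bnd, forall w, (0 <= bnd w)%E,
    forall u w, U u -> ((expR (lam u w + phi u))%:E <= bnd w)%E &
    (\int[P]_w bnd w <= (K / volB)%:E * \int[lebesgue_tuple p]_a (psi a)%:E)%E].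
Proof.
have mI : measurable_fun setT (fun w => \int[lebesgue_tuple p]_a Q (w, a))%E.
  exact: (measurable_fun_fubini_tonelli_F (m2 := lebesgue_tuple p) Q measurable_Q Q0).
have v0 : (0 <= volB^-1%:E :> \bar R)%E by rewrite lee_fin invr_ge0 ltW.
exists bnd; split.
- exact: measurable_funeM.
- by move=> w; rewrite mule_ge0.
- move=> u w Uu'; have [e|] := eqVneq (bnd w) +oo%E; first by rewrite e leey.
  move=> boo; have bfin : bnd w \is a fin_num.
    by rewrite ge0_fin_numE ?mule_ge0// lt_neqAle boo leey.
  have b0 : 0 < fine (bnd w).
    rewrite -lte_fin fineK//; apply: lt_le_trans (bnd_m 0 w).
    by rewrite lte_fin expR_gt0.
  rewrite -(fineK bfin) lee_fin -(lnK b0) ler_expR.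
  apply/ler_addgt0Pr => e e0; have [m me] := dense w Uu' e0.
  apply: (le_trans me); rewrite lerD2r -ler_expR lnK// -lee_fin fineK//.
- rewrite ge0_integralZl; [|exact: measurableT|exact: mI
    |by move=> w _; exact: integral_Q_ge0|exact: v0].
  rewrite (fubini_tonelli Q measurable_Q Q0).
  rewrite mulrC EFinM -muleA; apply: lee_wpmul2l; first exact: v0.
  rewrite -ge0_integralZl; [|exact: measurableT|exact/measurable_EFinP
    |by move=> a _; rewrite lee_fin|by rewrite lee_fin].
  apply: ge0_le_integral_lower => a.
    by apply: integral_ge0 => w _; exact: Q0.
  have mHa : measurable_fun setT (fun w => H (w, a)).
    apply: (measurableT_comp (f := H)); first exact: measurable_fun_esups.
    exact: measurable_pair2.
  have -> : (\int[P]_w Q (w, a) = \int[P]_w ((psi a)%:E * H (w, a)))%E by [].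
  rewrite ge0_integralZl; [|exact: measurableT|exact: mHa
    |by move=> w _; exact: H0|by rewrite lee_fin].
  rewrite muleC; apply: lee_wpmul2r; first by rewrite lee_fin.
  have [Ha [mH Ha0 Hint Hge]] := local a.
  apply: le_trans Hint; apply: ge0_le_integral_lower => w; first exact: H0.
  apply: ge_ereal_sup => _ [m _ <-]; rewrite /h/=.
  have [aA|aA] := boolP (a \in A m); last first.
    by rewrite indicE (negbTE aA) mul0r Ha0.
  have Aa : A m a by move: aA; rewrite inE.
  by rewrite indicE aA mul1r; exact: Hge (Uu m) Aa (AE Aa).
Qed.

End sup_majorant.

(** No topology on [U] and no regularity of [Phi] are involved: for each k the floors of (k + 1) Phi
    cut [U] into countably many cells of width 1/(k + 1), and the sequence lists one representative
    of each nonempty cell, with [u0] as filler. *)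
Lemma dense_sequence (R : realType) (V : Type) (U : set V) (q : nat)
    (Phi : V -> 'I_q -> R) : U !=set0 ->
  exists2 u_ : nat -> V, forall m, U (u_ m) &
    forall u (e : R), U u -> 0 < e -> exists m, forall j, `|Phi (u_ m) j - Phi u j| <= e.
Proof.
move=> [u0 Uu0].
pose cell (x : nat * {ffun 'I_q -> int}) u :=
  U u /\ forall j, Num.floor (x.1.+1%:R * Phi u j) = x.2 j.
have /choice[rep repP] : forall x, exists u, U u /\ ((exists u', cell x u') -> cell x u).
  move=> x; have [[u cu]|nu] := pselect (exists u', cell x u').
    by exists u; split => //; case: cu.
  by exists u0; split.
exists (fun m => if unpickle m is Some x then rep x else u0).
  by move=> m; case: unpickle => // x; have [] := repP x.
move=> u e Uu e0; pose k := Num.truncn e^-1.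
pose x : nat * {ffun 'I_q -> int} := (k, [ffun j => Num.floor (k.+1%:R * Phi u j)]).
exists (pickle x); rewrite pickleK => j.
have /(proj2 (repP x))[_ hx] : exists u', cell x u'.
  by exists u; split => // i; rewrite ffunE.
have := hx j; rewrite ffunE /= => fe.
have k0 : 0 < k.+1%:R :> R by rewrite ltr0n.
have ke : e^-1 <= k.+1%:R by rewrite ltW// truncnS_gt.
have h : `|k.+1%:R * Phi (rep x) j - k.+1%:R * Phi u j| <= 1.
  have /andP[a1 a2] := floor_itv (k.+1%:R * Phi (rep x) j).
  have /andP[b1 b2] := floor_itv (k.+1%:R * Phi u j).
  move: a1 a2 b1 b2; rewrite fe !intrD => a1 a2 b1 b2.
  by rewrite ler_norml; apply/andP; split; lra.
rewrite -(ler_pM2l k0) -[X in X * `|_|]gtr0_norm// -normrM mulrBr (le_trans h)//.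
by rewrite -ler_pdivrMr// mul1r.
Qed.

Section penalized.
Context d (T : measurableType d) (R : realType) (P : probability T R) (n p : nat).
Local Notation mR := (measurableTypeR R).
Variables (X : 'I_n -> T -> R) (g : 'I_n -> R -> R) (L : R) (tau : 'I_n -> 'cV[R]_p).
Hypothesis L0 : 0 < L.
Hypothesis mX : forall i, measurable_fun setT (X i).
Hypothesis mgf : forall y : 'I_n -> R, (forall i, `|y i| <= 2 * L) ->
  (\int[P]_w (expR (\sum_i y i * X i w))%:E = (expR (\sum_i g i (y i)))%:E)%E.
Hypothesis gb : forall i y, `|y| <= 2 * L -> 0 <= g i y <= y ^+ 2 / 2.
Hypothesis gsub : forall i t, `|t| <= L ->
  exists G, forall s, `|s| <= 2 * L -> g i t + G * (s - t) <= g i s.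
Variables (rho eps : R) (B : set 'cV[R]_p).
Hypothesis rho0 : 0 < rho.
Hypothesis rho1 : rho < 1.
Let k := (1 - rho) / rho.
Let tB := [set z : p.-tuple mR | B (cV_of_tuple z)].
Hypothesis mB : measurable tB.
Hypothesis Bsym : forall v, B v -> B (- v).
Hypothesis Bconv : forall v z (s : R), 0 <= s <= 1 -> B v -> B z ->
  B (s *: v + (1 - s) *: z).
Hypothesis Bt : forall z i, B z -> `|dotp (tau i) z| <= k * L.
Hypothesis Bq : forall z, B z -> \sum_i dotp (tau i) z ^+ 2 <= eps ^+ 2.
Variable volB : R.
Hypothesis volBE : lebesgue_tuple p tB = volB%:E.
Hypothesis volB0 : 0 < volB.
Variables (U : set 'cV[R]_p) (phi : 'cV[R]_p -> R) (psi : p.-tuple mR -> R).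
Hypothesis U0 : U !=set0.
Hypothesis UL : forall u i, U u -> `|dotp (tau i) u| <= L.
Hypothesis mpsi : measurable_fun setT psi.
Hypothesis psi0 : forall a, 0 <= psi a.
Hypothesis phi_psi : forall u a v, U u -> B v ->
  u = cV_of_tuple a + v -> expR (phi u) <= psi a.

Lemma penalized_majorant : exists bnd : T -> \bar R,
  [/\ measurable_fun setT bnd, forall w, (0 <= bnd w)%E,
    forall u w, U u -> ((expR (rho * centered_llr X g tau u w + phi u))%:E <= bnd w)%E &
    (\int[P]_w bnd w <= (expR ((1 - rho) * (p%:R * ln (7 / 2)) +
      2 * eps ^+ 2 * rho ^+ 2 / (1 - rho)) / volB)%:E *
      \int[lebesgue_tuple p]_a (psi a)%:E)%E].
Proof.
(* For fixed [w] the exponent is affine in the numbers t_i(u) and in [c u], which gathers its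
   deterministic part. Density in these n + 1 coordinates suffices, however irregular [phi] is. *)
pose c u := phi u - rho * \sum_i g i (dotp (tau i) u).
pose Phi u (j : 'I_n.+1) := if unlift ord0 j is Some i then dotp (tau i) u else c u.
have [u_ Uu dense] := dense_sequence Phi U0.
have -> : expR ((1 - rho) * (p%:R * ln (7 / 2)) + 2 * eps ^+ 2 * rho ^+ 2 / (1 - rho)) =
    expR ((1 - rho) * (p%:R * ln (7 / 2) + 2 * eps ^+ 2 / k ^+ 2)).
  have e1 : 1 - rho != 0 by rewrite gt_eqF// subr_gt0.
  have e2 : rho != 0 by rewrite gt_eqF.
  by congr expR; rewrite /k; field; rewrite ?e1 ?e2.
apply: (@sup_majorant _ _ _ _ _ U _ phi tB volB _ psi _ mB volBE volB0 _ mpsi psi0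
  _ _ u_ Uu).
- move=> u; apply: measurable_funM => //; apply: measurable_sum => i.
  by apply: measurable_funB => //; exact: measurable_funM.
- exact: expR_ge0.
- move=> a; have [||||H [mH H0 Hint Hge]] := @local_majorant _ _ _ P n p X g L tau L0 mX mgf gb gsub
    rho eps tB rho0 rho1 mB _ _ _ _ volB volBE volB0 a.
  + by move=> z; rewrite /tB/= cV_of_tuple_affine tuple_of_cVK scaleN1r add0r; exact: Bsym.
  + move=> v z; rewrite /tB/= cV_of_tuple_affine tuple_of_cVK => Bv Bz.
    have := @Bconv _ _ (5 / 7) _ Bv Bz.
    rewrite (_ : 1 - 5 / 7 = 2 / 7 :> R); last by field.
    by apply; apply/andP; split; lra.
  + by move=> z i; exact: Bt.
  + by move=> z; exact: Bq.
  exists H; split => // u v w Uu' Bv; apply: Hge => // i; exact: UL.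
- by move=> u a v Uu'; exact: phi_psi.
- move=> u w e Uu' e0; pose K := rho * \sum_i `|X i w| + 1.
  have K0 : 0 < K by rewrite ltr_wpDl// mulr_ge0 ?(ltW rho0)// sumr_ge0.
  have [m me] := dense u _ Uu' (divr_gt0 e0 K0); exists m.
  have E v : rho * centered_llr X g tau v w + phi v =
      rho * (\sum_i X i w * dotp (tau i) v) + c v.
    by rewrite /centered_llr /c big_split/= sumrN; ring.
  rewrite !E.
  have h1 : c u - c (u_ m) <= e / K.
    have := me ord0; rewrite /Phi unlift_none distrC => /(le_trans (ler_norm _)).
    by [].
  have h2 : \sum_i X i w * dotp (tau i) u - \sum_i X i w * dotp (tau i) (u_ m) <=
      \sum_i `|X i w| * (e / K).
    rewrite -sumrB; apply: ler_sum => i _; rewrite -mulrBr (le_trans (ler_norm _))//.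
    by rewrite normrM ler_wpM2l// distrC; have := me (lift ord0 i); rewrite /Phi liftK.
  have h3 : rho * (\sum_i X i w * dotp (tau i) u - \sum_i X i w * dotp (tau i) (u_ m)) <=
      rho * \sum_i `|X i w| * (e / K) by rewrite ler_wpM2l// ltW.
  have : rho * \sum_i `|X i w| * (e / K) + e / K = e.
    by rewrite -mulr_suml mulrA -[X in _ + X]mul1r -mulrDl -/K mulrC divfK// gt_eqF.
  lra.
Qed.

End penalized.

(** * Standardized observations *)

Section exponential_moments.
Context d (T : measurableType d) (R : realType).
Variable P : probability T R.

Lemma integral_expR_gt0 (f : T -> R) : measurable_fun setT f ->
  (0 < \int[P]_w (expR (f w))%:E)%E.
Proof.
move=> mf; rewrite lt_neqAle integral_ge0 ?andbT//.
apply/eqP => h.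
have me : measurable_fun setT (fun w => (expR (f w))%:E).
  by apply/measurable_EFinP; exact: measurableT_comp.
have : ae_eq P setT (fun w => (expR (f w))%:E) (cst 0%E).
  apply/(ae_eq_integral_abs _ measurableT me).
  by under eq_integral do rewrite gee0_abs ?lee_fin ?expR_ge0//.
move=> [N [mN N0 hN]].
have : setT `<=` N.
  move=> w _; apply: hN => /= /(_ I) /eqP; apply/negP.
  by rewrite gt_eqF// lte_fin expR_gt0.
rewrite subTset => NT; have := @probability_setT _ _ _ P.
by rewrite -NT N0 => /eqP; rewrite eq_sym onee_eq0.
Qed.

(** The bound on [lne] rules out an infinite moment and [integral_expR_gt0] a zero one, so the
    logarithm is a genuine real number. *)
Lemma log_mgf_exists (X : T -> R) (L : R) : measurable_fun setT X ->
  (forall y, `|y| <= 2 * L ->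
    (lne (\int[P]_w (expR (y * X w))%:E) <= (y ^+ 2 / 2)%:E)%E) ->
  exists g : R -> R, forall y, `|y| <= 2 * L ->
    (\int[P]_w (expR (y * X w))%:E = (expR (g y))%:E)%E /\ g y <= y ^+ 2 / 2.
Proof.
move=> mX h; exists (fun y => ln (fine (\int[P]_w (expR (y * X w))%:E)%E)) => y yL.
have m0 : (0 < \int[P]_w (expR (y * X w))%:E)%E.
  by apply: integral_expR_gt0; exact: measurable_funM.
have := h _ yL; move: m0; case: (\int[P]_w _)%E => //= m; rewrite lte_fin => m0.
by rewrite (lt_geF m0) lee_fin lnK.
Qed.

Lemma integrable_of_mgf (X : T -> R) (L : R) : 0 < L -> measurable_fun setT X ->
  (\int[P]_w (expR (L * X w))%:E < +oo)%E ->
  (\int[P]_w (expR (- L * X w))%:E < +oo)%E ->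
  P.-integrable setT (fun w => (X w)%:E).
Proof.
move=> L0 mX h1 h2.
have ie (y : R) : (\int[P]_w (expR (y * X w))%:E < +oo)%E ->
    P.-integrable setT (fun w => (expR (y * X w))%:E).
  move=> yoo; apply/integrableP; split.
    by apply/measurable_EFinP; apply: measurableT_comp => //; exact: measurable_funM.
  by under eq_integral do rewrite gee0_abs ?lee_fin ?expR_ge0//.
have i1 : P.-integrable setT (fun w =>
    (L^-1%:E * ((expR (L * X w))%:E + (expR (- L * X w))%:E))%E).
  by apply: integrableZl => //; apply: integrableD => //; exact: ie.
apply: le_integrable i1 => //; first exact/measurable_EFinP.
move=> w _; rewrite -EFinD -EFinM !abse_EFin lee_fin.
by rewrite (le_trans _ (ler_norm _))// normr_le_expR_sum.
Qed.

End exponential_moments.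

Section positive_definite_forms.
Context {R : realType} {p : nat}.
Implicit Types (A S : 'M[R]_p) (u v : 'cV[R]_p).

Lemma qform_sqr S u : S^T = S -> qform (S *m S) u = dotp (S *m u) (S *m u).
Proof. by move=> sS; rewrite /qform /dotp trmx_mul sS !mulmxA. Qed.

Lemma qformZ a A u : qform A (a *: u) = a ^+ 2 * qform A u.
Proof.
rewrite /qform (_ : (a *: u)^T = a *: u^T); last by rewrite linearZ.
by rewrite -scalemxAr -!scalemxAl scalerA mxE expr2.
Qed.

Lemma qform_scale a A u : qform (a *: A) u = a * qform A u.
Proof. by rewrite /qform -scalemxAr -scalemxAl mxE. Qed.

Lemma qform_sum_dyads n (c : 'I_n -> R) (psi : 'I_n -> 'cV[R]_p) u :
  qform (\sum_i c i *: (psi i *m (psi i)^T)) u = \sum_i c i * dotp (psi i) u ^+ 2.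
Proof.
rewrite /qform mulmx_sumr mulmx_suml summxE; apply: eq_bigr => i _.
rewrite -scalemxAr -scalemxAl mxE; congr (_ * _).
rewrite (mulmxA u^T) -(mulmxA (u^T *m psi i)) mxE big_ord1 expr2; congr (_ * _).
by rewrite -[LHS]/(dotp u (psi i)) dotpC.
Qed.

Lemma unitmx_sqrt A S : S^T = S -> S *m S = A ->
  (forall u, u != 0 -> 0 < qform A u) -> S \in unitmx.
Proof.
move=> sS SA pos; rewrite -row_free_unit; apply/inj_row_free => v vS.
apply/eqP; apply/negPn/negP => v0.
have u0 : v^T != 0 by rewrite -trmx0 (inj_eq trmx_inj).
have := pos _ u0; rewrite -SA qform_sqr//.
have -> : S *m v^T = 0 by rewrite -sS -trmx_mul vS trmx0.
by rewrite dotp0r ltxx.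
Qed.

Lemma dotp_invmx S (x v : 'cV[R]_p) : S^T = S -> S \in unitmx ->
  dotp (invmx S *m x) (S *m v) = dotp x v.
Proof.
move=> sS uS; rewrite /dotp trmx_mul trmx_inv sS -mulmxA (mulmxA (invmx S)).
by rewrite mulVmx// mul1mx.
Qed.

End positive_definite_forms.

(** Every c >= 0 is a value of [expeR] on the extended line, so monotonicity alone carries the bound
    through the supremum. *)
Lemma expeR_ereal_sup_le (R : realType) (A : set (\bar R)) (c : \bar R) :
  (0 <= c)%E -> (forall x, A x -> (expeR x <= c)%E) -> (expeR (ereal_sup A) <= c)%E.
Proof.
move=> c0 h; have [y yc] := expeR_total c0.
rewrite -yc lee_expeR; apply: ge_ereal_sup => x /h.
by rewrite -yc lee_expeR.
Qed.

Lemma expeR_mul_ereal_sup_le (R : realType) (r : R) (A : set (\bar R)) (c : \bar R) :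
  0 < r -> (0 <= c)%E -> (forall x, A x -> (expeR (r%:E * x) <= c)%E) ->
  (expeR (r%:E * ereal_sup A) <= c)%E.
Proof.
move=> r0 c0 h; have [y yc] := expeR_total c0.
rewrite -yc lee_expeR muleC -lee_pdivlMr//; apply: ge_ereal_sup => x /h.
by rewrite -yc lee_expeR muleC -lee_pdivlMr.
Qed.

(** The moment condition is read at lambda = y/2: the range becomes |y| <= 2L and the bound
    y^2/2. *)
Lemma standardized_family d (T : measurableType d) (R : realType) (P : probability T R)
    n (Y : 'I_n -> {RV P >-> R}) (b nn : 'I_n -> R) (L : R) :
  0 < L -> (forall i, 0 < nn i) -> mutually_independent P (fun i => Y i) ->
  (forall i, 'E_P[Y i] = (b i)%:E)%E ->
  (forall i lambda, `|lambda| <= L ->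
    (lne 'E_P[fun w => expR (2 * lambda * ((Y i w - b i) / nn i))]
       <= (2 * lambda ^+ 2)%R%:E)%E) ->
  exists g : 'I_n -> R -> R, let X i w := (Y i w - b i) / nn i in
    [/\ forall i, measurable_fun setT (X i),
      forall y : 'I_n -> R, (forall i, `|y i| <= 2 * L) ->
        (\int[P]_w (expR (\sum_i y i * X i w))%:E = (expR (\sum_i g i (y i)))%:E)%E,
      forall i y, `|y| <= 2 * L -> 0 <= g i y <= y ^+ 2 / 2 &
      forall i t, `|t| <= L ->
        exists G, forall s, `|s| <= 2 * L -> g i t + G * (s - t) <= g i s].
Proof.
move=> L0 nn0 indY EY hmgf; pose X i w := (Y i w - b i) / nn i.
have mX i : measurable_fun setT (X i).
  by apply: measurable_funM => //; exact: measurable_funB.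
have mgf i y : `|y| <= 2 * L ->
    (lne (\int[P]_w (expR (y * X i w))%:E) <= (y ^+ 2 / 2)%:E)%E.
  move=> yL; have y2 : `|y / 2| <= L.
    by rewrite normrM (@ger0_norm _ 2^-1) ?invr_ge0//; lra.
  have := hmgf i _ y2; rewrite unlock.
  rewrite (_ : 2 * (y / 2) ^+ 2 = y ^+ 2 / 2); last by field.
  apply: le_trans; rewrite le_eqVlt; apply/orP; left; apply/eqP.
  have yE : 2 * (y / 2) = y by field.
  by congr lne; apply: eq_integral => w _ /=; rewrite yE.
have /choice[g gP] := fun i => log_mgf_exists (mX i) (mgf i).
have iX i : P.-integrable setT (fun w => (X i w)%:E).
  have L2 : `|L| <= 2 * L by rewrite ger0_norm; lra.
  apply: (integrable_of_mgf L0 (mX i)); last rewrite -normrN in L2.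
    by have [-> _] := gP i _ L2; rewrite ltry.
  by have [-> _] := gP i _ L2; rewrite ltry.
have EX i : (\int[P]_w (X i w)%:E = 0)%E.
  have : (\int[P]_w ((nn i)%:E * (X i w)%:E + (b i)%:E) = (b i)%:E)%E.
    rewrite -[RHS](EY i) unlock; apply: eq_integral => w _.
    by rewrite -EFinM -EFinD /X mulrC divfK ?subrK// gt_eqF.
  rewrite integralD//; last 2 first.
  - exact: integrableZl.
  - exact: finite_measure_integrable_cst.
  rewrite integralZl// integral_cst_probability.
  have := integrable_fin_num measurableT (iX i).
  case: (\int[P]_w _)%E => //= m _.
  rewrite -EFinM -EFinD => -[] /eqP; rewrite -subr_eq0 addrK mulf_eq0.
  by rewrite gt_eqF//= => /eqP ->.
exists g; split => //.
- move=> y yL; rewrite (_ : (expR _)%:E = \prod_i (expR (g i (y i)))%:E)%E; last first.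
    by rewrite prodEFin expR_sum.
  have := @integral_prod_independent _ _ _ P n (fun i => Y i)
    (fun i r => expR (y i * ((r - b i) / nn i))) _ indY _ _.
  under eq_integral do rewrite -expR_sum.
  move=> -> //; first by apply: eq_bigr => i _; have [-> _] := gP i _ (yL i).
    move=> i; apply: measurableT_comp => //; apply: measurable_funM => //.
    by apply: measurable_funM => //; exact: measurable_funB.
- move=> i y yL; have [_ ->] := gP i _ yL; rewrite andbT.
  have h z : `|z| <= 2 * L -> (\int[P]_w (expR (z * X i w))%:E = (expR (g i z))%:E)%E.
    by move=> zL; have [] := gP i _ zL.
  by have [_ ->] := log_mgf_subgradients L0 (mX i) (EX i) h.
- move=> i.
  have h z : `|z| <= 2 * L -> (\int[P]_w (expR (z * X i w))%:E = (expR (g i z))%:E)%E.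
    by move=> zL; have [] := gP i _ zL.
  by have [hs _] := log_mgf_subgradients L0 (mX i) (EX i) h.
Qed.

(** * The Euclidean ball as body, with a radial penalty *)

Section penalized_ball.
Context d (T : measurableType d) (R : realType) (P : probability T R) (n p : nat).
Local Notation mR := (measurableTypeR R).
Variables (X : 'I_n -> T -> R) (g : 'I_n -> R -> R) (L : R) (tau : 'I_n -> 'cV[R]_p).
Hypothesis p0 : (0 < p)%N.
Hypothesis L0 : 0 < L.
Hypothesis mX : forall i, measurable_fun setT (X i).
Hypothesis mgf : forall y : 'I_n -> R, (forall i, `|y i| <= 2 * L) ->
  (\int[P]_w (expR (\sum_i y i * X i w))%:E = (expR (\sum_i g i (y i)))%:E)%E.
Hypothesis gb : forall i y, `|y| <= 2 * L -> 0 <= g i y <= y ^+ 2 / 2.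
Hypothesis gsub : forall i t, `|t| <= L ->
  exists G, forall s, `|s| <= 2 * L -> g i t + G * (s - t) <= g i s.
Hypothesis tauE : forall u, \sum_i dotp (tau i) u ^+ 2 = dotp u u.
Variable rho : R.
Hypothesis rho0 : 0 < rho.
Hypothesis rho1 : rho < 1.
Variable U : set 'cV[R]_p.
Hypothesis U0 : U !=set0.
Hypothesis UL : forall u i, U u -> `|dotp (tau i) u| <= L.

(** If u lies in a + B then |a| <= |u| + eps, so psi(a) = kappa(|a|/eps) dominates kappa(|u|/eps +
    1): this is the origin of the shift by 1 in the penalty. Rescaling the integral of psi by eps
    cancels the eps^p in the volume of [B], and [radial_mass] remains. *)
Lemma penalized_ball_majorant (eps : R) (kappa : R -> R) : 0 < eps ->
  (forall z i, enorm z <= eps -> `|dotp (tau i) z| <= (1 - rho) / rho * L) ->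
  (forall t, 0 <= t -> 0 < kappa t) ->
  (forall t t', 0 <= t -> t <= t' -> kappa t' <= kappa t) ->
  exists bnd : T -> \bar R,
  [/\ forall w, (0 <= bnd w)%E,
    forall u w, U u -> ((expR (rho * centered_llr X g tau u w +
      ln (kappa (eps^-1 * enorm u + 1))))%:E <= bnd w)%E &
    (\int[P]_w bnd w <= (expR ((1 - rho) * (p%:R * ln (7 / 2)) +
      2 * eps ^+ 2 * rho ^+ 2 / (1 - rho)))%:E * radial_mass p kappa)%E].
Proof.
move=> eps0 Bt k0 kd.
have vol0 := ball_volume_gt0 (R := R) p0.
have volf := ball_volume_fin_num (R := R) p0.
pose om := fine (ball_volume (R := R) p).
have omE : ball_volume (R := R) p = om%:E by rewrite fineK.
have om0 : 0 < om by rewrite -lte_fin -omE.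
have ep0 : 0 < eps ^+ p by rewrite exprn_gt0.
have mk : measurable_fun setT
    (fun a : p.-tuple mR => kappa (eps^-1 * enorm (cV_of_tuple a))).
  apply: (@measurable_radial R p (fun t => kappa (eps^-1 * t))) => t t' t0 tt'.
  by apply: kd; rewrite ?mulr_ge0 ?ler_wpM2l// invr_ge0 ltW.
have psiE : (\int[lebesgue_tuple p]_(a in setT)
    (kappa (eps^-1 * enorm (cV_of_tuple a)))%:E =
    (eps ^+ p)%:E * \int[lebesgue_tuple p]_a (kappa (enorm (cV_of_tuple a)))%:E)%E.
  rewrite -(@ge0_integral_tuple_affine _ p (tuple_of_cV 0) eps).
  - rewrite ger0_norm ?ltW//; congr (_ * _)%E; apply: eq_integral => a _.
    rewrite cV_of_tuple_affine tuple_of_cVK add0r enormZ ger0_norm ?ltW//.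
    by rewrite mulKf// gt_eqF.
  - by rewrite gt_eqF.
  - exact/measurable_EFinP.
  - by move=> a; rewrite lee_fin ltW// k0// mulr_ge0 ?enorm_ge0// invr_ge0 ltW.
have [||||||||bnd [mbnd bnd0 bndge bndle]] := @penalized_majorant _ _ _ P n p X g L tau L0 mX
  mgf gb gsub rho eps [set u | enorm u <= eps] rho0 rho1 (@measurable_tuple_ball R p eps)
  _ _ _ _ (eps ^+ p * om) _ _ U
  (fun u => ln (kappa (eps^-1 * enorm u + 1)))
  (fun a => kappa (eps^-1 * enorm (cV_of_tuple a))) U0 UL mk _ _.
- by move=> v; rewrite /= enormN.
- move=> v z s /andP[s0 s1] /= v1 z1; apply: le_trans (enormD _ _) _.
  rewrite !enormZ !ger0_norm ?subr_ge0//.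
  have := ler_wpM2l s0 v1; have s1' : 0 <= 1 - s by rewrite subr_ge0.
  have := ler_wpM2l s1' z1; lra.
- by move=> z i; exact: Bt.
- by move=> z /= ze; rewrite tauE -le_enorm_sqr// ltW.
- by rewrite EFinM -omE; exact: lebesgue_tuple_ball.
- by rewrite mulr_gt0.
- by move=> a; rewrite ltW// k0// mulr_ge0 ?enorm_ge0// invr_ge0 ltW.
- move=> u a v Uu /= ve ua; rewrite lnK; last first.
    by rewrite posrE k0// addr_ge0// mulr_ge0 ?enorm_ge0// invr_ge0 ltW.
  apply: kd; first by rewrite mulr_ge0 ?enorm_ge0// invr_ge0 ltW.
  have -> : eps^-1 * enorm u + 1 = eps^-1 * (enorm u + eps).
    by rewrite mulrDr mulVf// gt_eqF.
  rewrite ler_wpM2l ?invr_ge0 ?(ltW eps0)//.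
  have -> : cV_of_tuple a = u - v by rewrite ua addrK.
  by apply: le_trans (enormD _ _) _; rewrite enormN lerD2l.
exists bnd; split => //; apply: le_trans bndle _.
rewrite psiE /radial_mass omE inver gt_eqF//.
rewrite muleA -EFinM muleA -EFinM le_eqVlt; apply/orP; left; apply/eqP.
congr (_%:E * _)%E; move: (expR _) ep0 => e; move: (eps ^+ p) => v v0.
by field; rewrite !gt_eqF.
Qed.

End penalized_ball.

(** * The two choices of body *)

Section slab.
Context {R : realType} (n p : nat).
Local Notation mR := (measurableTypeR R).
Variable tau : 'I_n -> 'cV[R]_p.
Hypothesis p0 : (0 < p)%N.
Hypothesis tauE : forall u, \sum_i dotp (tau i) u ^+ 2 = dotp u u.

Definition slab (r : R) : set 'cV[R]_p := [set u | forall i, `|dotp (tau i) u| <= r].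

Definition tuple_slab (r : R) : set (p.-tuple mR) := [set z | slab r (cV_of_tuple z)].

Definition slab_ball (r e : R) : set (p.-tuple mR) := tuple_slab r `&` tuple_ball e.

Lemma measurable_tuple_slab r : measurable (tuple_slab r).
Proof.
rewrite (_ : tuple_slab r =
    \bigcap_(i in [set: 'I_n]) [set z | `|dotp (tau i) (cV_of_tuple z)| <= r]); last first.
  by apply/seteqP; split => z h; [move=> i _|move=> i]; [exact: h|exact: (h i I)].
apply: fin_bigcap_measurable; first exact: finite_finset.
move=> i _; apply: measurable_preimage_true; apply: measurable_fun_ler => //.
by apply: measurableT_comp => //; exact: measurable_dotp_tuple.
Qed.

Lemma measurable_slab_ball r e : measurable (slab_ball r e).
Proof. by apply: measurableI; [exact: measurable_tuple_slab|exact: measurable_tuple_ball]. Qed.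

Lemma normr_dotp_le_enorm i u : `|dotp (tau i) u| <= enorm u.
Proof.
rewrite -(@ler_pXn2r _ 2)// ?nnegrE ?enorm_ge0// real_normK ?num_real//.
rewrite sqr_enorm -tauE (bigD1 i)//= lerDl sumr_ge0// => j _; exact: sqr_ge0.
Qed.

Lemma slab_enorm_le r u : 0 <= r -> slab r u -> enorm u <= n.+1%:R * r.
Proof.
move=> r0 hu; rewrite le_enorm_sqr ?mulr_ge0// -tauE.
apply: (@le_trans _ _ (\sum_(i < n) r ^+ 2)).
  apply: ler_sum => i _; rewrite -[X in X <= _]real_normK ?num_real//.
  by rewrite ler_pXn2r ?nnegrE.
rewrite sumr_const card_ord -[leLHS]mulr_natl exprMn; apply: ler_wpM2r; rewrite ?sqr_ge0//.
rewrite -natrX ler_nat (leq_trans (leqnSn n))//.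
by rewrite -[X in (X <= _)%N]expn1 leq_pexp2l.
Qed.

Lemma lebesgue_slab_ball r e : 0 < r -> 0 < e ->
  exists2 v, 0 < v & lebesgue_tuple p (slab_ball r e) = v%:E.
Proof.
move=> r0 e0.
have vol0 := ball_volume_gt0 (R := R) p0.
have vole : (lebesgue_tuple p (slab_ball r e) < +oo)%E.
  apply: (@le_lt_trans _ _ (lebesgue_tuple p (tuple_ball e))).
    apply: le_measure; rewrite ?inE; [exact: measurable_slab_ball|exact: measurable_tuple_ball|].
    exact: subIsetr.
  rewrite lebesgue_tuple_ball// lte_mul_pinfty// ?ball_volume_fin//.
  by rewrite lee_fin exprn_ge0// ltW.
have m0 : 0 < Num.min r e by rewrite lt_min r0.
have vol1 : (0 < lebesgue_tuple p (slab_ball r e))%E.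
  apply: (@lt_le_trans _ _ (lebesgue_tuple p (tuple_ball (Num.min r e)))).
    by rewrite lebesgue_tuple_ball// mule_gt0// lte_fin exprn_gt0.
  apply: le_measure; rewrite ?inE; [exact: measurable_tuple_ball|exact: measurable_slab_ball|].
  move=> z; rewrite /tuple_ball/= le_min => /andP[zr ze]; split => // i.
  by apply: le_trans (normr_dotp_le_enorm _ _) zr.
exists (fine (lebesgue_tuple p (slab_ball r e))); last first.
  by rewrite fineK// ge0_fin_numE.
by rewrite fine_gt0// vol1.
Qed.

(* At most half of the integral lies outside the ball of radius [2 sqrt p / c]: there
   the integrand is at most [e^(-3p)] times its value at [z / 2], and the slab is
   star-shaped.  What is left is contained in the dilation of [slab_ball] by [s]. *)
Lemma gaussian_slab_integral (r q s c v : R) : 0 < r -> 0 < c -> 0 < s -> 0 < q ->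
  r <= s * q -> 2 * (Num.sqrt p%:R / c) <= s * Num.sqrt p%:R ->
  lebesgue_tuple p (slab_ball q (Num.sqrt p%:R)) = v%:E ->
  (\int[lebesgue_tuple p]_z
     (\1_(tuple_slab r) z * expR (- (c ^+ 2 * dotp (cV_of_tuple z) (cV_of_tuple z))))%:E <=
   (2 * (s ^+ p * v))%:E)%E.
Proof.
move=> r0 c0 s0 q0 rs es vE.
pose F z := \1_(tuple_slab r) z * expR (- (c ^+ 2 * dotp (cV_of_tuple z) (cV_of_tuple z))).
have F0 z : 0 <= F z by rewrite mulr_ge0// expR_ge0.
have mS := measurable_tuple_slab r.
have mF : measurable_fun setT F.
  apply: measurable_funM; first exact: measurable_indic.
  apply: measurableT_comp => //; apply: measurableT_comp => //.
  apply: measurable_funM => //.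
  apply: (eq_measurable_fun (fun z : p.-tuple mR => enorm (cV_of_tuple z) ^+ 2)).
    by move=> z _; rewrite sqr_enorm.
  by apply: measurable_funX; exact: measurable_enorm_tuple.
have mEF : measurable_fun setT (fun z => (F z)%:E) by exact/measurable_EFinP.
have F1 z : F z <= \1_(tuple_slab r) z.
  rewrite /F ler_piMr// -[leRHS]expR0 ler_expR oppr_le0.
  by rewrite mulr_ge0 ?sqr_ge0 ?dotp_ge0.
have indT A : measurable A ->
    (\int[lebesgue_tuple p]_z (\1_A z)%:E = lebesgue_tuple p A)%E.
  by move=> mA; rewrite integral_indic// setIT.
set I := (\int[_]_z _)%E.
(* Finiteness allows the final inequality I <= D + I/2 to be solved for I. The slab is bounded since
   the squares of the t_i sum to |u|^2. *)
have Ioo : (I < +oo)%E.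
  apply: (@le_lt_trans _ _ (lebesgue_tuple p (tuple_ball (n.+1%:R * r)))).
    rewrite -indT; last exact: measurable_tuple_ball.
    apply: ge0_le_integral_lower => z; rewrite lee_fin// (le_trans (F1 z))//.
    rewrite !indicE ler_nat; case: (boolP (z \in tuple_slab r)) => //.
    rewrite inE => /(slab_enorm_le (ltW r0)) zr.
    by rewrite (_ : z \in tuple_ball _) // inE.
  rewrite lebesgue_tuple_ball ?mulr_gt0// lte_mul_pinfty// ?ball_volume_fin//.
  by rewrite lee_fin exprn_ge0// mulr_ge0// ltW.
pose D := slab_ball r (2 * (Num.sqrt p%:R / c)).
have mD : measurable D by exact: measurable_slab_ball.
pose h := tuple_affine (tuple_of_cV (0 : 'cV[R]_p)) 2^-1.
have hE z : cV_of_tuple (h z) = 2^-1 *: cV_of_tuple z.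
  by rewrite cV_of_tuple_affine tuple_of_cVK add0r.
have Fh : (\int[lebesgue_tuple p]_z (F (h z))%:E = (2 ^+ p)%:E * I)%E.
  rewrite /I -/F -(@ge0_integral_tuple_affine _ p (tuple_of_cV 0) 2^-1 (fun z => (F z)%:E))//.
    by rewrite muleA -EFinM ger0_norm// -exprMn divff// expr1n mul1e.
have FD z : F z <= \1_D z + expR (- (3 * p%:R)) * F (h z).
  have [zD|zD] := pselect (D z).
    rewrite (le_trans (F1 z))// !indicE (mem_set zD).
    apply: (@le_trans _ _ 1); first by case: (_ \in _).
    by rewrite lerDl mulr_ge0// expR_ge0.
  rewrite [X in X + _]indicE memNset// add0r /F !indicE.
  have [zr|zr] := pselect (tuple_slab r z); last by rewrite memNset// mul0r !mulr_ge0// expR_ge0.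
  have hzr : tuple_slab r (h z).
    move=> i; rewrite hE dotpZr normrM ger0_norm//.
    rewrite (le_trans _ (zr i))// ler_piMl// invf_le1//; lra.
  rewrite !mem_set// !mul1r -expRD ler_expR hE dotpZr dotpZl.
  have : 2 * (Num.sqrt p%:R / c) < enorm (cV_of_tuple z).
    by rewrite ltNge; apply/negP => zc; apply: zD; split.
  have e0 : 0 <= 2 * (Num.sqrt p%:R / c) by rewrite mulr_ge0// divr_ge0// ?sqrtr_ge0// ltW.
  rewrite -(@ltr_pXn2r _ 2)// ?nnegrE ?enorm_ge0// sqr_enorm !exprMn sqr_sqrtr//.
  rewrite exprVn mulrA ltr_pdivrMr ?exprn_gt0// => hz.
  lra.
have I2 : (I <= lebesgue_tuple p D + 2^-1%:E * I)%E.
  have : (I <= \int[lebesgue_tuple p]_z ((\1_D z)%:E + (expR (- (3 * p%:R)))%:E * (F (h z))%:E))%E.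
    apply: ge0_le_integral_lower => z; first by rewrite lee_fin; exact: F0.
    by rewrite -EFinM -EFinD lee_fin; exact: FD.
  move/le_trans; apply.
  have mFh : measurable_fun setT (fun z => (F (h z))%:E).
    by apply: (measurableT_comp mEF); exact: measurable_tuple_affine.
  rewrite ge0_integralD//; last 3 first.
  - by apply/measurable_EFinP; exact: measurable_indic.
  - by move=> z _; rewrite mule_ge0// lee_fin ?expR_ge0.
  - exact: measurable_funeM.
  have Fh0 z : setT z -> (0 <= (F (h z))%:E)%E by rewrite lee_fin.
  have e0 : (0 <= (expR (- (3 * p%:R) : R))%:E)%E by rewrite lee_fin expR_ge0.
  rewrite (ge0_integralZl _ measurableT mFh Fh0 e0) indT; last by [].
  rewrite Fh [X in (_ + X)%E]muleA -EFinM; apply: leeD2l; apply: lee_wpmul2r.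
    by apply: integral_ge0 => z _; rewrite lee_fin.
  (* The dilation costs 2^p and the tail gains e^(-3p); e^3 >= 1 + 3 leaves at most 2^(-p) <=
     1/2. *)
  rewrite lee_fin expRN mulrC expRM_natr -exprVn -exprMn.
  apply: (@le_trans _ _ (2^-1 ^+ p)).
    rewrite ler_pXn2r ?nnegrE ?mulr_ge0// ?invr_ge0 ?expR_ge0//.
    have := @expR_ge1Dx R 3; rewrite ler_pdivrMr ?expR_gt0//; lra.
  rewrite -[X in _ <= X]expr1; apply: ler_wiXn2l => //; lra.
have DB : (lebesgue_tuple p D <= (s ^+ p * v)%:E)%E.
  have s'0 : s^-1 != 0 by rewrite invr_eq0 gt_eqF.
  have := lebesgue_tuple_affine (tuple_of_cV (0 : 'cV[R]_p)) s'0 (measurable_slab_ball q (Num.sqrt p%:R)).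
  rewrite vE ger0_norm ?invr_ge0 ?(ltW s0)// => vs.
  rewrite EFinM -vs muleA -EFinM -exprMn divff ?gt_eqF// expr1n mul1e.
  apply: le_measure; rewrite ?inE//.
    rewrite -[X in measurable X]setTI; apply: measurable_tuple_affine => //.
    exact: measurable_slab_ball.
  move=> z [zr ze]; split.
    move=> i; rewrite cV_of_tuple_affine tuple_of_cVK add0r dotpZr normrM ger0_norm ?invr_ge0 ?(ltW s0)//.
    by rewrite ler_pdivrMl// (le_trans (zr i)).
  rewrite /tuple_ball/= cV_of_tuple_affine tuple_of_cVK add0r enormZ ger0_norm ?invr_ge0 ?(ltW s0)//.
  by rewrite ler_pdivrMl// (le_trans ze).
have I0 : (0 <= I)%E by apply: integral_ge0 => z _; rewrite lee_fin.
have := le_trans I2 (leeD2r _ DB).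
move: (I) I0 Ioo; case=> //= I' _ _.
by rewrite -EFinM -EFinD !lee_fin; lra.
Qed.

End slab.

Section quadratic_penalty.
Context d (T : measurableType d) (R : realType) (P : probability T R) (n p : nat).
Local Notation mR := (measurableTypeR R).
Variables (X : 'I_n -> T -> R) (g : 'I_n -> R -> R) (L : R) (tau : 'I_n -> 'cV[R]_p).
Hypothesis p0 : (0 < p)%N.
Hypothesis L0 : 0 < L.
Hypothesis mX : forall i, measurable_fun setT (X i).
Hypothesis mgf : forall y : 'I_n -> R, (forall i, `|y i| <= 2 * L) ->
  (\int[P]_w (expR (\sum_i y i * X i w))%:E = (expR (\sum_i g i (y i)))%:E)%E.
Hypothesis gb : forall i y, `|y| <= 2 * L -> 0 <= g i y <= y ^+ 2 / 2.
Hypothesis gsub : forall i t, `|t| <= L ->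
  exists G, forall s, `|s| <= 2 * L -> g i t + G * (s - t) <= g i s.
Hypothesis tauE : forall u, \sum_i dotp (tau i) u ^+ 2 = dotp u u.
Variable rho : R.
Hypothesis rho0 : 0 < rho.
Hypothesis rho1 : rho < 1.
Variable U : set 'cV[R]_p.
Hypothesis U0 : U !=set0.
Hypothesis UL : forall u i, U u -> `|dotp (tau i) u| <= L.

(** Radius sqrt p makes all exponents linear in p, and the slabs |t_i| <= k L restore the bound on
    t_i that such a ball may violate. With c = a1 sqrt(rho/2), the summand 1/(1 - rho) of [s]
    dilates the slab from k L to (1 + k) L = L/rho, and 2/c dilates the radius to 2 sqrt p / c. The
    volume of the body is never computed: it cancels against that of its dilation. *)
Lemma quadratic_penalty_majorant (a1 s : R) : 0 < a1 ->
  s = (1 - rho)^-1 + 2 / (a1 * Num.sqrt (rho / 2)) ->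
  exists bnd : T -> \bar R,
  [/\ forall w, (0 <= bnd w)%E,
    forall u w, U u -> ((expR (rho * (centered_llr X g tau u w - a1 ^+ 2 * dotp u u)))%:E
      <= bnd w)%E &
    (\int[P]_w bnd w <= (expR (p%:R * ((1 - rho) * ln (7 / 2) +
      2 * rho ^+ 2 / (1 - rho) + rho * a1 ^+ 2 + ln 2 + ln s)))%:E)%E].
Proof.
move=> a0 sE.
have r0 := rho0; have r1 := rho1; have l0 := L0.
have eta0 : 0 < 1 - rho by rewrite subr_gt0.
pose k := (1 - rho) / rho; have k0 : 0 < k by rewrite divr_gt0.
pose e := Num.sqrt (p%:R : R).
have e0 : 0 < e by rewrite sqrtr_gt0 ltr0n.
have e2 : e ^+ 2 = p%:R by rewrite sqr_sqrtr.
pose c := a1 * Num.sqrt (rho / 2).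
have c0 : 0 < c by rewrite mulr_gt0// sqrtr_gt0 divr_gt0.
have c2 : c ^+ 2 = rho * a1 ^+ 2 / 2.
  by rewrite exprMn sqr_sqrtr ?divr_ge0 ?(ltW rho0)//; field.
have s0 : 0 < s by rewrite sE addr_gt0 ?invr_gt0// divr_gt0.
have s1 : (1 + k) * L <= s * (k * L).
  apply: (@le_trans _ _ ((1 - rho)^-1 * (k * L))).
    rewrite le_eqVlt; apply/orP; left; apply/eqP; rewrite /k; field.
    by rewrite !gt_eqF.
  apply: ler_wpM2r; first by rewrite mulr_ge0// ltW.
  by rewrite sE lerDl divr_ge0// ltW.
have s2 : 2 * (e / c) <= s * e.
  rewrite mulrA (mulrAC _ e); apply: ler_wpM2r; first exact: ltW.
  by rewrite sE lerDr invr_ge0 ltW.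
have kL0 : 0 < k * L by rewrite mulr_gt0.
have [v v0 vE] := lebesgue_slab_ball p0 tauE kL0 e0.
have kL1 : 0 < (1 + k) * L by rewrite mulr_gt0// addr_gt0.
have Ile := gaussian_slab_integral p0 tauE kL1 c0 s0 kL0 s1 s2 vE.
pose A := rho * a1 ^+ 2 * p%:R.
pose F (z : p.-tuple mR) := \1_(tuple_slab tau ((1 + k) * L)) z *
  expR (- (c ^+ 2 * dotp (cV_of_tuple z) (cV_of_tuple z))).
have mF : measurable_fun setT F.
  apply: measurable_funM; first by apply: measurable_indic; exact: measurable_tuple_slab.
  apply: measurableT_comp => //; apply: measurableT_comp => //.
  apply: measurable_funM => //.
  apply: (eq_measurable_fun (fun z : p.-tuple mR => enorm (cV_of_tuple z) ^+ 2)).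
    by move=> z _; rewrite sqr_enorm.
  by apply: measurable_funX; exact: measurable_enorm_tuple.
have F0 z : 0 <= F z by rewrite mulr_ge0// expR_ge0.
have mEF : measurable_fun setT (fun z => expR A * F z) by exact: measurable_funM.
have EF0 z : 0 <= expR A * F z by rewrite mulr_ge0// expR_ge0.
have [|||||bnd [mbnd bnd0 bndge bndle]] := @penalized_majorant _ _ _ P n p X g L tau L0 mX
  mgf gb gsub rho e (slab tau (k * L) `&` [set u | enorm u <= e]) rho0 rho1
  (measurable_slab_ball tau (k * L) e) _ _ _ _ v vE v0 U
  (fun u => - (rho * a1 ^+ 2 * dotp u u))
  (fun a => expR A * F a) U0 UL mEF EF0 _.
- move=> u [/= ut ue]; split; last by rewrite /= enormN.
  by move=> i; rewrite dotpNr normrN.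
- move=> u z t /andP[t0 t1] [/= u1 u2] [/= z1 z2].
  have t1' : 0 <= 1 - t by rewrite subr_ge0.
  split; last first.
    apply: le_trans (enormD _ _) _; rewrite !enormZ !ger0_norm//.
    have := ler_wpM2l t0 u2; have := ler_wpM2l t1' z2; lra.
  move=> i; rewrite dotpDr !dotpZr; apply: le_trans (ler_normD _ _) _.
  rewrite !normrM !(ger0_norm t0) !(ger0_norm t1').
  have := ler_wpM2l t0 (u1 i); have := ler_wpM2l t1' (z1 i).
  move: (k * L) => q; lra.
- by move=> z i [/= zt _]; exact: zt.
- by move=> z [_ /= ze]; rewrite tauE -le_enorm_sqr// ltW.
- move=> u a w Uu [/= wt we] ua.
  have aE : cV_of_tuple a = u - w by rewrite ua addrK.
  rewrite /F indicE mem_set; last first.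
    move=> i; rewrite aE dotpBr (le_trans (ler_normB _ _))//.
    by rewrite mulrDl mul1r lerD//; exact: UL.
  rewrite mul1r -expRD ler_expR.
  (* Since c^2 = rho a1^2/2, this makes c^2 |a|^2 exceed the penalty rho a1^2 |u|^2 by at most
     [A]. *)
  have a2 : dotp (cV_of_tuple a) (cV_of_tuple a) <= 2 * dotp u u + 2 * p%:R.
    have ww : dotp w w <= p%:R by rewrite -e2 -le_enorm_sqr// ltW.
    have := dotp_ge0 (u + w); rewrite dotpDl !dotpDr aE dotpBl !dotpBr (dotpC w u).
    move: (dotp u u) (dotp w w) (dotp u w) ww => x y z; move: (p%:R : R) => q; lra.
  have ra : 0 <= rho * a1 ^+ 2 / 2 by rewrite divr_ge0// mulr_ge0 ?sqr_ge0 ?(ltW rho0).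
  have := ler_wpM2l ra a2; rewrite c2 /A; move: (rho * a1 ^+ 2) => q.
  move: (dotp u u) (dotp _ _) (p%:R : R) => x y z; lra.
exists bnd; split => //.
  move=> u w Uu; apply: le_trans (bndge u w Uu).
  by rewrite lee_fin ler_expR mulrBr mulrA.
apply: le_trans bndle _.
have IF : (\int[lebesgue_tuple p]_a (expR A * F a)%:E <=
    (expR A)%:E * (2 * (s ^+ p * v))%:E)%E.
  have mF' : measurable_fun setT (fun z => (F z)%:E) by exact/measurable_EFinP.
  have F0' z : setT z -> (0 <= (F z)%:E)%E by rewrite lee_fin.
  have A0 : (0 <= (expR A)%:E)%E by rewrite lee_fin expR_ge0.
  under eq_integral do rewrite EFinM.
  by rewrite (ge0_integralZl _ measurableT mF' F0' A0); apply: lee_wpmul2l.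
have c1 : (0 <= (expR ((1 - rho) * (p%:R * ln (7 / 2)) +
      2 * e ^+ 2 * rho ^+ 2 / (1 - rho)) / v)%:E)%E.
  by rewrite lee_fin divr_ge0 ?expR_ge0// ltW.
apply: le_trans (lee_wpmul2l c1 IF) _.
rewrite -!EFinM lee_fin e2.
have -> : p%:R * ((1 - rho) * ln (7 / 2) + 2 * rho ^+ 2 / (1 - rho) +
    rho * a1 ^+ 2 + ln 2 + ln s) =
  ((1 - rho) * (p%:R * ln (7 / 2)) + 2 * p%:R * rho ^+ 2 / (1 - rho)) + A
    + p%:R * ln 2 + p%:R * ln s.
  by rewrite /A; field; rewrite gt_eqF.
have final (Z A' : R) : expR Z / v * (expR A' * (2 * (s ^+ p * v))) <=
    expR (Z + A' + p%:R * ln 2 + p%:R * ln s).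
  rewrite !expRD !(mulrC p%:R (ln _)) !expRM_natr !lnK ?posrE//.
  have -> : expR Z / v * (expR A' * (2 * (s ^+ p * v))) = expR Z * expR A' * 2 * s ^+ p.
    by move: (s ^+ p) => S; field; rewrite gt_eqF.
  apply: ler_wpM2r; first by rewrite exprn_ge0// ltW.
  apply: ler_wpM2l; first by rewrite mulr_ge0 ?expR_ge0.
  by rewrite -[X in X <= _]expr1; apply: ler_weXn2l => //; rewrite ler1n.
exact: final.
Qed.

End quadratic_penalty.

(** * The quasi-likelihood *)

Section whitening.
Context {R : realType} {n p : nat}.
Variables (mu : R) (nn : 'I_n -> R) (Psi : 'I_n -> 'cV[R]_p) (S : 'M[R]_p).
Let V1 := \sum_i nn i ^+ 2 *: (Psi i *m (Psi i)^T).
Hypothesis mu0 : 0 < mu.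
Hypothesis nn0 : forall i, 0 < nn i.
Hypothesis V1_gt0 : forall gamma, unit_sphere gamma -> 0 < qform V1 gamma.
Hypothesis sqrtS : is_sqrtmx (mu ^+ 2 *: V1) S.

(** The vector representing t_i as a linear form in u = sqrtV (theta - theta0). *)
Definition whitened (i : 'I_n) : 'cV[R]_p := (nn i * mu) *: (invmx S *m Psi i).

Let symS : S^T = S. Proof. by case: sqrtS. Qed.

Let sqrS : S *m S = mu ^+ 2 *: V1. Proof. by case: sqrtS. Qed.

Let V1_gt0' u : u != 0 -> 0 < qform V1 u.
Proof.
move=> u0; have e0 : 0 < enorm u.
  by rewrite lt_neqAle enorm_ge0 andbT eq_sym; apply: contra_neq u0; exact: enorm_eq0.
have uE : u = enorm u *: ((enorm u)^-1 *: u) by rewrite scalerA divff ?gt_eqF// scale1r.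
rewrite uE qformZ mulr_gt0 ?exprn_gt0//; apply: V1_gt0.
by rewrite /unit_sphere/= enormZ ger0_norm ?invr_ge0 ?enorm_ge0// mulVf// gt_eqF.
Qed.

Let unitS : S \in unitmx.
Proof.
apply: (unitmx_sqrt symS sqrS) => u u0.
by rewrite qform_scale mulr_gt0 ?exprn_gt0//; exact: V1_gt0'.
Qed.

Lemma dotp_whitened i v : dotp (whitened i) (S *m v) = mu * nn i * dotp (Psi i) v.
Proof. by rewrite dotpZl dotp_invmx// (mulrC mu). Qed.

Lemma qform_whitened v : qform (mu ^+ 2 *: V1) v = dotp (S *m v) (S *m v).
Proof. by rewrite -sqrS qform_sqr. Qed.

Lemma sum_sqr_dotp_whitened u : \sum_i dotp (whitened i) u ^+ 2 = dotp u u.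
Proof.
have -> : u = S *m (invmx S *m u) by rewrite mulmxA mulmxV// mul1mx.
rewrite -qform_whitened qform_scale qform_sum_dyads mulr_sumr.
by apply: eq_bigr => i _; rewrite dotp_whitened !exprMn mulrA.
Qed.

(** The ratio in the supremum is homogeneous in gamma; it is taken at the direction of v = S^(-1) u,
    where |u| is mu times the square root of [qform V1 v]. *)
Lemma normr_dotp_whitened_le (c l : R) i u : 0 < c ->
  (ereal_sup
    [set (c * (nn i * `|dotp gamma (Psi i)| / Num.sqrt (qform V1 gamma)))%:E
      | gamma in unit_sphere] <= l%:E)%E ->
  c * `|dotp (whitened i) u| <= l * enorm u.
Proof.
move=> c0 hl.
have [->|u0] := eqVneq u 0; first by rewrite dotp0r normr0 mulr0 enorm0 mulr0.
have uE : u = S *m (invmx S *m u) by rewrite mulmxA mulmxV// mul1mx.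
set v := invmx S *m u in uE.
have v0 : v != 0 by apply: contra_neq u0 => v0; rewrite uE v0 mulmx0.
have e0 : 0 < enorm v.
  by rewrite lt_neqAle enorm_ge0 andbT eq_sym; apply: contra_neq v0; exact: enorm_eq0.
pose gam := (enorm v)^-1 *: v.
have gam1 : unit_sphere gam.
  by rewrite /unit_sphere/= enormZ ger0_norm ?invr_ge0 ?enorm_ge0// mulVf// gt_eqF.
have vE : v = enorm v *: gam by rewrite scalerA divff ?gt_eqF// scale1r.
have q0 := V1_gt0 gam1.
have enE : enorm u = mu * enorm v * Num.sqrt (qform V1 gam).
  rewrite uE /enorm -qform_whitened qform_scale {1}vE qformZ.
  rewrite sqrtrM ?sqr_ge0// sqrtr_sqr ger0_norm ?ltW//.
  by rewrite sqrtrM ?sqr_ge0// sqrtr_sqr ger0_norm ?mulrA// ltW.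
have : c * (nn i * `|dotp gam (Psi i)| / Num.sqrt (qform V1 gam)) <= l.
  by rewrite -lee_fin; apply: le_trans hl; apply: ereal_sup_ubound; exists gam.
have s0 : 0 < Num.sqrt (qform V1 gam) by rewrite sqrtr_gt0.
rewrite !mulrA ler_pdivrMr// => h.
rewrite enE {1}uE dotp_whitened {1}vE dotpZr dotpC !normrM.
rewrite (gtr0_norm mu0) (gtr0_norm (nn0 i)) (gtr0_norm e0).
have -> : c * (mu * nn i * (enorm v * `|dotp gam (Psi i)|)) =
    (mu * enorm v) * (c * nn i * `|dotp gam (Psi i)|) by ring.
have -> : l * (mu * enorm v * Num.sqrt (qform V1 gam)) =
    (mu * enorm v) * (l * Num.sqrt (qform V1 gam)) by ring.
by rewrite ler_wpM2l// mulr_ge0// ltW.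
Qed.

End whitening.

(** All deterministic terms, those with [dd] included, are collected in [m0]. They enter the
    likelihood ratio and, with the opposite sign, the rate, so they cancel in the sum. The rate is
    seen to be finite on the way. *)
Lemma rate_centered d (T : measurableType d) (R : realType) (P : probability T R)
    (n p : nat) (Y : 'I_n -> T -> R) (b nn : 'I_n -> R) (Psi : 'I_n -> 'cV[R]_p)
    (mu L : R) (dd : R -> R) (g : 'I_n -> R -> R) (tau : 'I_n -> 'cV[R]_p)
    (theta theta0 u : 'cV[R]_p) :
  (forall i, 0 < nn i) ->
  (forall y : 'I_n -> R, (forall i, `|y i| <= 2 * L) ->
    (\int[P]_w (expR (\sum_i y i * ((Y i w - b i) / nn i)))%:E =
      (expR (\sum_i g i (y i)))%:E)%E) ->
  (forall i, measurable_fun setT (Y i)) ->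
  (forall i, dotp (tau i) u = mu * nn i * dotp (Psi i) (theta - theta0)) ->
  (forall i, `|dotp (tau i) u| <= 2 * L) ->
  exists m : R, rate P mu dd Psi Y theta theta0 = m%:E /\
    forall w, quasi_llr mu dd Psi Y theta theta0 w + m =
      centered_llr (fun i w => (Y i w - b i) / nn i) g tau u w.
Proof.
move=> nn0 mgf mY tauE tauL.
pose m0 := mu * \sum_i (b i * dotp (Psi i) (theta - theta0) -
  dd (dotp (Psi i) theta) + dd (dotp (Psi i) theta0)).
have llrE w : quasi_llr mu dd Psi Y theta theta0 w =
    m0 + \sum_i dotp (tau i) u * ((Y i w - b i) / nn i).
  rewrite /m0 /quasi_llr /quasi_lik -mulrBr -sumrB !mulr_sumr -big_split/=.
  apply: eq_bigr => i _; rewrite tauE dotpBr; field; exact/lt0r_neq0.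
have intE : (\int[P]_w (expR (quasi_llr mu dd Psi Y theta theta0 w))%:E =
    (expR (m0 + \sum_i g i (dotp (tau i) u)))%:E)%E.
  under eq_integral do rewrite llrE expRD EFinM.
  have me : measurable_fun setT (fun w =>
      (expR (\sum_i dotp (tau i) u * ((Y i w - b i) / nn i)))%:E).
    apply/measurable_EFinP; apply: measurableT_comp => //; apply: measurable_sum => i.
    apply: measurable_funM => //; apply: measurable_funM => //.
    exact: measurable_funB.
  rewrite ge0_integralZl// ?lee_fin ?expR_ge0//.
  by rewrite mgf// expRD EFinM.
exists (- (m0 + \sum_i g i (dotp (tau i) u))); split.
  by rewrite /rate unlock intE /= (lt_geF (expR_gt0 _)) expRK.
move=> w; rewrite llrE /centered_llr sumrB opprD addrACA subrr add0r.
by congr (_ - _); apply: eq_bigr => i _; rewrite mulrC.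
Qed.

(** Markov's inequality for a supremum over an arbitrary family; measurability is asked of the event
    alone. *)
Lemma sup_exponential_tail d (T : measurableType d) (R : realType)
    (P : probability T R) (A : set T) (F : T -> set (\bar R)) (r t : R) :
  measurable A -> 0 <= r -> (forall w, A w -> exists2 x, F w x & (t%:E <= x)%E) ->
  (P A <= (\int[P]_w expeR (r%:E * ereal_sup (F w))) * (expR (- (r * t)))%:E)%E.
Proof.
move=> mA r0 h.
have f0 w : (0 <= expeR (r%:E * ereal_sup (F w)))%E by exact: expeR_ge0.
have le := le_measure_integral P mA (expR_ge0 (r * t)) f0. rewrite expRN; apply: (@le_trans _ _
  ((expR (r * t))%:E * P A * (expR (r * t))^-1%:E)%E).
  by rewrite muleAC -EFinM divff ?mul1e// gt_eqF// expR_gt0.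
apply: lee_wpmul2r; first by rewrite lee_fin invr_ge0 expR_ge0.
apply: le => w /h[x Fx tx].
rewrite -[X in (X <= _)%E]/(expeR (r * t)%:E) lee_expeR EFinM.
apply: lee_wpmul2l; first by rewrite lee_fin.
by apply: le_trans tx _; exact: ereal_sup_ubound.
Qed.

Section measurable_quasi_likelihood.
Context d (T : measurableType d) (R : realType) (n p : nat).
Variables (mu : R) (dd : R -> R) (Psi : 'I_n -> 'cV[R]_p) (U : set R).
Hypothesis openU : open U.
Hypothesis smooth_dd : smooth_on U dd.

Lemma measurable_quasi_lik (Y : 'I_n -> T -> R) (th : T -> 'cV[R]_p) :
  (forall i, measurable_fun setT (Y i)) ->
  (forall j, measurable_fun setT (fun w => th w j 0)) ->
  (forall i w, U (dotp (Psi i) (th w))) ->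
  measurable_fun setT (fun w => quasi_lik mu dd Psi Y (th w) w).
Proof.
move=> mY mth thU.
have mdot i : measurable_fun setT (fun w => dotp (Psi i) (th w)).
  under eq_fun do rewrite dotpE.
  by apply: measurable_sum => j; exact: measurable_funM.
have mdd : measurable_fun U dd.
  apply: open_continuous_measurable_fun => // v; rewrite inE => Uv.
  apply: differentiable_continuous; apply/derivable1_diffP.
  exact: smooth_dd 0 v Uv.
apply: measurable_funM => //; apply: measurable_sum => i.
apply: measurable_funB; first exact: measurable_funM.
apply: (measurable_comp _ _ mdd (mdot i)).
  exact: open_measurable.
by move=> _ [w _ <-]; exact: thU.
Qed.

Lemma measurable_quasi_llr (Y : 'I_n -> T -> R) (th : T -> 'cV[R]_p) (theta0 : 'cV[R]_p) :
  (forall i, measurable_fun setT (Y i)) ->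
  (forall j, measurable_fun setT (fun w => th w j 0)) ->
  (forall i w, U (dotp (Psi i) (th w))) ->
  (forall i, U (dotp (Psi i) theta0)) ->
  measurable_fun setT (fun w => quasi_llr mu dd Psi Y (th w) theta0 w).
Proof.
move=> mY mth thU theta0U; apply: measurable_funB; first exact: measurable_quasi_lik.
by apply: measurable_quasi_lik.
Qed.

End measurable_quasi_likelihood.

(** The expectation inside the rate treats [th w] as a constant, so it is an integral over an
    independent copy: [th] reads the first coordinate of T x T and [Y] the second, and Tonelli gives
    measurability. Then z < rate means that this integral is below e^(-z). *)
Lemma measurable_rate_superlevel d (T : measurableType d) (R : realType)
    (P : probability T R) (n p : nat) (mu : R) (dd : R -> R) (Psi : 'I_n -> 'cV[R]_p)
    (U : set R) (Y : 'I_n -> T -> R) (th : T -> 'cV[R]_p) (theta0 : 'cV[R]_p) (z : R) :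
  open U -> smooth_on U dd ->
  (forall i, measurable_fun setT (Y i)) ->
  (forall j, measurable_fun setT (fun w => th w j 0)) ->
  (forall i w, U (dotp (Psi i) (th w))) ->
  (forall i, U (dotp (Psi i) theta0)) ->
  measurable [set w | (z%:E < rate P mu dd Psi Y (th w) theta0)%E].
Proof.
move=> openU sdd mY mth thU theta0U.
pose f (x : T * T) := (expR (quasi_llr mu dd Psi (fun i x => Y i x.2) (th x.1) theta0 x))%:E.
have mf : measurable_fun setT f.
  apply/measurable_EFinP; apply: measurableT_comp => //.
  apply: (@measurable_quasi_llr _ (T * T)%type R n p mu dd Psi U openU sdd
    (fun i x => Y i x.2) (fun x => th x.1) theta0) => //.
  - by move=> i; exact: measurableT_comp.
  - by move=> j; exact: (measurableT_comp (mth j)).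
have f0 x : (0 <= f x)%E by rewrite lee_fin expR_ge0.
have mI := @measurable_fun_fubini_tonelli_F _ _ T T R P f mf f0.
have key w : (z%:E < rate P mu dd Psi Y (th w) theta0)%E =
    (fubini_F P f w < (expR (- z))%:E)%E.
  have I0 : (0 <= fubini_F P f w)%E by apply: integral_ge0.
  rewrite -[fubini_F P f w]lneK ?in_itv/= ?leey ?andbT//.
  by rewrite -[(expR (- z))%:E]/(expeR (- z)%:E) lte_expeR /rate unlock lteNr.
under eq_set do rewrite key.
apply: measurable_preimage_true; exact: measurable_fun_lte.
Qed.

(** The exponent per dimension in [quadratic_penalty_majorant], with 1/a1 split off the last
    logarithm and a1 then replaced by its bound [abar]; the term ln(1 - rho)/2 offsets the factor (1
    - rho)^(-1/2) of the stated bound. *)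
Definition quasi_const (R : realType) (abar rho : R) : R :=
  (1 - rho) * ln (7 / 2) + 2 * rho ^+ 2 / (1 - rho) + rho * abar ^+ 2 + ln 2 +
  ln (abar / (1 - rho) + 2 / Num.sqrt (rho / 2)) + 2^-1 * ln (1 - rho).

Lemma quasi_const_ge (R : realType) (abar rho a1 : R) :
  0 < rho -> rho < 1 -> 0 < a1 -> a1 <= abar ->
  (1 - rho) * ln (7 / 2) + 2 * rho ^+ 2 / (1 - rho) + rho * a1 ^+ 2 + ln 2 +
    ln ((1 - rho)^-1 + 2 / (a1 * Num.sqrt (rho / 2))) <=
  quasi_const abar rho + ln (`|a1 ^+ 2 * (1 - rho)| `^ (- 2^-1)).
Proof.
move=> r0 r1 a0 aa.
have eta0 : 0 < 1 - rho by rewrite subr_gt0.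
have q0 : 0 < Num.sqrt (rho / 2) by rewrite sqrtr_gt0 divr_gt0.
have abar0 := lt_le_trans a0 aa.
have c0 : 0 < abar / (1 - rho) + 2 / Num.sqrt (rho / 2) by rewrite addr_gt0// divr_gt0.
have s0 : 0 < (1 - rho)^-1 + 2 / (a1 * Num.sqrt (rho / 2)).
  by rewrite addr_gt0 ?invr_gt0// divr_gt0// mulr_gt0.
rewrite ln_powR ger0_norm; last by rewrite mulr_ge0 ?sqr_ge0// ltW.
rewrite lnM ?posrE ?exprn_gt0// lnXn//.
have h1 : ln ((1 - rho)^-1 + 2 / (a1 * Num.sqrt (rho / 2))) + ln a1 <=
    ln (abar / (1 - rho) + 2 / Num.sqrt (rho / 2)).
  rewrite -lnM ?posrE// ler_ln ?posrE ?mulr_gt0// mulrDl; apply: lerD.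
    by rewrite mulrC ler_wpM2r// invr_ge0 ltW.
  rewrite le_eqVlt; apply/orP; left; apply/eqP; field.
  by rewrite !gt_eqF.
have h2 : rho * a1 ^+ 2 <= rho * abar ^+ 2.
  by rewrite ler_wpM2l ?(ltW r0)// ler_pXn2r// nnegrE ltW.
move: h1 h2; rewrite /quasi_const -[ln a1 *+ 2]mulr_natl.
move: (ln (_ + 2 / (a1 * _))) (ln (_ + 2 / Num.sqrt _)) (ln a1) => x1 x2 x3.
move: (rho * a1 ^+ 2) (rho * abar ^+ 2) (ln 2) => x4 x5 x6.
by move: (ln (1 - rho)) (_ + _ / (1 - rho)) => x7 x8; lra.
Qed.

Theorem theorem3p3 (R : realType) (abar : R) :
  exists C : R -> R,
  forall (disp : measure_display) (T : measurableType disp)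
    (P : probability T R) (n p : nat)
    (Y : 'I_n -> {RV P >-> R}) (Psi : 'I_n -> 'cV[R]_p)
    (Theta : set 'cV[R]_p) (U : set R) (d : R -> R)
    (b nn : 'I_n -> R) (theta0 : 'cV[R]_p)
    (mu lambda1 lambdas rho eps : R) (sqrtV : 'M[R]_p),
  let V1 := \sum_i nn i ^+ 2 *: (Psi i *m (Psi i)^T) in
  let V := mu ^+ 2 *: V1 in
  let L := quasi_llr mu d Psi Y in
  let M := rate P mu d Psi Y in
  (0 < p)%N ->
  open U -> is_interval U ->
  canonical_expfam U d -> convex_function U d -> smooth_on U d ->
  (forall i theta, Theta theta -> U (dotp (Psi i) theta)) ->
  mutually_independent P (fun i => Y i) ->
  (forall i, 'E_P[Y i] = (b i)%:E)%E ->
  is_argmax Theta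
    (fun theta => \sum_i (b i * dotp (Psi i) theta - d (dotp (Psi i) theta)))
    theta0 ->
  0 < lambda1 -> (forall i, 0 < nn i) ->
  (forall i lambda, `|lambda| <= lambda1 ->
    (lne 'E_P[fun w => expR (2 * lambda * ((Y i w - b i) / nn i))]
       <= (2 * lambda ^+ 2)%R%:E)%E) ->
  0 < mu ->
  (forall theta, Theta theta -> forall i,
    mu * nn i * `|dotp (Psi i) (theta - theta0)| <= lambda1) ->
  0 < lambdas ->
  (forall gamma, unit_sphere gamma -> 0 < qform V1 gamma) ->
  (forall i, (ereal_sup
    [set (lambdas * (nn i * `|dotp gamma (Psi i)| / Num.sqrt (qform V1 gamma)))%R%:E
      | gamma in unit_sphere] <= lambda1%:E)%E) ->
  is_sqrtmx V sqrtV ->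
  0 < rho < 1 -> 0 < eps -> rho * eps / (1 - rho) <= lambdas ->
  (forall kappa : R -> R,
    (forall t, 0 <= t -> 0 < kappa t) ->
    (forall t t', 0 <= t -> t <= t' -> kappa t' <= kappa t) ->
    (radial_mass p kappa < +oo)%E ->
    let pen theta :=
      - rho^-1 * ln (kappa (eps^-1 * enorm (sqrtV *m (theta - theta0)) + 1)) in
    (radial_mass p kappa =
      p%:R%:E * \int[lebesgue_measure]_(t in `[0%R, +oo[)
                  (kappa t * t ^+ p.-1)%:E)%E /\
    (lne (\int[P]_w expeR (ereal_sup
        [set rho%:E * ((L theta theta0 w)%:E + M theta theta0 - (pen theta)%:E)
          | theta in Theta])) <=
      (2 * eps ^+ 2 * rho ^+ 2 / (1 - rho))%:E
      + (1 - rho)%:E * entropy_number p + lne (radial_mass p kappa))%E) /\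
  (forall a : R, 0 < a ->
    (forall theta, Theta theta ->
      ((a ^+ 2 * qform V (theta - theta0))%:E <= M theta theta0)%E) ->
    forall a1 : R, 0 < a1 -> a1 <= a ->
    let s := 1 - a1 ^+ 2 / a ^+ 2 in
    (* Q(rho, s) is [frakQ a1], so that Q(rho, 0) is [frakQ a]. *)
    let frakQ (c : R) :=
      (\int[P]_w expeR (rho%:E * ereal_sup
        [set (L theta theta0 w)%:E + M theta theta0
             - (c ^+ 2 * qform V (theta - theta0))%R%:E | theta in Theta]))%E in
    let Q_rho_s := frakQ a1 in
    let Q_rho := frakQ a in
    (a1 <= abar ->
      (lne Q_rho_s <=
        (p%:R * C rho
         + p%:R * ln (`|a ^+ 2 * (1 - s) * (1 - rho)| `^ (- 2^-1)))%R%:E)%E) /\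
    (forall theta_hat : T -> 'cV[R]_p,
      (forall j, measurable_fun setT (fun w => theta_hat w j 0)) ->
      (forall w, is_argmax Theta
        (fun theta => quasi_lik mu d Psi Y theta w) (theta_hat w)) ->
      forall z : R, 0 < z ->
      (P [set w | (z%:E < M (theta_hat w) theta0)%E]
         <= Q_rho_s * (expR (- (rho * s * z)))%:E)%E /\
      (P [set w | ~ conf_set mu d Psi Y Theta theta_hat z w theta0]
         <= Q_rho * (expR (- (rho * z)))%:E)%E)).
Proof.
exists (quasi_const abar).
move=> disp T P n p Y Psi Theta U d b nn theta0 mu lambda1 lambdas rho eps sqrtV V1 V L M.
move=> p0 openU _ _ _ smooth_d psiU indY EY argmax0 l0 nn0 hmgf mu0 muL ls0 V1pos hsup.
move=> sqrtVE /andP[rho0 rho1] eps0 epsle.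
have [Th0 _] := argmax0.
have eta0 : 0 < 1 - rho by rewrite subr_gt0.
have [g [mX mgf gb gsub]] := standardized_family l0 nn0 indY EY hmgf.
pose tau := whitened mu nn Psi sqrtV.
have tauE u : \sum_i dotp (tau i) u ^+ 2 = dotp u u.
  exact: (sum_sqr_dotp_whitened mu0 V1pos sqrtVE).
pose u theta := sqrtV *m (theta - theta0).
have tauu i theta : dotp (tau i) (u theta) = mu * nn i * dotp (Psi i) (theta - theta0).
  exact: (dotp_whitened mu0 V1pos sqrtVE).
have uL i theta : Theta theta -> `|dotp (tau i) (u theta)| <= lambda1.
  move=> Tt; rewrite tauu normrM ger0_norm; first exact: muL.
  by rewrite mulr_ge0 ?ltW.
pose UU := u @` Theta.
have UU0 : UU !=set0 by exists (u theta0); exists theta0.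
have UUL x i : UU x -> `|dotp (tau i) x| <= lambda1.
  by move=> [theta Tt <-]; exact: uL.
pose X i w := (Y i w - b i) / nn i.
have LM theta : Theta theta -> exists m, M theta theta0 = m%:E /\
    forall w, L theta theta0 w + m = centered_llr X g tau (u theta) w.
  move=> Tt; apply: (rate_centered d nn0 mgf) => // i; apply: le_trans (uL i _ Tt) _.
  lra.
have qV theta : qform V (theta - theta0) = dotp (u theta) (u theta).
  exact: (qform_whitened sqrtVE).
split.
  move=> kappa k0 kd kint pen; split; first exact: radial_massE.
  (* On the ball |t_i| <= lambda1 eps / lambdas, and the condition on [eps] says eps / lambdas <= (1
     - rho)/rho. *)
  have Bt z i : enorm z <= eps -> `|dotp (tau i) z| <= (1 - rho) / rho * lambda1.
    move=> ze; have := normr_dotp_whitened_le mu0 nn0 V1pos sqrtVE z ls0 (hsup i).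
    rewrite -/tau -ler_pdivlMl// => /le_trans; apply.
    rewrite ler_pdivrMl//.
    have h1 := ler_wpM2l (ltW l0) ze; apply: le_trans h1 _.
    move: epsle; rewrite ler_pdivrMr// => h2.
    have -> : lambdas * ((1 - rho) / rho * lambda1) = lambda1 * (lambdas * (1 - rho) / rho).
      by ring.
    apply: ler_wpM2l; first exact: ltW.
    by rewrite ler_pdivlMr// mulrC.
  have [bnd [bnd0 bndge bndle]] := penalized_ball_majorant p0 l0 mX mgf gb gsub tauE rho0 rho1
    UU0 UUL eps0 Bt k0 kd.
  pose I := (\int[P]_w expeR (ereal_sup
        [set (rho%:E * ((L theta theta0 w)%:E + M theta theta0 - (pen theta)%:E))%E
          | theta in Theta]))%E.
  rewrite -/I.
  have I0 : (0 <= I)%E by apply: integral_ge0 => w _; exact: expeR_ge0.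
  have Ile : (I <= \int[P]_w bnd w)%E.
    apply: ge0_le_integral_lower => w; first exact: expeR_ge0.
    apply: expeR_ereal_sup_le => // _ [theta Tt <-].
    have [m [mE Lm]] := LM _ Tt; rewrite mE.
    rewrite -[X in (X <= _)%E]/((expR (rho * (L theta theta0 w + m - pen theta)))%:E) Lm.
    apply: le_trans (bndge (u theta) w _); last by exists theta.
    by rewrite lee_fin ler_expR mulrBr /pen mulNr mulrN opprK mulVKf ?gt_eqF.
  move: I0 {Ile} (le_trans Ile bndle) => I0 Ile.
  move: kint Ile; have : (0 <= radial_mass p kappa)%E.
    apply: mule_ge0; first by rewrite inve_ge0 ltW// ball_volume_gt0.
    by apply: integral_ge0 => z _; rewrite lee_fin ltW// k0// enorm_ge0.
  case: (radial_mass p kappa) => // m; rewrite lee_fin => m0 _.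
  rewrite -EFinM => Ile.
  have [m00|m1] := eqVneq m 0.
    have -> : I = 0%E by apply/eqP; rewrite eq_le I0 andbT; rewrite m00 mulr0 in Ile.
    by rewrite le0_lneNy// leNye.
  have {m0 m1}m0 : 0 < m by rewrite lt_neqAle eq_sym m1.
  apply: (@le_trans _ _ (lne (expR ((1 - rho) * (p%:R * ln (7 / 2)) +
      2 * eps ^+ 2 * rho ^+ 2 / (1 - rho)) * m)%:E)).
    by rewrite lee_lne// in_itv/= leey andbT// lee_fin mulr_ge0 ?expR_ge0// ltW.
  rewrite /= (lt_geF (mulr_gt0 (expR_gt0 _) m0)) (lt_geF m0).
  rewrite lnM ?posrE ?expR_gt0// expRK EFinD; apply: leeD2r.
  rewrite addrC EFinD; apply: leeD2l; rewrite EFinM; apply: lee_wpmul2l.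
    by rewrite lee_fin ltW.
  exact: entropy_number_ge.
move=> a a0 aM a1 a10 a1a s frakQ Q_rho_s Q_rho; split.
  move=> a1abar.
  have [bnd [bnd0 bndge bndle]] := quadratic_penalty_majorant p0 l0 mX mgf gb gsub tauE
    rho0 rho1 UU0 UUL a10 erefl.
  have Q0 : (0 <= Q_rho_s)%E by apply: integral_ge0 => w _; exact: expeR_ge0.
  have Qle : (Q_rho_s <= \int[P]_w bnd w)%E.
    apply: ge0_le_integral_lower => w; first exact: expeR_ge0.
    apply: expeR_mul_ereal_sup_le => // _ [theta Tt <-].
    have [m [mE Lm]] := LM _ Tt; rewrite mE qV.
    rewrite -[X in (X <= _)%E]/((expR (rho * (L theta theta0 w + m -
      a1 ^+ 2 * dotp (u theta) (u theta))))%:E) Lm.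
    by apply: bndge; exists theta.
  have {}Qle := le_trans Qle bndle.
  apply: (@le_trans _ _ (lne (expR (p%:R * ((1 - rho) * ln (7 / 2) +
      2 * rho ^+ 2 / (1 - rho) + rho * a1 ^+ 2 + ln 2 +
      ln ((1 - rho)^-1 + 2 / (a1 * Num.sqrt (rho / 2))))))%:E)).
    by rewrite lee_lne// in_itv/= leey andbT// lee_fin expR_ge0.
  rewrite /= (lt_geF (expR_gt0 _)) expRK lee_fin -mulrDr; apply: ler_wpM2l => //.
  have -> : a ^+ 2 * (1 - s) = a1 ^+ 2.
    by rewrite /s; field; rewrite gt_eqF.
  exact: quasi_const_ge.
move=> th mth thmax z z0.
have Tth w : Theta (th w) by have [] := thmax w.
have thU i w : U (dotp (Psi i) (th w)) by exact: psiU.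
have th0U i : U (dotp (Psi i) theta0) by exact: psiU.
have mY i : measurable_fun setT (Y i) by [].
have Lth w : 0 <= L (th w) theta0 w.
  by rewrite /L /quasi_llr subr_ge0; have [_] := thmax w; exact.
have s0 : 0 <= s.
  by rewrite subr_ge0 ler_pdivrMr ?exprn_gt0// mul1r ler_pXn2r// nnegrE ltW.
have saE : a1 ^+ 2 = (1 - s) * a ^+ 2.
  by rewrite /s; field; rewrite gt_eqF.
have s1 : 0 <= 1 - s.
  by rewrite /s opprB addrCA subrr addr0 divr_ge0// sqr_ge0.
split.
  rewrite -mulrA; apply: (@sup_exponential_tail _ _ _ _ _ _ _ (s * z)).
  - exact: (@measurable_rate_superlevel _ _ _ P n p mu d Psi U (fun i => Y i) th theta0 z
      openU smooth_d mY mth thU th0U).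
  - exact: ltW.
  - move=> w /=; have [m [mE Lm]] := LM _ (Tth w).
    have := aM _ (Tth w); rewrite -/M mE !lee_fin lte_fin => am zm.
    exists ((L (th w) theta0 w)%:E + M (th w) theta0 -
        (a1 ^+ 2 * qform V (th w - theta0))%:E)%E; first by exists (th w).
    rewrite mE -[X in (_ <= X)%E]/((L (th w) theta0 w + m -
      a1 ^+ 2 * qform V (th w - theta0))%:E) lee_fin saE -mulrA.
    (* The ratio is nonnegative at the maximizer, and a1^2 = (1 - s) a^2 makes the quadratic term at
       most (1 - s) M; what is left is at least s M >= s z. *)
    have h1 := ler_wpM2l s1 am; have h2 := ler_wpM2l s0 (ltW zm); have := Lth w.
    lra.
apply: sup_exponential_tail.
- rewrite (_ : [set w | _] = [set w | z < L (th w) theta0 w]); last first.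
    apply/seteqP; split => w /=.
      by move=> h; rewrite ltNge; apply/negP => h'; apply: h; split.
    by move=> h [_]; rewrite leNgt h.
  apply: measurable_preimage_true; apply: measurable_fun_ltr => //.
  exact: (measurable_quasi_llr mu openU smooth_d mY mth thU th0U).
- exact: ltW.
- move=> w /= h; have [m [mE Lm]] := LM _ (Tth w).
  have := aM _ (Tth w); rewrite -/M mE lee_fin => am.
  have zL : z < L (th w) theta0 w.
    by rewrite ltNge; apply/negP => h'; apply: h; split.
  (* Here the ratio alone exceeds z, and M dominates the quadratic term. *)
  exists ((L (th w) theta0 w)%:E + M (th w) theta0 -
      (a ^+ 2 * qform V (th w - theta0))%:E)%E; first by exists (th w).
  rewrite mE -[X in (_ <= X)%E]/((L (th w) theta0 w + m -
      a ^+ 2 * qform V (th w - theta0))%:E) lee_fin; lra.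
Qed.
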